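(* Let $k$ be a quadratic étale algebra over $\mathbb{Q}$, $m\ge1$, and $\chi$ a character of $Cl_{k,m}$ of conductor $f$. Then \[ L(s,\chi,\mathcal{O}_{k,m})=\sum_{f\mid m'\mid m}\frac{|U(\mathcal{O}_{k,m'},\mathcal{O}_{k,m})|}{(m/m')^{2s}}\,L^*(s,\chi,\mathcal{O}_{k,m'}), \] where for $f\mid m'$, $\chi$ on the right denotes the character of $Cl_{k,m'}$ inducing $\chi$. In particular, if $\chi$ is a primitive character of $Cl_{k,m}$, then $L(s,\chi,\mathcal{O}_{k,m})=L^*(s,\chi,\mathcal{O}_{k,m})$.
   Context: A quadratic étale algebra $k$ over $\mathbb{Q}$ is a quadratic field or $\mathbb{Q}\oplus\mathbb{Q}$. $\mathcal{O}_k$ is its maximal order, $\mathcal{O}_{k,m}=\mathbb{Z}\cdot1+m\mathcal{O}_k$ (conductor $m\mathcal{O}_k$). Fractional ideals of an order $\mathcal{O}$ are rank-2 $\mathbb{Z}$-submodules $\mathfrak a$ of $k$ with $\mathcal{O}\mathfrak a=\mathfrak a$; invertible if $\mathfrak a\mathfrak b=\mathcal{O}$ for some fractional $\mathfrak b$. $Cl_{k,m}$: invertible $\mathcal{O}_{k,m}$-ideals modulo principal ideals $\alpha\mathcal{O}_{k,m}$, $\alpha\in k^*$. $\mathbf N\mathfrak a=[\mathcal{O}:\mathfrak a]$ for integral invertible $\mathfrak a$. For $m'\mid m$, $\varphi_{k,m',m}:Cl_{k,m}\to Cl_{k,m'}$, $[\mathfrak a]\mapsto[\mathfrak a\mathcal{O}_{k,m'}]$;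 $\chi$ is defined at $Cl_{k,m'}$ if $\chi=\chi'\circ\varphi_{k,m',m}$ for a character $\chi'$ of $Cl_{k,m'}$; the conductor of $\chi$ is the gcd of all such $m'$ ($\chi$ is defined at $Cl_{k,m'}$ exactly when the conductor divides $m'$); $\chi$ is primitive if its conductor is $m$. $U(\mathcal{O}_{k,m'},\mathcal{O}_{k,m})$ is the group of invertible $\mathcal{O}_{k,m}$-ideals $\mathfrak a$ with $\mathfrak a\mathcal{O}_{k,m'}=\mathcal{O}_{k,m'}$. $L(s,\chi,\mathcal{O}_{k,m})=\sum\chi([\mathfrak a])\mathbf N\mathfrak a^{-s}$ over integral invertible $\mathcal{O}_{k,m}$-ideals; $L^*(s,\chi,\mathcal{O}_{k,m})$ is the same sum over integral ideals $\mathfrak a$ with $\mathfrak a+m\mathcal{O}_k=\mathcal{O}_{k,m}$. *)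

(* Defs.v *)
From HB Require Import structures.
From mathcomp Require Import all_boot all_order all_algebra.
From mathcomp Require Import finmap.
From mathcomp Require Import complex.
From mathcomp Require Import all_classical all_reals all_analysis.

Set Implicit Arguments.
Unset Strict Implicit.
Unset Printing Implicit Defensive.
Import Order.TTheory GRing.Theory Num.Theory.
Local Open Scope classical_set_scope.
Local Open Scope ring_scope.

(* The cardinality of a finite set, and 0 for an infinite one. *)
Definition set_card (T : choiceType) (A : set T) : nat := #|` fset_set A |%fset.

Definition quadratic_field (k : comUnitAlgType rat) : Prop :=
  (exists v : {linear k -> 'rV[rat]_2}, bijective v) /\
  (forall x : k, x != 0 -> x \is a GRing.unit).

(* A ring isomorphism between algebras over the rationals is rat-linear. *)
Definition split_quadratic (k : comUnitAlgType rat) : Prop :=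
  exists u : {rmorphism k -> (rat * rat)%type}, bijective u.

Definition quadratic_etale (k : comUnitAlgType rat) : Prop :=
  quadratic_field k \/ split_quadratic k.

Section Ideals.
Variable k : comUnitAlgType rat.
Implicit Types (O a b : set k) (m : nat).

(* Free Z-modules of rank 2; inside a two-dimensional k, linear independence
   over Z and over the rationals are the same. *)
Definition lattice a : Prop :=
  exists b1 b2 : k,
    (forall p q : rat, p *: b1 + q *: b2 = 0 -> p = 0 /\ q = 0) /\
    a = [set x | exists i j : int, x = b1 *~ i + b2 *~ j].

Definition lat_mul a b : set k :=
  [set x | exists s : seq (k * k),
     (forall p, p \in s -> a p.1 /\ b p.2) /\ x = \sum_(p <- s) p.1 * p.2].

Definition lat_add a b : set k := [set x + y | x in a & y in b].

Definition lat_scale (alpha : k) a : set k := [set alpha * x | x in a].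

Definition is_order O : Prop :=
  [/\ lattice O, O 1 & forall x y, O x -> O y -> O (x * y)].

Definition is_maximal_order O : Prop :=
  is_order O /\ forall O', is_order O' -> O `<=` O' -> O' = O.

(* The order Z.1 + m Ok; Ok is meant to be the maximal order. *)
Definition suborder (Ok : set k) m : set k :=
  [set x | exists (i : int) (y : k), Ok y /\ x = i%:~R + y *+ m].

Definition fractional_ideal O a : Prop := lattice a /\ lat_mul O a = a.

Definition invertible_ideal O a : Prop :=
  fractional_ideal O a /\
  exists b, fractional_ideal O b /\ lat_mul a b = O.

(* The index [O : a], as the number of cosets x + a with x in O. *)
Definition lat_index O a : nat :=
  set_card [set [set x + y | y in a] | x in O].

(* The class of a modulo principal ideals, as a set of ideals. *)
Definition ideal_class O a : set (set k) :=
  [set b | invertible_ideal O b /\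
     exists2 alpha : k, alpha \is a GRing.unit &
       b = lat_mul (lat_scale alpha O) a].

(* U(O', O) *)
Definition Ugroup O' O : set (set k) :=
  [set a | invertible_ideal O a /\ lat_mul a O' = O'].

End Ideals.

Section Characters.
Variables (R : realType) (k : comUnitAlgType rat).
Implicit Types (O : set k) (chi : set (set k) -> R[i]).

(* A character of the class group of O is represented by a function on sets of
   ideals; only its values at the classes ideal_class O a, with a an invertible
   O-ideal, are meaningful.  The values are nonzero by multiplicativity. *)
Definition is_character O chi : Prop :=
  chi (ideal_class O O) = 1 /\
  forall a b, invertible_ideal O a -> invertible_ideal O b ->
    chi (ideal_class O (lat_mul a b)) =
    chi (ideal_class O a) * chi (ideal_class O b).

(* chi' is a character of the class group of O', and chi is its composition
   with the map [a] |-> [a O'] from the class group of O. *)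
Definition induced_from O O' chi chi' : Prop :=
  is_character O' chi' /\
  forall a, invertible_ideal O a ->
    chi (ideal_class O a) = chi' (ideal_class O' (lat_mul a O')).

Definition inducing O O' chi : set (set k) -> R[i] :=
  xget (fun=> 0) [set chi' | induced_from O O' chi chi'].

Definition defined_at (Ok : set k) (m : nat) chi (m' : nat) : Prop :=
  exists chi', induced_from (suborder Ok m) (suborder Ok m') chi chi'.

Definition conductor (Ok : set k) (m : nat) chi : nat :=
  \big[gcdn/0%N]_(m' <- divisors m | `[< defined_at Ok m chi m' >]) m'.

End Characters.

Section LSeries.
Variables (R : realType) (k : comUnitAlgType rat).

(* Unordered sum of an absolutely convergent family. *)
Definition rsum (T : choiceType) (D : set T) (f : T -> R) : R :=
  fine (\esum_(i in D) (Num.max (f i) 0)%:E) -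
  fine (\esum_(i in D) (Num.max (- f i) 0)%:E).

Definition csum (T : choiceType) (D : set T) (f : T -> R[i]) : R[i] :=
  (rsum D (fun i => complex.Re (f i)) +i* rsum D (fun i => complex.Im (f i)))%C.

(* n ^ s = exp (s * ln n), for n > 0 *)
Definition natpowC (n : nat) (s : R[i]) : R[i] :=
  let t : R := ln n%:R in
  ((expR (complex.Re s * t) * cos (complex.Im s * t)) +i*
   (expR (complex.Re s * t) * sin (complex.Im s * t)))%C.

Definition Lseries (O : set k) (chi : set (set k) -> R[i]) (s : R[i]) : R[i] :=
  csum [set a | invertible_ideal O a /\ a `<=` O]
    (fun a => chi (ideal_class O a) / natpowC (lat_index O a) s).

(* The ideals a with a + m Ok = O, where O = Z.1 + m Ok, are automatically
   invertible. *)
Definition Lseries_star (Ok : set k) (m : nat) (chi : set (set k) -> R[i])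
    (s : R[i]) : R[i] :=
  let O := suborder Ok m in
  csum [set a | [/\ fractional_ideal O a, a `<=` O &
                    lat_add a [set y *+ m | y in Ok] = O]]
    (fun a => chi (ideal_class O a) / natpowC (lat_index O a) s).

End LSeries.

(* Main.v *)
(* Write O_m = Z + m O_k.  An invertible integral O_m-ideal a satisfies
   a + m O_k = d O_{m'} with m = m' d, and then a O_{m'} = d b for an integral
   O_{m'}-ideal b with b + m' O_k = O_{m'}.  Conversely the ideals a lying over a
   given b form a coset of U(O_{m'}, O_m), all of index d^2 N b, so that the
   character sum over this coset is |U(O_{m'}, O_m)| chi(b) or 0, according as chi is
   trivial on U(O_{m'}, O_m), i.e. defined at Cl_{k,m'}, or not.  Since
   U(O_{gcd(m1,m2)}, O_m) = U(O_{m1}, O_m) U(O_{m2}, O_m), the first case is that of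
   f | m'.

   An invertible ideal is locally principal, because a primitive quadratic form
   represents integers prime to any given d; this gives the surjectivity of
   a |-> a O_{m'}.  The index is preserved by a |-> a O_{m'}, because
   a * conj(a) = [O : a] O for invertible a.

   Rearranging the series needs absolute convergence.  The class group is finite, so
   |chi| = 1.  The ideals of index e^2 A correspond to the roots modulo A of a
   quadratic polynomial of discriminant D, of which there are at most |D| times
   the number of divisors of A; this bounds the series by |D| zeta(sigma)^3. *)

Require Import Defs.
From HB Require Import structures.
From mathcomp Require Import all_boot all_order all_algebra.
From mathcomp Require Import finmap.
From mathcomp Require Import complex.
From mathcomp Require Import all_classical all_reals all_analysis.
From mathcomp Require Import ring lra zify.

Set Implicit Arguments.
Unset Strict Implicit.
Unset Printing Implicit Defensive.
Import Order.TTheory GRing.Theory Num.Theory.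
Local Open Scope classical_set_scope.
Local Open Scope ring_scope.

(** * Products of additive subgroups *)

Section Subgroups.
Variable k : comUnitAlgType rat.
Implicit Types (a b c : set k) (x y : k).

(** Localization is replaced by congruences. That [a] is principal at the primes dividing d is
    expressed by [x * y = 1 + d z] with x in [a] and y in its inverse. If b is an O_m-ideal with
    such x and y, then Z x + d b is a lift of b to O_{md}, and Z y + d b^-1 is the inverse of that
    lift. The same construction over O_k describes U(O_{m'}, O_m) by units of O_{m'} / m O_k, and
    the statement about gcd(m1, m2) becomes a computation with an idempotent modulo m. The conductor
    is defined as a gcd, so it is not immediate that chi is defined at it; this is what the product
    formula for U provides. The series is not cut into the infinitely many cosets of ideals over one
    b, but into finitely many pieces, one for each m' and each u in U(O_{m'}, O_m), in which b
    varies. The character of Cl_{k,m'} exists only if f divides m', so the pieces are written with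
    chi at a chosen lift of b. The field case and the split case are separated once, on the way to
    the integral basis (1, w) of O_k. After that the arithmetic takes place in integer coordinates,
    with w^2 = t w - n. *)

Definition zsub a := a 0 /\ forall x y, a x -> a y -> a (x - y).

Lemma zsub0 a : zsub a -> a 0. Proof. by case. Qed.

Lemma zsubB a : zsub a -> forall x y, a x -> a y -> a (x - y).
Proof. by case=> _; apply. Qed.

Lemma zsubN a : zsub a -> forall x, a x -> a (- x).
Proof. by move=> ha x ax; rewrite -sub0r; apply: (zsubB ha) => //; case: ha. Qed.

Lemma zsubD a : zsub a -> forall x y, a x -> a y -> a (x + y).
Proof.
by move=> ha x y ax ay; rewrite -[y]opprK; apply: (zsubB ha) => //; apply: zsubN.
Qed.

Lemma zsubMnl a : zsub a -> forall (i : nat) x, a x -> a (i%:R * x).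
Proof.
move=> ha i x ax; elim: i => [|i IH]; first by rewrite mul0r; case: ha.
by rewrite mulrS mulrDl mul1r; apply: (zsubD ha).
Qed.

Lemma zsubMz a : zsub a -> forall (i : int) x, a x -> a (i%:~R * x).
Proof.
move=> ha [i|i] x ax; first exact: (zsubMnl ha).
by rewrite NegzE mulrNz mulNr; apply/(zsubN ha)/(zsubMnl ha).
Qed.

Lemma zsub_sum a : zsub a -> forall (T : eqType) (s : seq T) (F : T -> k),
  (forall i, i \in s -> a (F i)) -> a (\sum_(i <- s) F i).
Proof.
move=> ha T; elim=> [|i s IH] F h; first by rewrite big_nil; case: ha.
rewrite big_cons; apply: (zsubD ha); first by apply: h; rewrite mem_head.
by apply: IH => j js; apply: h; rewrite inE js orbT.
Qed.

Lemma lat_mulP a b x y : a x -> b y -> lat_mul a b (x * y).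
Proof.
move=> ax by_; exists [:: (x, y)]; rewrite big_seq1; split => // p.
by rewrite inE => /eqP ->.
Qed.

Lemma lat_mul_sub a b c : zsub c ->
  (forall x y, a x -> b y -> c (x * y)) -> lat_mul a b `<=` c.
Proof.
by move=> hc h z [s [hs ->]]; apply: zsub_sum => // p /hs [? ?]; apply: h.
Qed.

Lemma lat_mul_zsub a b : zsub a -> zsub (lat_mul a b).
Proof.
move=> ha; split; first by exists [::]; rewrite big_nil; split.
move=> x y [s [hs ->]] [s' [hs' ->]].
exists (s ++ [seq (- p.1, p.2) | p <- s']); split.
  move=> p; rewrite mem_cat => /orP [/hs //|/mapP [q /hs' [? ?] -> /=]].
  by split=> //; apply: zsubN.
rewrite big_cat big_map /=; congr (_ + _); rewrite -sumrN.
by apply: eq_bigr => p _; rewrite mulNr.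
Qed.

Lemma lat_mulC a b : lat_mul a b = lat_mul b a.
Proof.
suff H a' b' : lat_mul a' b' `<=` lat_mul b' a' by apply/seteqP; split; apply: H.
move=> x [s [hs ->]]; exists [seq (p.2, p.1) | p <- s]; split.
  by move=> p /mapP [q /hs [? ?] ->].
by rewrite big_map; apply: eq_bigr => p _; rewrite mulrC.
Qed.

Lemma lat_mulA a b c : zsub a -> zsub b -> zsub c ->
  lat_mul a (lat_mul b c) = lat_mul (lat_mul a b) c.
Proof.
move=> ha hb hc; apply/seteqP; split.
  apply: lat_mul_sub; first by apply: lat_mul_zsub; apply: lat_mul_zsub.
  move=> x y ax [s [hs ->]]; rewrite mulr_sumr; apply: zsub_sum.
    by apply: lat_mul_zsub; apply: lat_mul_zsub.
  move=> p /hs [? ?]; rewrite mulrA; apply: lat_mulP => //.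
  exact: lat_mulP.
apply: lat_mul_sub; first exact: lat_mul_zsub.
move=> x y [s [hs ->]] cy; rewrite mulr_suml; apply: zsub_sum.
  exact: lat_mul_zsub.
move=> p /hs [? ?]; rewrite -mulrA; apply: lat_mulP => //.
exact: lat_mulP.
Qed.

Lemma lat_scale_zsub x a : zsub a -> zsub (lat_scale x a).
Proof.
move=> ha; split; first by exists 0; [apply: zsub0|rewrite mulr0].
by move=> _ _ [y ay <-] [z az <-]; exists (y - z); [apply: zsubB|rewrite mulrBr].
Qed.

Lemma lat_mul_scale x a b : zsub a -> zsub b ->
  lat_mul (lat_scale x a) b = lat_scale x (lat_mul a b).
Proof.
move=> ha hb; apply/seteqP; split.
  apply: lat_mul_sub; first by apply: lat_scale_zsub; apply: lat_mul_zsub.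
  move=> _ y [z az <-] by_; exists (z * y); last by rewrite mulrA.
  exact: lat_mulP.
move=> _ [_ [s [hs ->]] <-]; rewrite mulr_sumr; apply: zsub_sum.
  by apply: lat_mul_zsub; apply: lat_scale_zsub.
move=> p /hs [? ?]; rewrite mulrA; apply: lat_mulP => //.
by exists p.1.
Qed.

Lemma lat_scale1 a : lat_scale 1 a = a.
Proof.
apply/seteqP; split=> [_ [x ax <-]|x ax]; first by rewrite mul1r.
by exists x; rewrite ?mul1r.
Qed.

Lemma lat_scaleA x y a : lat_scale x (lat_scale y a) = lat_scale (x * y) a.
Proof.
apply/seteqP; split=> [_ [_ [z az <-] <-]|_ [z az <-]].
  by exists z; rewrite ?mulrA.
by exists (y * z); rewrite ?mulrA //; exists z.
Qed.

Lemma lat_scale_inj x a b : x \is a GRing.unit ->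
  lat_scale x a = lat_scale x b -> a = b.
Proof.
move=> ux /(congr1 (lat_scale x^-1)).
by rewrite !lat_scaleA mulVr // !lat_scale1.
Qed.

Lemma natr_unit (N : nat) : (0 < N)%N -> (N%:R : k) \is a GRing.unit.
Proof.
move=> N0; rewrite -scaler_nat scaler_unit ?unitr1 //.
by rewrite unitfE pnatr_eq0 -lt0n.
Qed.

Lemma intr_unit (i : int) : i != 0 -> (i%:~R : k) \is a GRing.unit.
Proof.
case: i => i i0; first by apply: natr_unit; rewrite lt0n.
by rewrite NegzE mulrNz unitrN; apply: natr_unit.
Qed.

End Subgroups.
(** * Orders in a quadratic algebra *)

Lemma natz_mul_eq1 (g : nat) (i : int) : g%:Z * i = 1 -> g = 1%N.
Proof.
move=> /(congr1 absz); rewrite abszM /= => h; apply/eqP; rewrite -dvdn1.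
by apply/dvdnP; exists `|i|%N; rewrite mulnC.
Qed.

Section PrincipalInt.
Variable P : set int.
Hypothesis (P0 : P 0) (PB : forall i j, P i -> P j -> P (i - j)).

Let PM (i j : int) : P i -> P (j * i).
Proof.
have PN l : P l -> P (- l) by move=> Pl; rewrite -sub0r; apply: PB.
have Pn (l : nat) : P i -> P (l%:Z * i).
  move=> Pi; elim: l => [|l IH]; first by rewrite mul0r.
  have -> : l.+1%:Z * i = l%:Z * i - - i by rewrite -addn1 PoszD; ring.
  by apply: PB => //; apply: PN.
by case: j => j Pi; [apply: Pn|rewrite NegzE mulNr; apply/PN/Pn].
Qed.

(** The generator is the least positive element, by Euclidean division; [N] certifies that there is
    a positive one. *)
Lemma int_subgroup (N : nat) : (0 < N)%N -> P N%:Z ->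
  exists g : nat, (0 < g)%N /\ forall i, P i <-> (g%:Z %| i)%Z.
Proof.
move=> N0 PN.
have ex : exists g : nat, (0 < g)%N && `[< P g%:Z >].
  by exists N; rewrite N0; apply/asboolP.
case: (ex_minnP ex) => g /andP [g0 /asboolP Pg] gmin; exists g; split=> // i.
split=> [Pi|/dvdzP [q ->]]; last exact: PM.
have Pr : P (i %% g)%Z.
  have -> : (i %% g)%Z = i - (i %/ g)%Z * g by rewrite {2}(divz_eq i g); ring.
  by apply: PB => //; apply: PM.
apply/dvdz_mod0P; have gN0 : g%:Z != 0 by rewrite lt0r_neq0.
have r0 := modz_ge0 i gN0; have rg := ltz_pmod i (_ : 0 < g%:Z).
case E : (i %% g)%Z r0 rg Pr => [r|//] _ /(_ g0) rg Pr.
case: r {E} rg Pr => // r rg Pr.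
by have := gmin r.+1; rewrite /= asboolT // => /(_ isT); move: rg; lia.
Qed.

End PrincipalInt.

(* Integral basis (1, w) of the maximal order.  The last field is maximality in the
   form in which it is used: Z[(b + w) / g] is a ring only for g = 1. *)
Record quadratic_basis (k : comUnitAlgType rat) := QuadraticBasis {
  qw : k; qt : int; qn : int;
  qw2 : qw * qw = qt%:~R * qw - qn%:~R;
  qfree : forall i j : int, i%:~R + j%:~R * qw = 0 -> i = 0 /\ j = 0;
  qspan : forall x : k, exists N : nat, (0 < N)%N /\
            exists i j : int, N%:R * x = i%:~R + j%:~R * qw;
  qdisc : qt ^+ 2 - 4 * qn != 0;
  qmax : forall (th : k) (g : nat) (b u v : int), (0 < g)%N ->
    g%:R * th = b%:~R + qw -> th * th = u%:~R * th - v%:~R -> g = 1%N }.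

Section Orders.
Variables (k : comUnitAlgType rat) (Q : quadratic_basis k).
Implicit Types (a b c : set k) (x y : k) (m d : nat).
Notation w := (qw Q).
Notation t := (qt Q).
Notation n := (qn Q).

(** The order of conductor m in coordinates; [suborder_ord] identifies it with
    [suborder (ord 1) m]. *)
Definition ord m : set k :=
  [set x | exists i j : int, x = i%:~R + j%:~R * (m%:R * w)].

Lemma ord_zsub m : zsub (ord m).
Proof.
split; first by exists 0, 0; ring.
by move=> _ _ [i [j ->]] [i' [j' ->]]; exists (i - i'), (j - j'); ring.
Qed.

Lemma ord_int m (i : int) : ord m i%:~R.
Proof. by exists i, 0; ring. Qed.

Lemma ord1 m : ord m 1.
Proof. exact: (ord_int m 1). Qed.

Lemma ord_w m : ord m (m%:R * w).
Proof. by exists 0, 1; ring. Qed.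

Lemma ordM m x y : ord m x -> ord m y -> ord m (x * y).
Proof.
move=> [i [j ->]] [i' [j' ->]].
exists (i * i' - j * j' * m%:Z * m%:Z * n).
exists (i * j' + j * i' + j * j' * m%:Z * t).
ring: (qw2 Q).
Qed.

Lemma ord_sub m m' : (m' %| m)%N -> ord m `<=` ord m'.
Proof.
move=> /dvdnP [d ->] _ [i [j ->]].
by exists i, (j * d%:Z); rewrite natrM; ring.
Qed.

Lemma ord_cond m x : ord 1 x -> ord m (m%:R * x).
Proof. by move=> [i [j ->]]; exists (i * m%:Z), j; ring. Qed.

Lemma ordP m x : ord m x <-> exists (i : int) y, ord 1 y /\ x = i%:~R + m%:R * y.
Proof.
split=> [[i [j ->]]|[i [y [hy ->]]]].
  by exists i, (j%:~R * w); split; [exists 0, j; ring|ring].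
by apply: (zsubD (ord_zsub m)); [apply: ord_int|apply: ord_cond].
Qed.

Lemma ord_coord_inj m (i j i' j' : int) : (0 < m)%N ->
  i%:~R + j%:~R * (m%:R * w) = i'%:~R + j'%:~R * (m%:R * w) -> i = i' /\ j = j'.
Proof.
move=> m0 e.
have [] := @qfree _ Q (i - i') ((j - j') * m%:Z).
  have -> : (i - i')%:~R + ((j - j') * m%:Z)%:~R * w =
    (i%:~R + j%:~R * (m%:R * w)) - (i'%:~R + j'%:~R * (m%:R * w)) by ring.
  by rewrite e subrr.
by move=> h1 /eqP; rewrite mulf_eq0 => /orP [/eqP h2|]; lia.
Qed.

(** Modules over O_m without a condition on the rank. For invertible ones [invm_lattice] recovers
    the rank. *)
Definition omod m a := zsub a /\ forall x y, ord m x -> a y -> a (x * y).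

Lemma omodI m a : zsub a -> (forall x, a x -> a (m%:R * w * x)) -> omod m a.
Proof.
move=> ha h; split=> // _ y [i [j ->]] ay.
have -> : (i%:~R + j%:~R * (m%:R * w)) * y =
  i%:~R * y + j%:~R * (m%:R * w * y) by ring.
apply: (zsubD ha); first exact: (zsubMz ha).
by apply: (zsubMz ha); apply: h.
Qed.

Lemma omod_ord m m' : (m' %| m)%N -> omod m (ord m').
Proof.
by move=> h; split=> [|x y /(ord_sub h) ? ?]; [apply: ord_zsub|apply: ordM].
Qed.

Lemma omod_mul m a b : omod m a -> zsub b -> omod m (lat_mul a b).
Proof.
move=> [ha hm] hb; split; first exact: lat_mul_zsub.
move=> x _ hx [s [hs ->]]; rewrite mulr_sumr.
apply: (zsub_sum (lat_mul_zsub b ha)) => p /hs [? ?].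
by rewrite mulrA; apply: lat_mulP => //; apply: hm.
Qed.

Lemma omod_scale m x a : omod m a -> omod m (lat_scale x a).
Proof.
move=> [ha hm]; split; first exact: lat_scale_zsub.
by move=> y _ hy [z az <-]; exists (y * z); [apply: hm|rewrite mulrCA].
Qed.

Lemma lat_mul_ord m a : omod m a -> lat_mul (ord m) a = a.
Proof.
move=> [ha hm]; apply/seteqP; split; first exact: lat_mul_sub.
by move=> x ax; rewrite -[x]mul1r; apply: lat_mulP => //; apply: ord1.
Qed.

Lemma omodE m a : zsub a -> lat_mul (ord m) a = a -> omod m a.
Proof. by move=> ha e; split=> // x y ox ay; rewrite -e; apply: lat_mulP. Qed.

Lemma ord_mul m m' : (m' %| m)%N -> lat_mul (ord m) (ord m') = ord m'.
Proof. by move=> h; apply: lat_mul_ord; apply: omod_ord. Qed.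

(** Hermite normal form: [E] generates the integers of [a], [e] generates the coordinates of [a]
    along m w, and [B] is reduced modulo [E]. The two multiples of [N] make both groups nonzero. *)
Lemma hnf m a (N : nat) : (0 < m)%N -> zsub a -> a `<=` ord m -> (0 < N)%N ->
  a N%:R -> a (N%:R * (m%:R * w)) ->
  exists E e B : nat, [/\ (0 < E)%N, (0 < e)%N, (B < E)%N &
    a = [set x | exists i j : int,
           x = i%:~R * E%:R + j%:~R * (B%:R + e%:R * (m%:R * w))]].
Proof.
move=> m0 ha aO N0 aN aNw; set v := m%:R * w.
have [] := @int_subgroup [set i | a i%:~R] _ _ N => //.
- by case: ha.
- by move=> i j /= ai aj; rewrite intrB; apply: (zsubB ha).
move=> E [E0 hE].
have [] := @int_subgroup [set j | exists i : int, a (i%:~R + j%:~R * v)] _ _ N => //.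
- by exists 0; rewrite mul0r addr0; case: ha.
- move=> j j' /= [i ai] [i' ai']; exists (i - i').
  have -> : (i - i')%:~R + (j - j')%:~R * v =
    (i%:~R + j%:~R * v) - (i'%:~R + j'%:~R * v) by ring.
  exact: (zsubB ha).
- by exists 0; rewrite add0r.
move=> e [e0 he].
have [i0 hi0] : exists i : int, a (i%:~R + e%:Z%:~R * v) by apply/he.
have EN0 : E%:Z != 0 by rewrite lt0r_neq0.
have [B hB] : exists B : nat, (i0 %% E)%Z = B%:Z.
  by have := modz_ge0 i0 EN0; case: (i0 %% E)%Z => // B _; exists B.
have BE : (B < E)%N by have := @ltz_pmod i0 E E0; rewrite hB.
have aE : a E%:R by have /hE : (E%:Z %| E%:Z)%Z by apply: dvdzz.
have aB : a (B%:R + e%:R * v).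
  have -> : B%:R + e%:R * v = (i0%:~R + e%:Z%:~R * v) - (i0 %/ E)%Z%:~R * E%:R :> k.
    have -> : i0%:~R = ((i0 %/ E)%Z * E%:Z + B%:Z)%:~R :> k by rewrite -hB -divz_eq.
    ring.
  by apply: (zsubB ha) => //; apply: (zsubMz ha).
exists E, e, B; split=> //; apply/seteqP; split=> [x ax|x [i [j ->]]]; last first.
  by apply: (zsubD ha); apply: (zsubMz ha).
have [i [j xE]] := aO _ ax.
have /dvdzP [j' jE] : (e%:Z %| j)%Z by apply/he; exists i; rewrite -xE.
have : a (i - j' * B%:Z)%:~R.
  have -> : (i - j' * B%:Z)%:~R = x - j'%:~R * (B%:R + e%:R * v).
    by rewrite xE jE -/v; ring.
  by apply: (zsubB ha) => //; apply: (zsubMz ha).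
move=> /hE /dvdzP [i' iE]; exists i', j'.
have -> : x = (i - j' * B%:Z)%:~R + j'%:~R * (B%:R + e%:R * v).
  by rewrite xE jE -/v; ring.
by rewrite iE; ring.
Qed.

Lemma qfreeQ (p q : rat) : p *: 1 + q *: w = 0 -> p = 0 /\ q = 0.
Proof.
move=> h; pose D := denq p * denq q.
have D0 : D%:~R != 0 :> rat by rewrite intr_eq0 mulf_neq0 ?denq_neq0.
have hp : D%:~R * p = (numq p * denq q)%:~R.
  by rewrite /D !intrM numqE; ring.
have hq : D%:~R * q = (numq q * denq p)%:~R.
  by rewrite /D !intrM numqE; ring.
have [] := @qfree _ Q (numq p * denq q) (numq q * denq p).
  move: (congr1 (fun z => D%:~R *: z) h).
  by rewrite scaler0 scalerDr !scalerA hp hq !scaler_int -(mulrzl w) => <-.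
move=> /eqP; rewrite mulf_eq0 (negPf (denq_neq0 _)) orbF numq_eq0 => /eqP ->.
by move=> /eqP; rewrite mulf_eq0 (negPf (denq_neq0 _)) orbF numq_eq0 => /eqP ->.
Qed.

(** Cramer's rule: the determinant D of N1 b1, N2 b2 with respect to 1, w satisfies D O_k <= a, and
    N1 N2 is a common denominator of [a]. *)
Lemma lattice_bounded a : lattice a -> zsub a /\ exists N : nat, [/\ (0 < N)%N,
  forall x, a x -> ord 1 (N%:R * x) & forall x, ord 1 x -> a (N%:R * x)].
Proof.
move=> [b1 [b2 [free aE]]].
have ha : zsub a.
  rewrite aE; split; first by exists 0, 0; rewrite !mulr0z addr0.
  move=> _ _ [i [j ->]] [i' [j' ->]]; exists (i - i'), (j - j').
  by ring.
have ab1 : a b1 by rewrite aE; exists 1, 0; rewrite mulr1z mulr0z addr0.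
have ab2 : a b2 by rewrite aE; exists 0, 1; rewrite mulr1z mulr0z add0r.
split=> //.
have [N1 [N10 [p [q e1]]]] := @qspan _ Q b1.
have [N2 [N20 [r [s e2]]]] := @qspan _ Q b2.
(* The cofactors that express D and D w through b1 and b2. *)
pose x1 := N1%:Z * s; pose x2 := N2%:Z * q.
pose y1 := N1%:Z * r; pose y2 := N2%:Z * p.
have eD : (p * s - q * r)%:~R = x1%:~R * b1 - x2%:~R * b2.
  rewrite /x1 /x2; have -> : (N1%:Z * s)%:~R * b1 - (N2%:Z * q)%:~R * b2 =
    s%:~R * (N1%:R * b1) - q%:~R * (N2%:R * b2) by ring.
  by rewrite e1 e2; ring.
have eDw : (p * s - q * r)%:~R * w = y2%:~R * b2 - y1%:~R * b1.
  rewrite /y1 /y2; have -> : (N2%:Z * p)%:~R * b2 - (N1%:Z * r)%:~R * b1 =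
    p%:~R * (N2%:R * b2) - r%:~R * (N1%:R * b1) by ring.
  by rewrite e1 e2; ring.
have free' (i j : int) : i%:~R * b1 + j%:~R * b2 = 0 -> i = 0 /\ j = 0.
  move=> h; have [] := free i%:~R j%:~R.
    by rewrite !scaler_int -(mulrzl b1) -(mulrzl b2).
  by move=> /eqP; rewrite intr_eq0 => /eqP -> /eqP; rewrite intr_eq0 => /eqP ->.
(* If D = 0, the two Cramer identities are relations between b1 and b2, so all cofactors vanish;
   then N2 b2 = 0, which contradicts freeness. *)
have D0 : p * s - q * r != 0.
  apply/eqP => D0; move: eD eDw; rewrite D0 mul0r => eD eDw.
  have [] := free' x1 (- x2); first by rewrite intrN mulNr -eD mulr0z.
  have [] := free' (- y1) y2; first by rewrite intrN mulNr addrC -eDw.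
  rewrite /x1 /x2 /y1 /y2 => h1 h2 h3 h4.
  have r0 : r = 0 by nia.
  have s0 : s = 0 by nia.
  have [] := free' 0 N2%:Z; last by lia.
  by rewrite mul0r add0r [LHS]e2 r0 s0; ring.
set D := p * s - q * r in eD eDw D0.
have aD (x : k) : ord 1 x -> a (D%:~R * x).
  move=> [i [j ->]].
  have -> : D%:~R * (i%:~R + j%:~R * (1%:R * w)) =
     i%:~R * D%:~R + j%:~R * (D%:~R * w) by ring.
  rewrite eDw eD.
  by apply: (zsubD ha); apply: (zsubMz ha); apply: (zsubB ha); apply: (zsubMz ha).
exists (N1 * N2 * `|D|)%N; split.
- by rewrite !muln_gt0 N10 N20 absz_gt0.
- move=> x; rewrite aE => -[i [j ->]]; rewrite -(mulrzl b1) -(mulrzl b2) !natrM.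
  have -> : N1%:R * N2%:R * (`|D|%N)%:R * (i%:~R * b1 + j%:~R * b2) =
    (N2 * `|D|)%N%:R * i%:~R * (N1%:R * b1) +
    (N1 * `|D|)%N%:R * j%:~R * (N2%:R * b2) by rewrite !natrM; ring.
  rewrite e1 e2; exists ((N2 * `|D|)%N%:Z * i * p + (N1 * `|D|)%N%:Z * j * r).
  exists ((N2 * `|D|)%N%:Z * i * q + (N1 * `|D|)%N%:Z * j * s).
  ring.
- move=> x /aD ax.
  have : a ((N1 * N2)%N%:R * (sgz D)%:~R * (D%:~R * x)).
    by rewrite -mulrA; apply: (zsubMnl ha); apply: (zsubMz ha).
  have hD : (`|D|%N)%:R = (sgz D)%:~R * D%:~R :> k.
    by rewrite -intrM -abszEsg.
  by rewrite [in X in _ -> X]natrM hD mulrA (mulrA (_%:R)).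
Qed.

(** Converse of [lattice_bounded]: N a lies in O_k and has a Hermite basis, which is then divided by
    N. *)
Lemma bounded_lattice a (N M : nat) : zsub a -> (0 < N)%N -> (0 < M)%N ->
  (forall x, a x -> ord 1 (N%:R * x)) -> (forall x, ord 1 x -> a (M%:R * x)) ->
  lattice a.
Proof.
move=> ha N0 M0 h1 h2.
have uN := natr_unit k N0.
have [] := @hnf 1 (lat_scale N%:R a) (N * M)%N => //.
- exact: lat_scale_zsub.
- by move=> _ [x /h1 ? <-].
- by rewrite muln_gt0 N0.
- exists M%:R; last by rewrite natrM.
  by rewrite -[M%:R]mulr1; apply/h2/ord1.
- exists (M%:R * (1%:R * w)); last by rewrite natrM; ring.
  by apply/h2/ord_w.
move=> E [e [B [E0 e0 BE aE]]].
exists (N%:R^-1 * E%:R), (N%:R^-1 * (B%:R + e%:R * w)); split.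
  move=> p q /(congr1 (fun z => N%:R * z)); rewrite mulr0 mulrDr.
  rewrite -!scalerAr !mulrA mulrV // !mul1r => h.
  have [] := @qfreeQ (p * E%:R + q * B%:R) (q * e%:R).
    rewrite -[RHS]h scalerDl -!scalerA !scaler_nat scalerDr -addrA.
    by rewrite (mulr_natl w e).
  move=> h1' /eqP; rewrite mulf_eq0 pnatr_eq0 (gtn_eqF e0) orbF => /eqP q0.
  split=> //; move/eqP: h1'; rewrite q0 mul0r addr0 mulf_eq0 pnatr_eq0 (gtn_eqF E0) orbF.
  by move=> /eqP.
have aE' : a = lat_scale N%:R^-1 (lat_scale N%:R a).
  by rewrite lat_scaleA mulVr // lat_scale1.
rewrite {1}aE' aE; apply/seteqP; split.
  by move=> _ [_ [i [j ->]] <-]; exists i, j; ring.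
move=> _ [i [j ->]]; exists (i%:~R * E%:R + j%:~R * (B%:R + e%:R * w)).
  by exists i, j; rewrite mul1r.
by ring.
Qed.

End Orders.
(** * Invertible ideals *)

Section Invertible.
Variables (k : comUnitAlgType rat) (Q : quadratic_basis k).
Implicit Types (a b c : set k) (x y : k) (m d : nat).
Notation w := (qw Q).
Notation ord := (ord Q).
Notation omod := (omod Q).

(** Invertibility with the inverse displayed. The lattice conditions of [invertible_ideal] follow
    from it by [invm_upper] and [invm_lower]. *)
Definition invm m a b := [/\ omod m a, omod m b & lat_mul a b = ord m].

Lemma invmC m a b : invm m a b -> invm m b a.
Proof. by case=> ha hb e; split=> //; rewrite lat_mulC. Qed.

Lemma invm_ord m : invm m (ord m) (ord m).
Proof. by split; rewrite ?ord_mul //; apply: omod_ord. Qed.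

Lemma seq_den (s : seq k) :
  exists2 N : nat, (0 < N)%N & forall x, x \in s -> ord 1 (N%:R * x).
Proof.
elim: s => [|x s [N N0 IH]]; first by exists 1%N.
have [M [M0 [i [j e]]]] := @qspan _ Q x.
exists (M * N)%N; first by rewrite muln_gt0 M0.
move=> y; rewrite inE natrM => /orP [/eqP ->|/IH oy].
  by rewrite mulrAC mulrC e; exists (N%:Z * i), (N%:Z * j); ring.
by rewrite -mulrA; apply: (zsubMnl (ord_zsub Q 1)).
Qed.

(** Write 1 as a finite sum of products [p.1 * p.2]. Then x is the sum of [p.1 * (x * p.2)] with
    [x * p.2] in O_m, so a common denominator of the finitely many [p.1] serves for all of [a]. *)
Lemma invm_upper m a b : invm m a b ->
  exists2 N : nat, (0 < N)%N & forall x, a x -> ord 1 (N%:R * x).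
Proof.
move=> [[ha hma] hb e].
have [s [hs e1]] : lat_mul a b 1 by rewrite e; apply: ord1.
have [N N0 hN] := seq_den [seq p.1 | p <- s].
exists N => // x ax.
have -> : N%:R * x = \sum_(p <- s) N%:R * (x * (p.1 * p.2)).
  by rewrite -!mulr_sumr -e1 mulr1.
apply: (zsub_sum (ord_zsub Q 1)) => p ps.
have [? ?] := hs _ ps.
have -> : N%:R * (x * (p.1 * p.2)) = (N%:R * p.1) * (x * p.2) by ring.
apply: ordM; first by apply: hN; apply: map_f.
by apply: (ord_sub (dvd1n m)); rewrite -e; apply: lat_mulP.
Qed.

(** The same sum for 1, now with denominators cleared on the side of b; the factor m brings O_k into
    O_m. *)
Lemma invm_lower m a b : (0 < m)%N -> invm m a b ->
  exists2 N : nat, (0 < N)%N & forall x, ord 1 x -> a (N%:R * x).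
Proof.
move=> m0 h; have [N N0 hN] := invm_upper (invmC h).
case: h => [[ha hma] hb e].
have [s [hs e1]] : lat_mul a b 1 by rewrite e; apply: ord1.
exists (m * N)%N => [|x ox]; first by rewrite muln_gt0 m0.
have -> : (m * N)%N%:R * x = \sum_(p <- s) (m * N)%N%:R * (x * (p.1 * p.2)).
  by rewrite -!mulr_sumr -e1 mulr1.
apply: (zsub_sum ha) => p /hs [? ?].
have -> : (m * N)%N%:R * (x * (p.1 * p.2)) = m%:R * (x * (N%:R * p.2)) * p.1.
  by rewrite natrM; ring.
by apply: hma => //; apply: ord_cond; apply: ordM => //; apply: hN.
Qed.

Lemma invm_lattice m a b : (0 < m)%N -> invm m a b -> lattice a.
Proof.
move=> m0 h; have [N N0 hN] := invm_upper h; have [M M0 hM] := invm_lower m0 h.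
by case: h => -[ha _] _ _; apply: (bounded_lattice ha N0 M0 hN hM).
Qed.

Lemma fractional_omod m a : fractional_ideal (ord m) a -> omod m a.
Proof. by move=> [/(lattice_bounded Q) [ha _] e]; apply: omodE. Qed.

Lemma invm_invertible m a b : (0 < m)%N -> invm m a b -> invertible_ideal (ord m) a.
Proof.
move=> m0 h; have h' := invmC h; split.
  by split; [apply: (invm_lattice m0 h)|case: h => ha _ _; apply: lat_mul_ord].
exists b; split; last by case: h.
by split; [apply: (invm_lattice m0 h')|case: h => _ hb _; apply: lat_mul_ord].
Qed.

Lemma invertible_invm m a : invertible_ideal (ord m) a -> exists b, invm m a b.
Proof.
by move=> [/fractional_omod ? [b [/fractional_omod ? e]]]; exists b.
Qed.

Lemma invm_mul m a a' b b' : invm m a b -> invm m a' b' ->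
  invm m (lat_mul a a') (lat_mul b b').
Proof.
move=> [ha hb e] [ha' hb' e']; have [za _] := ha; have [zb _] := hb.
have [za' _] := ha'; have [zb' _] := hb'.
split; [exact: omod_mul|exact: omod_mul|].
rewrite -lat_mulA ?(lat_mulC b) //; last exact: lat_mul_zsub.
rewrite (lat_mulA za' zb' zb) e' (lat_mul_ord hb) //.
Qed.

Lemma invm_cancel m a b c c' : invm m a b -> omod m c -> omod m c' ->
  lat_mul a c = lat_mul a c' -> c = c'.
Proof.
move=> [[za _] [zb _] e] hc hc' h.
have H c1 : omod m c1 -> c1 = lat_mul b (lat_mul a c1).
  by move=> hc1; case: (hc1) => zc1 _; rewrite lat_mulA // (lat_mulC b) e lat_mul_ord.
by rewrite (H _ hc) h -(H _ hc').
Qed.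

Lemma invm_uniq m a b b' : invm m a b -> invm m a b' -> b = b'.
Proof.
by move=> h [_ hb' e']; apply: (invm_cancel h) => //; case: h => // ? ? ->.
Qed.

Lemma invm_scale m a b x : x \is a GRing.unit -> invm m a b ->
  invm m (lat_scale x a) (lat_scale x^-1 b).
Proof.
move=> ux [ha hb e]; have [za _] := ha; have [zb _] := hb.
split; [exact: omod_scale|exact: omod_scale|].
rewrite lat_mul_scale //; last exact: lat_scale_zsub.
by rewrite lat_mulC lat_mul_scale // lat_scaleA mulrV // lat_scale1 lat_mulC.
Qed.

Lemma omod_ext m a : zsub a -> omod m (lat_mul a (ord m)).
Proof. by move=> za; rewrite lat_mulC; apply: omod_mul => //; apply: omod_ord. Qed.

Lemma lat_mul_ext m a b : zsub a -> zsub b ->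
  lat_mul (lat_mul a b) (ord m) = lat_mul (lat_mul a (ord m)) (lat_mul b (ord m)).
Proof.
move=> za zb; have zo := ord_zsub Q m.
by rewrite -!lat_mulA ?(lat_mul_ord (omod_ext _ zb)) //; apply: lat_mul_zsub.
Qed.

Lemma invm_ext m m' a b : (m' %| m)%N -> invm m a b ->
  invm m' (lat_mul a (ord m')) (lat_mul b (ord m')).
Proof.
move=> h [ha hb e]; have [za _] := ha; have [zb _] := hb.
split; [exact: omod_ext|exact: omod_ext|].
by rewrite -lat_mul_ext // e ord_mul.
Qed.

Lemma lat_mul_ordr m a : omod m a -> lat_mul a (ord m) = a.
Proof. by move=> ha; rewrite lat_mulC lat_mul_ord. Qed.

Lemma lat_mul_ext2 m' m'' a : (m'' %| m')%N -> zsub a ->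
  lat_mul (lat_mul a (ord m')) (ord m'') = lat_mul a (ord m'').
Proof.
by move=> h za; rewrite -lat_mulA ?ord_mul //; apply: ord_zsub.
Qed.

Lemma lat_mul_principal m x a : omod m a -> lat_mul (lat_scale x (ord m)) a = lat_scale x a.
Proof.
move=> ha; have [za _] := ha.
by rewrite lat_mul_scale ?lat_mul_ord //; apply: ord_zsub.
Qed.

Lemma ideal_classE m a b b' : (0 < m)%N -> invm m b b' -> omod m a ->
  ideal_class (ord m) a b <->
  exists2 x : k, x \is a GRing.unit & b = lat_scale x a.
Proof.
move=> m0 hb ha; split=> [[_ [x ux ->]]|[x ux e]].
  by exists x => //; rewrite lat_mul_principal.
by split; [apply: (invm_invertible m0 hb)|exists x; rewrite ?lat_mul_principal].
Qed.

Lemma ideal_class_scale m a x : omod m a -> x \is a GRing.unit ->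
  ideal_class (ord m) (lat_scale x a) = ideal_class (ord m) a.
Proof.
move=> ha ux; apply/seteqP; split=> b [hb [y uy e]]; split=> //.
  exists (y * x); first by rewrite unitrM uy.
  move: e; rewrite !lat_mul_principal ?lat_scaleA //; exact: omod_scale.
exists (y / x); first by rewrite unitrM unitrV uy.
move: e; rewrite !lat_mul_principal ?lat_scaleA ?mulrVK //; exact: omod_scale.
Qed.

Lemma ideal_class_eq m a b a' b' : (0 < m)%N -> invm m a a' -> invm m b b' ->
  ideal_class (ord m) a = ideal_class (ord m) b ->
  exists2 x : k, x \is a GRing.unit & b = lat_scale x a.
Proof.
move=> m0 ha hb e; apply/(ideal_classE m0 hb); first by case: ha.
rewrite e; apply/(ideal_classE m0 hb); first by case: hb.
by exists 1; rewrite ?unitr1 ?lat_scale1.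
Qed.

Lemma suborder_ord m : suborder (ord 1) m = ord m.
Proof.
apply/seteqP; split=> x.
  by move=> [i [y [hy ->]]]; apply/ordP; exists i, y; rewrite mulr_natl.
by move=> /ordP [i [y [hy ->]]]; exists i, y; rewrite mulr_natl.
Qed.

Lemma conductor_scale m : [set y *+ m | y in ord 1] = lat_scale m%:R (ord 1).
Proof.
by apply/seteqP; split=> _ [y hy <-]; exists y; rewrite ?mulr_natl.
Qed.

End Invertible.
(** * Values of binary quadratic forms *)

Definition qform (A B C x y : int) : int := A * x ^+ 2 + B * (x * y) + C * y ^+ 2.

(** At a prime p of d the value reduces to one term: A X^2 if p does not divide A, C Y^2 if p
    divides A but not C, and B X Y if p divides both. In the last case p does not divide B, by
    primitivity. X and Y are the products of primes of d that produce these cases. *)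
Lemma form_represents_coprime (A B C : int) (d : nat) : (0 < d)%N ->
  gcdz A (gcdz B C) = 1 ->
  exists x y : int, coprimez (qform A B C x y) d%:Z.
Proof.
move=> d0 h.
pose X := \prod_(p <- primes d | (p %| `|A|)%N && ~~ (p %| `|C|)%N) p.
pose Y := \prod_(p <- primes d | ~~ (p %| `|A|)%N) p.
exists X%:Z, Y%:Z; apply/negPn/negP; rewrite coprimezE => nc.
have [p pp /andP [pq pd]] : exists2 p, prime p &
    (p %| `|qform A B C X Y|)%N && (p %| d)%N.
  pose g := gcdn `|qform A B C X Y| d.
  exists (pdiv g); last first.
    by rewrite -dvdn_gcd pdiv_dvd.
  apply: pdiv_prime; rewrite ltn_neqAle eq_sym nc.
  by rewrite gcdn_gt0 d0 orbT.
have ppd : p \in primes d by rewrite mem_primes pp d0.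
(* A product of selected primes of d is divisible by p exactly when p is selected. *)
have in_prod (P : pred nat) : (p %| \prod_(q <- primes d | P q) q)%N = P p.
  apply/idP/idP => [|Pp]; last first.
    by rewrite big_mkcond (big_rem p) //= Pp dvdn_mulr.
  rewrite big_mkcond /= => hp.
  have : forall s : seq nat, all prime s ->
    (p %| \prod_(q <- s) (if P q then q else 1))%N -> P p.
    elim=> [|q s IH] /=; first by rewrite big_nil dvdn1 => _ /eqP p1; rewrite p1 in pp.
    move=> /andP [pq' ps]; rewrite big_cons Euclid_dvdM // => /orP [|/(IH ps)//].
    case: ifP => Pq; last by rewrite dvdn1 => /eqP p1; rewrite p1 in pp.
    by rewrite dvdn_prime2 // => /eqP ->.
  apply; last exact: hp.
  by apply/allP => q; rewrite mem_primes => /andP [].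
have hX : (p%:Z %| X%:Z)%Z = (p %| `|A|)%N && ~~ (p %| `|C|)%N.
  by rewrite dvdzE /= in_prod.
have hY : (p%:Z %| Y%:Z)%Z = ~~ (p %| `|A|)%N by rewrite dvdzE /= in_prod.
have EM (i j : int) : (p%:Z %| i * j)%Z = (p%:Z %| i)%Z || (p%:Z %| j)%Z.
  by rewrite !dvdzE abszM Euclid_dvdM.
have pq' : (p%:Z %| qform A B C X Y)%Z by rewrite dvdzE.
rewrite /qform in pq'.
have EA : (p %| `|A|)%N = (p%:Z %| A)%Z by rewrite dvdzE.
have EC : (p %| `|C|)%N = (p%:Z %| C)%Z by rewrite dvdzE.
rewrite EA EC in hX hY.
case pA : (p%:Z %| A)%Z in hX hY; last first.
  move: pq'; rewrite rpredDr; last by rewrite expr2 !EM hY !orbT.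
  rewrite rpredDr; last by rewrite !EM hY !orbT.
  by rewrite expr2 !EM pA hX.
case pC : (p%:Z %| C)%Z in hX hY.
  move: pq'; rewrite rpredDr; last by rewrite !EM pC.
  rewrite rpredDl; last by rewrite !EM pA.
  rewrite !EM hX hY !orbF => pB.
  have : (p%:Z %| gcdz A (gcdz B C))%Z by rewrite !dvdz_gcd pA pB pC.
  by rewrite h dvdzE dvdn1 => /eqP /= p1; rewrite p1 in pp.
move: pq'; rewrite rpredDl; last by rewrite rpredD // !EM ?pA ?hX ?orbT.
by rewrite expr2 !EM pC hY.
Qed.

(* Reduction theory: shift until |B| <= |A|, then swap A and C
   while |C| < |A|; the case C = 0 of a split form is treated by hand. *)
Lemma form_represents_small (A B C : int) : A != 0 -> B ^+ 2 - 4 * (A * C) != 0 ->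
  exists x y : int,
    0 < `|qform A B C x y| <= `|B ^+ 2 - 4 * (A * C)|.
Proof.
have [r] := ubnP `|A|%N; elim: r => // r IH in A B C *; move=> Ar A0 D0.
have [j hj] : exists j : int, `|B + 2 * A * j| <= `|A|.
  have A20 : 2 * A != 0 by lia.
  have h1 := divz_eq B (2 * A).
  have h2 := modz_ge0 B A20.
  have h3 := ltz_mod B A20.
  set q := (B %/ (2 * A))%Z in h1; set s := (B %% (2 * A))%Z in h1 h2 h3.
  have [h4|h4] := leP s `|A|.
    exists (- q); have -> : B + 2 * A * - q = s by rewrite h1; ring.
    by rewrite ger0_norm.
  (* Here |A| < s < 2|A|, and subtracting 2|A| = 2 sgn(A) A once more gives absolute value below
     |A|. *)
  exists (- (q + sgz A)); have -> : B + 2 * A * - (q + sgz A) = s - 2 * (sgz A * A).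
    by rewrite {1}h1; ring.
  by rewrite -abszEsg; lia.
pose B' := B + 2 * A * j; pose C' := A * j ^+ 2 + B * j + C.
have eD : B' ^+ 2 - 4 * (A * C') = B ^+ 2 - 4 * (A * C) by rewrite /B' /C'; ring.
rewrite -/B' in hj; rewrite -eD in D0 *.
suff [x [y hxy]] : exists x y : int,
    0 < `|qform A B' C' x y| <= `|B' ^+ 2 - 4 * (A * C')|.
  exists (x + j * y), y.
  suff -> : qform A B C (x + j * y) y = qform A B' C' x y by [].
  by rewrite /qform /B' /C'; ring.
move: B' C' hj D0 {eD} => {}B {}C hj D0.
(* For C = 0 the discriminant is B^2, and the values at x = 1 are the integers congruent to A modulo
   B: the remainder s serves if it is nonzero, and B otherwise. *)
have [C0|C0] := eqVneq C 0.
  have B0 : B != 0.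
    by apply: contra_neq D0 => B0; rewrite B0 C0; ring.
  have h1 := divz_eq A B; have h2 := modz_ge0 A B0; have h3 := ltz_mod A B0.
  set q := (A %/ B)%Z in h1; set s := (A %% B)%Z in h1 h2 h3.
  have BB : `|B| <= `|B ^+ 2 - 4 * (A * C)| by rewrite C0; nia.
  have [s0|s0] := eqVneq s 0.
    exists 1, (1 - q); have -> : qform A B C 1 (1 - q) = s + B.
      by rewrite /qform C0 {1}h1; ring.
    by rewrite s0 add0r BB andbT normr_gt0.
  exists 1, (- q); have -> : qform A B C 1 (- q) = s.
    by rewrite /qform C0 {1}h1; ring.
  by rewrite normr_gt0 s0 /=; apply: le_trans BB; rewrite ger0_norm // ltW.
have [AC|AC] := leqP `|A|%N `|C|%N.
  exists 1, 0; have -> : qform A B C 1 0 = A by rewrite /qform; ring.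
  (* From |B| <= |A| <= |C| one gets 4|AC| - B^2 >= 3 A^2 >= |A|. *)
  rewrite normr_gt0 A0 /=.
  have : `|A| <= `|C| by lia.
  nia.
have [] := IH C B A; [exact: leq_trans AC _|exact: C0|by rewrite [C * A]mulrC|].
move=> x [y hxy]; exists y, x.
have -> : qform A B C y x = qform C B A x y by rewrite /qform; ring.
by rewrite [A * C]mulrC.
Qed.
(** * Normal forms and norms of ideals *)

Section Norms.
Variables (k : comUnitAlgType rat) (Q : quadratic_basis k).
Implicit Types (a b c : set k) (x y : k) (m d e A B : nat) (C : int).
Notation w := (qw Q).
Notation t := (qt Q).
Notation n := (qn Q).
Notation ord := (ord Q).
Notation omod := (omod Q).
Notation invm := (invm Q).

(* Only meant for elements of [ord 1], where the two coordinates are integers. *)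
Definition conj x : k :=
  xget 0 [set y | exists i j : int,
    x = i%:~R + j%:~R * w /\ y = i%:~R + j%:~R * (t%:~R - w)].

Lemma conjE (i j : int) : conj (i%:~R + j%:~R * w) = i%:~R + j%:~R * (t%:~R - w).
Proof.
rewrite /conj; case: xgetP => [y -> /=|/(_ (i%:~R + j%:~R * (t%:~R - w)))].
  move=> [i' [j' [e ->]]].
  have [] := @ord_coord_inj _ Q 1 i j i' j'; rewrite ?mul1r //.
  by move=> -> ->.
by case; exists i, j.
Qed.

Lemma conjE' m (i j : int) :
  conj (i%:~R + j%:~R * (m%:R * w)) = i%:~R + j%:~R * (m%:R * (t%:~R - w)).
Proof.
have -> : i%:~R + j%:~R * (m%:R * w) = i%:~R + (j * m%:Z)%:~R * w by ring.
by rewrite conjE; ring.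
Qed.

Lemma conj_sub x y : ord 1 x -> ord 1 y -> conj (x - y) = conj x - conj y.
Proof.
move=> [i [j ->]] [i' [j' ->]].
have -> : i%:~R + j%:~R * (1%:R * w) - (i'%:~R + j'%:~R * (1%:R * w)) =
  (i - i')%:~R + (j - j')%:~R * (1%:R * w) by ring.
by rewrite !conjE'; ring.
Qed.

Lemma conj0 : conj 0 = 0.
Proof.
have -> : 0 = 0%:~R + 0%:~R * w by ring.
by rewrite conjE; ring.
Qed.

Lemma conj_ord m x : ord m x -> ord m (conj x).
Proof.
by move=> [i [j ->]]; rewrite conjE'; exists (i + j * m%:Z * t), (- j); ring.
Qed.

Lemma conjK x : ord 1 x -> conj (conj x) = x.
Proof.
move=> [i [j ->]]; rewrite conjE'.
have -> : i%:~R + j%:~R * (1%:R * (t%:~R - w)) = (i + j * t)%:~R + (- j)%:~R * w.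
  by ring.
by rewrite conjE; ring.
Qed.

Lemma conjM x y : ord 1 x -> ord 1 y -> conj (x * y) = conj x * conj y.
Proof.
move=> [i [j ->]] [i' [j' ->]].
have -> : (i%:~R + j%:~R * (1%:R * w)) * (i'%:~R + j'%:~R * (1%:R * w)) =
  (i * i' - j * j' * n)%:~R + (i * j' + j * i' + j * j' * t)%:~R * w.
  by ring: (qw2 Q).
rewrite conjE !conjE'.
by ring: (qw2 Q).
Qed.

Definition conjs a : set k := conj @` a.

Lemma conjs_zsub a : a `<=` ord 1 -> zsub a -> zsub (conjs a).
Proof.
move=> aO ha; split; first by exists 0; [case: ha|rewrite conj0].
move=> _ _ [x ax <-] [y ay <-]; exists (x - y); first exact: (zsubB ha).
by rewrite conj_sub //; apply: aO.
Qed.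

Lemma sub_ord1 m a : a `<=` ord m -> a `<=` ord 1.
Proof. by move=> h x /h; apply/ord_sub/dvd1n. Qed.

Lemma conjsM a b : a `<=` ord 1 -> b `<=` ord 1 -> zsub a -> zsub b ->
  conjs (lat_mul a b) = lat_mul (conjs a) (conjs b).
Proof.
move=> aO bO za zb; have zo := ord_zsub Q 1.
have sub a' b' : a' `<=` ord 1 -> b' `<=` ord 1 -> lat_mul a' b' `<=` ord 1.
  by move=> h h'; apply: (lat_mul_sub zo) => x y /h ? /h' ?; apply: ordM.
have zc := conjs_zsub aO za.
(* [conj] is known to be additive on [ord 1], so this subgroup records membership in [ord 1] as
   well. *)
have main : zsub [set x | ord 1 x /\ lat_mul (conjs a) (conjs b) (conj x)].
  have zl := lat_mul_zsub (conjs b) zc.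
  split=> [|x y [ox hx] [oy hy]].
    by split; [case: zo|rewrite conj0; case: zl].
  by split; [apply: (zsubB zo)|rewrite conj_sub //; apply: (zsubB zl)].
apply/seteqP; split.
  move=> _ [x hx <-]; have := @lat_mul_sub _ a b _ main.
  move=> /(_ _ x hx) []// y z ay bz; split; first by apply: ordM; [apply: aO|apply: bO].
  rewrite conjM; [|exact: aO|exact: bO].
  by apply: lat_mulP; [exists y|exists z].
apply: lat_mul_sub; first by apply: conjs_zsub; [apply: sub|apply: lat_mul_zsub].
move=> _ _ [y ay <-] [z bz <-]; exists (y * z); first exact: lat_mulP.
by rewrite conjM //; [apply: aO|apply: bO].
Qed.

Lemma conjs_ord m : conjs (ord m) = ord m.
Proof.
apply/seteqP; split=> [_ [x hx <-]|x hx]; first exact: conj_ord.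
exists (conj x); first exact: conj_ord.
by rewrite conjK //; apply: (@sub_ord1 m (ord m)).
Qed.

Lemma omod_conjs m a : a `<=` ord m -> omod m a -> omod m (conjs a).
Proof.
move=> aO [za hm]; have aO1 := sub_ord1 aO; split; first exact: conjs_zsub.
move=> x _ hx [y ay <-]; exists (conj x * y).
  by apply: hm => //; apply: conj_ord.
have ox : ord 1 x by apply: (@sub_ord1 m (ord m)).
by rewrite conjM ?conjK //; [apply: conj_ord|apply: aO1].
Qed.

(** The lattice e (Z A + Z (B + m w)). If A C is the norm of B + m w, then x A + y (B + m w) has
    norm A times the value at (x, y) of the form with coefficients A, 2 B + m t, C. *)
Definition hlat m e A B : set k := [set x | exists i j : int,
  x = e%:R * (i%:~R * A%:R + j%:~R * (B%:R + m%:R * w))].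

(** Stability under m w forces [e] to divide both other entries of the Hermite form. Multiplying the
    second basis vector by the conjugate of B + m w gives the integer e N(B + m w), which must be a
    multiple of e A; the quotient is C. *)
Lemma ideal_hnf m a (N : nat) : (0 < m)%N -> omod m a -> a `<=` ord m ->
  (0 < N)%N -> a N%:R ->
  exists e A B C, [/\ (0 < e)%N, (0 < A)%N, (B < A)%N,
    A%:Z * C = B%:Z ^+ 2 + B%:Z * m%:Z * t + m%:Z ^+ 2 * n & a = hlat m e A B].
Proof.
move=> m0 ha aO N0 aN; have [za hm] := ha.
have [] := hnf m0 za aO N0 aN; first by rewrite mulrC; apply: hm => //; apply: ord_w.
move=> E [e [B0 [E0 e0 BE aE]]].
have aI (i j : int) : a (i%:~R + j%:~R * (m%:R * w)) ->
    exists i' j' : int, i = i' * E%:Z + j' * B0%:Z /\ j = j' * e%:Z.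
  rewrite aE => -[i' [j' h]]; exists i', j'.
  apply: (@ord_coord_inj _ Q m _ _ _ _ m0); rewrite h; ring.
have a1 : a E%:R by rewrite aE; exists 1, 0; ring.
have a2 : a (B0%:R + e%:R * (m%:R * w)) by rewrite aE; exists 0, 1; ring.
have [A EA] : exists A, E = (e * A)%N.
  have : a (0%:~R + E%:Z%:~R * (m%:R * w)).
    have -> : 0%:~R + E%:Z%:~R * (m%:R * w) = (m%:R * w) * E%:R by ring.
    by apply: hm => //; apply: ord_w.
  move=> /aI [i' [j' [_ h]]]; exists `|j'|%N.
  by move: (congr1 absz h); rewrite abszM /= mulnC.
have [B EB] : exists B, B0 = (e * B)%N.
  have : a ((- e%:Z * m%:Z * m%:Z * n)%:~R + (B0%:Z + e%:Z * (m%:Z * t))%:~R * (m%:R * w)).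
    have -> : (- e%:Z * m%:Z * m%:Z * n)%:~R +
        (B0%:Z + e%:Z * (m%:Z * t))%:~R * (m%:R * w) =
        (m%:R * w) * (B0%:R + e%:R * (m%:R * w)) by ring: (qw2 Q).
    by apply: hm => //; apply: ord_w.
  move=> /aI [i' [j' [_ h]]]; exists (absz (j' - m%:Z * t)%R).
  have h' : B0%:Z = (j' - m%:Z * t) * e%:Z by rewrite mulrBl -h; ring.
  by move: (congr1 absz h'); rewrite abszM /= mulnC.
have [C EC] : exists C, A%:Z * C = B%:Z ^+ 2 + B%:Z * m%:Z * t + m%:Z ^+ 2 * n.
  pose q := B%:Z ^+ 2 + B%:Z * m%:Z * t + m%:Z ^+ 2 * n.
  have : a ((e%:Z * q)%:~R + 0%:~R * (m%:R * w)).
    have -> : (e%:Z * q)%:~R + 0%:~R * (m%:R * w) =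
       (B%:R + m%:R * (t%:~R - w)) * (B0%:R + e%:R * (m%:R * w)).
      by rewrite /q EB natrM; ring: (qw2 Q).
    apply: hm => //; exists (B%:Z + m%:Z * t), (- 1); ring.
  move=> /aI [i' [j' [h1 h2]]]; exists i'.
  have j0 : j' = 0 by move: h2 e0; nia.
  rewrite j0 mul0r addr0 EA PoszM in h1.
  have e0' : e%:Z != 0 by lia.
  by apply: (mulfI e0'); rewrite -/q h1; ring.
exists e, A, B, C; split=> //.
- by move: E0; rewrite EA muln_gt0 => /andP [].
- by move: BE; rewrite EA EB ltn_pmul2l.
- rewrite aE EA EB; apply/seteqP; split=> _ [i [j ->]]; exists i, j; rewrite !natrM; ring.
Qed.

Lemma hlat_zsub m e A B : zsub (hlat m e A B).
Proof.
split; first by exists 0, 0; ring.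
by move=> _ _ [i [j ->]] [i' [j' ->]]; exists (i - i'), (j - j'); ring.
Qed.

Lemma coset_eq a x y : zsub a ->
  [set x + z | z in a] = [set y + z | z in a] <-> a (x - y).
Proof.
move=> za; split=> [e|axy].
  have : [set y + z | z in a] x by rewrite -e; exists 0; [case: za|rewrite addr0].
  by move=> [z az <-]; rewrite addrC addKr.
apply/seteqP; split=> _ [z az <-].
  by exists (x - y + z); [apply: (zsubD za)|ring].
by exists (z - (x - y)); [apply: (zsubB za)|ring].
Qed.

Lemma hlat_index m e A B : (0 < m)%N -> (0 < e)%N -> (0 < A)%N ->
  lat_index (ord m) (hlat m e A B) = (e * (e * A))%N.
Proof.
move=> m0 e0 A0; rewrite /lat_index /set_card; apply: card_fset_set.
set E := (e * A)%N; have E0 : (0 < E)%N by rewrite muln_gt0 e0.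
(* A number r < e E encodes the representative i + j m w with i = r / e < E and j = r mod e < e. *)
pose f (r : nat) : set k :=
  [set (r %/ e)%N%:R + (r %% e)%N%:R * (m%:R * w) + z | z in hlat m e A B].
have za := hlat_zsub m e A B.
have -> : [set [set x + y | y in hlat m e A B] | x in ord m] = f @` `I_(e * E).
  apply/seteqP; split=> [_ [x [i [j ->]] <-]|_ [r hr <-]]; last first.
    exists ((r %/ e)%N%:R + (r %% e)%N%:R * (m%:R * w)) => //.
    by exists (r %/ e)%N, (r %% e)%N.
  have eN : e%:Z != 0 by lia.
  have EN : E%:Z != 0 by lia.
  have h1 := divz_eq j e; have h2 := modz_ge0 j eN; have h3 := ltz_mod j eN.
  set q := (j %/ e)%Z in h1; set s := (j %% e)%Z in h1 h2 h3.
  pose i' := i - q * e%:Z * B%:Z.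
  have h4 := divz_eq i' E; have h5 := modz_ge0 i' EN; have h6 := ltz_mod i' EN.
  set q' := (i' %/ E)%Z in h4; set s' := (i' %% E)%Z in h4 h5 h6.
  exists (`|s'| * e + `|s|)%N; first by rewrite /=; nia.
  have hs : (`|s| < e)%N by lia.
  rewrite /f divnMDl // divn_small // addn0 modnMDl modn_small //.
  apply/coset_eq => //.
  have -> : (`|s'|%N)%:R = s'%:~R :> k by rewrite -{2}[s']gez0_abs.
  have -> : (`|s|%N)%:R = s%:~R :> k by rewrite -{2}[s]gez0_abs.
  exists (- q'), (- q).
  have -> : i = i' + q * e%:Z * B%:Z by rewrite /i'; ring.
  by rewrite h4 h1 /E PoszM; ring.
apply/inj_card_eq => r r' /set_mem /= hr /set_mem /= hr' /coset_eq -/(_ za) [i [j h]].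
have [|h1 h2] := @ord_coord_inj _ Q m ((r %/ e)%N%:Z - (r' %/ e)%N%:Z)
  ((r %% e)%N%:Z - (r' %% e)%N%:Z) (i * E%:Z + j * e%:Z * B%:Z) (j * e%:Z) m0.
  transitivity ((r %/ e)%N%:R + (r %% e)%N%:R * (m%:R * w) -
    ((r' %/ e)%N%:R + (r' %% e)%N%:R * (m%:R * w))); first by ring.
  by rewrite h /E PoszM; ring.
have r1 := divn_eq r e; have r2 := ltn_pmod r e0.
have r1' := divn_eq r' e; have r2' := ltn_pmod r' e0.
have d1 : (r %/ e < E)%N by rewrite ltn_divLR // mulnC.
have d1' : (r' %/ e < E)%N by rewrite ltn_divLR // mulnC.
have j0 : j = 0 by nia.
rewrite j0 !mul0r addr0 in h1 h2.
have i0 : i = 0 by nia.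
rewrite i0 mul0r in h1.
rewrite r1 r1'; congr (_ * _ + _)%N; lia.
Qed.

End Norms.

(** * Norms of ideals and primitivity of the attached forms *)

Section IdealNorms.
Variables (k : comUnitAlgType rat) (Q : quadratic_basis k).
Implicit Types (a b c : set k) (x y : k) (m d e A B : nat) (C : int).
Notation w := (qw Q).
Notation t := (qt Q).
Notation n := (qn Q).
Notation ord := (ord Q).
Notation omod := (omod Q).
Notation invm := (invm Q).
Notation conj := (conj Q).
Notation conjs := (conjs Q).
Notation hlat := (hlat Q).

Lemma hlat_sub m e A B : hlat m e A B `<=` ord m.
Proof.
move=> _ [i [j ->]]; exists (e%:Z * (i * A%:Z + j * B%:Z)), (e%:Z * j); ring.
Qed.

(** The basis vectors multiplied with conjugates give e^2 A times A, 2 B + m t (as a trace) and C.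
    These have gcd 1, so a Bezout combination yields e^2 A itself. *)
Lemma hlat_conj m e A B C :
  A%:Z * C = B%:Z ^+ 2 + B%:Z * m%:Z * t + m%:Z ^+ 2 * n ->
  gcdz A%:Z (gcdz (2 * B%:Z + m%:Z * t) C) = 1 -> omod m (hlat m e A B) ->
  lat_mul (hlat m e A B) (conjs (hlat m e A B)) =
  lat_scale (e * (e * A))%N%:R (ord m).
Proof.
move=> hC hg hm; have [za _] := hm.
have EC : A%:R * C%:~R = B%:R ^+ 2 + B%:R * m%:R * t%:~R + m%:R ^+ 2 * n%:~R :> k.
  have -> : A%:R * C%:~R = (A%:Z * C)%:~R :> k by ring.
  by rewrite hC; ring.
have cE (i j : int) : conj (e%:R * (i%:~R * A%:R + j%:~R * (B%:R + m%:R * w))) =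
    e%:R * (i%:~R * A%:R + j%:~R * (B%:R + m%:R * (t%:~R - w))).
  have -> : e%:R * (i%:~R * A%:R + j%:~R * (B%:R + m%:R * w)) =
    (e%:Z * (i * A%:Z + j * B%:Z))%:~R + (e%:Z * j)%:~R * (m%:R * w) by ring.
  by rewrite conjE'; ring.
have sub1 : hlat m e A B `<=` ord 1 by apply: (@sub_ord1 _ Q m); apply: hlat_sub.
have zs : zsub (lat_scale (e * (e * A))%N%:R (ord m)).
  by apply: lat_scale_zsub; apply: ord_zsub.
apply/seteqP; split.
  apply: lat_mul_sub => // _ _ [i [j ->]] [_ [i' [j' ->]] <-]; rewrite cE.
  exists ((i * i' * A%:Z + j * j' * C + i * j' * (B%:Z + m%:Z * t) + j * i' * B%:Z)%:~R +
     (j * i' - i * j')%:~R * (m%:R * w)).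
    by exists (i * i' * A%:Z + j * j' * C + i * j' * (B%:Z + m%:Z * t) + j * i' * B%:Z),
      (j * i' - i * j').
  rewrite !natrM; ring: (qw2 Q) EC.
have zl : omod m (lat_mul (hlat m e A B) (conjs (hlat m e A B))).
  by apply: omod_mul => //; apply: conjs_zsub.
have [zl1 zl2] := zl.
move=> _ [x hx <-]; rewrite mulrC; apply: zl2 => //.
have [u [v]] := Bezoutz A%:Z (gcdz (2 * B%:Z + m%:Z * t) C).
have [p [q]] := Bezoutz (2 * B%:Z + m%:Z * t) C.
rewrite hg => <- huv.
pose a1 : k := e%:R * (1%:~R * A%:R + 0%:~R * (B%:R + m%:R * w)).
pose a2 : k := e%:R * (0%:~R * A%:R + 1%:~R * (B%:R + m%:R * w)).
have h1 : hlat m e A B a1 by exists 1, 0.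
have h2 : hlat m e A B a2 by exists 0, 1.
have c1 : conjs (hlat m e A B) (conj a1) by exists a1.
have c2 : conjs (hlat m e A B) (conj a2) by exists a2.
have -> : (e * (e * A))%N%:R = u%:~R * (a1 * conj a1) +
   ((v * p)%:~R * (a1 * conj a2 + a2 * conj a1) + (v * q)%:~R * (a2 * conj a2)).
  transitivity ((e * (e * A))%N%:R * (u * A%:Z + v * (p * (2 * B%:Z + m%:Z * t) + q * C))%:~R : k).
    by rewrite huv mulr1.
  rewrite /a1 /a2 !cE !natrM; ring: (qw2 Q) EC.
apply: (zsubD zl1); first by apply/(zsubMz zl1)/lat_mulP.
apply: (zsubD zl1); last by apply/(zsubMz zl1)/lat_mulP.
by apply/(zsubMz zl1)/(zsubD zl1); apply: lat_mulP.
Qed.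

Lemma invm_of_conj m a (N : nat) : (0 < N)%N -> a `<=` ord m -> omod m a ->
  lat_mul a (conjs a) = lat_scale N%:R (ord m) ->
  invm m a (lat_scale N%:R^-1 (conjs a)).
Proof.
move=> N0 aO ha e; have [za _] := ha; have uN := natr_unit k N0.
have hc := omod_conjs aO ha; have [zc _] := hc.
split=> //; first exact: omod_scale.
by rewrite lat_mulC lat_mul_scale // lat_mulC e lat_scaleA mulVr // lat_scale1.
Qed.

(* An element [th] multiplying the ideal into itself is (B + m w) / g, where g is
   the content of the quadratic form attached to the ideal. *)
Lemma hlat_multiplier m e A B C : (0 < A)%N ->
  A%:Z * C = B%:Z ^+ 2 + B%:Z * m%:Z * t + m%:Z ^+ 2 * n ->
  exists (g : nat) (th : k) (u v : int), [/\ (0 < g)%N,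
    g%:Z = gcdz A%:Z (gcdz (2 * B%:Z + m%:Z * t) C),
    g%:R * th = B%:R + m%:R * w, th * th = u%:~R * th - v%:~R &
    forall x, hlat m e A B x -> hlat m e A B (th * x)].
Proof.
move=> A0 hC; set T := 2 * B%:Z + m%:Z * t.
have [g hg] : exists g : nat, g%:Z = gcdz A%:Z (gcdz T C) by exists (gcdn A (gcdn `|T| `|C|)).
have g0 : (0 < g)%N by have : g%:Z != 0; [rewrite hg gcdz_eq0|]; lia.
have [/dvdzP [A' EA] /dvdzP [T' ET] /dvdzP [C' EC]] :
    [/\ (g%:Z %| A%:Z)%Z, (g%:Z %| T)%Z & (g%:Z %| C)%Z].
  by split; rewrite hg; [exact: dvdz_gcdl|
    exact: dvdz_trans (dvdz_gcdr _ _) (dvdz_gcdl _ _)|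
    exact: dvdz_trans (dvdz_gcdr _ _) (dvdz_gcdr _ _)].
have ug := natr_unit k g0.
pose th : k := g%:R^-1 * (B%:R + m%:R * w).
have gth : g%:R * th = B%:R + m%:R * w by rewrite /th mulrA mulrV // mul1r.
have AC : (A' * C' * g%:Z * g%:Z)%:~R =
    B%:R ^+ 2 + B%:R * m%:R * t%:~R + m%:R ^+ 2 * n%:~R :> k.
  have -> : A' * C' * g%:Z * g%:Z = A%:Z * C by rewrite EA EC; ring.
  by rewrite hC; ring.
have TT : T'%:~R * g%:R = 2 * B%:R + m%:R * t%:~R :> k.
  have -> : T'%:~R * g%:R = (T' * g%:Z)%:~R :> k by ring.
  by rewrite -ET /T; ring.
have thth : th * th = T'%:~R * th - (A' * C')%:~R.
  apply: (mulrI ug); apply: (mulrI ug).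
  have -> : g%:R * (g%:R * (th * th)) = (g%:R * th) * (g%:R * th) by ring.
  have -> : g%:R * (g%:R * (T'%:~R * th - (A' * C')%:~R)) =
    (T'%:~R * g%:R) * (g%:R * th) - (A' * C' * g%:Z * g%:Z)%:~R by ring.
  by rewrite gth TT AC; ring: (qw2 Q).
exists g, th, T', (A' * C'); split=> // _ [i [j ->]].
exists (- (j * C')), (i * A' + j * T').
have EA' : A%:R = A'%:~R * g%:R :> k.
  have -> : A%:R = A%:Z%:~R :> k by [].
  by rewrite EA; ring.
rewrite -gth EA'; ring: thth.
Qed.

(** The multiplier th = (B + m w) / g maps [a] into itself, hence lies in a a^-1 = O_m. Comparing
    the coordinates along m w shows that g divides 1, so the form of an invertible ideal is
    primitive. *)
Lemma invm_hlat m a a' : (0 < m)%N -> invm m a a' -> a `<=` ord m ->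
  exists e A B C, [/\ (0 < e)%N, (0 < A)%N,
    A%:Z * C = B%:Z ^+ 2 + B%:Z * m%:Z * t + m%:Z ^+ 2 * n,
    gcdz A%:Z (gcdz (2 * B%:Z + m%:Z * t) C) = 1 & a = hlat m e A B].
Proof.
move=> m0 h aO; have [ha ha' E] := h; have [za hm] := ha.
have [N N0 hN] := invm_lower m0 h.
have aN : a N%:R by rewrite -[N%:R]mulr1; apply/hN/ord1.
have [e [A [B [C [e0 A0 _ hC aE]]]]] := ideal_hnf m0 ha aO N0 aN.
exists e, A, B, C; split=> //.
have [g [th [u [v [g0 hg gth _ hth]]]]] := hlat_multiplier e A0 hC.
have [i [j hij]] : ord m th.
  rewrite -[th]mulr1.
  have : lat_mul a a' 1 by rewrite E; apply: ord1.
  move=> [s [hs ->]]; rewrite -E mulr_sumr; apply: (zsub_sum (lat_mul_zsub a' za)) => p /hs [a1 a2].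
  rewrite mulrA; apply: lat_mulP => //.
  by move: a1; rewrite aE => /hth.
rewrite -hg; have [|_ h2] := @ord_coord_inj _ Q m (g%:Z * i) (g%:Z * j) B%:Z 1 m0.
  transitivity (g%:R * th); first by rewrite hij; ring.
  by rewrite gth; ring.
by rewrite (natz_mul_eq1 h2).
Qed.

Lemma invm_index m a a' : (0 < m)%N -> invm m a a' -> a `<=` ord m ->
  (0 < lat_index (ord m) a)%N /\
  lat_mul a (conjs a) = lat_scale (lat_index (ord m) a)%:R (ord m).
Proof.
move=> m0 h aO; have [e [A [B [C [e0 A0 hC hg aE]]]]] := invm_hlat m0 h aO.
case: h => ha _ _; rewrite aE in ha *.
by rewrite hlat_index // (hlat_conj hC hg) // !muln_gt0 e0 A0.
Qed.

Lemma ord_scale_inj m (N N' : nat) : (0 < m)%N -> (0 < N)%N -> (0 < N')%N ->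
  lat_scale N%:R (ord m) = lat_scale N'%:R (ord m) -> N = N'.
Proof.
move=> m0 N0 N0' e.
have H (M M' : nat) : lat_scale M%:R (ord m) `<=` lat_scale M'%:R (ord m) -> (M' %| M)%N.
  move=> s; have [|x [i [j ->]] e'] := s M%:R; first by exists 1; [apply: ord1|rewrite mulr1].
  have [|h _] := @ord_coord_inj _ Q m (M'%:Z * i) (M'%:Z * j) M%:Z 0 m0.
    transitivity (M%:R : k); last by ring.
    by rewrite -e'; ring.
  by apply/dvdnP; exists `|i|%N; move: (congr1 absz h); rewrite abszM /= mulnC => <-.
by apply/eqP; rewrite eqn_dvd; apply/andP; split; apply: H; rewrite e.
Qed.

Lemma index_ext m m' a a' : (0 < m)%N -> (m' %| m)%N -> invm m a a' -> a `<=` ord m ->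
  lat_index (ord m') (lat_mul a (ord m')) = lat_index (ord m) a.
Proof.
move=> m0 mm h aO; have m0' : (0 < m')%N by apply: dvdn_gt0 mm.
have zo := ord_zsub Q m'; have [ha _ _] := h; have [za _] := ha.
have h' := invm_ext mm h.
have o1 : ord m' `<=` ord 1 by apply: (@sub_ord1 _ Q m').
have aO1 := sub_ord1 aO.
have aO' : lat_mul a (ord m') `<=` ord m'.
  apply: (lat_mul_sub zo) => x y /aO /(ord_sub mm) ? ?; exact: ordM.
have [N0 e] := invm_index m0 h aO.
have [N0' e'] := invm_index m0' h' aO'.
apply: (@ord_scale_inj m') => //; rewrite -e' conjsM //.
rewrite conjs_ord -lat_mul_ext // ?e; last exact: conjs_zsub.
by rewrite lat_mul_scale ?ord_mul //; apply: ord_zsub.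
Qed.

Lemma index_scale m d a a' : (0 < m)%N -> (0 < d)%N -> invm m a a' -> a `<=` ord m ->
  lat_index (ord m) (lat_scale d%:R a) = (d ^ 2 * lat_index (ord m) a)%N.
Proof.
move=> m0 d0 h aO; have [e [A [B [C [e0 A0 hC hg aE]]]]] := invm_hlat m0 h aO.
have -> : lat_scale d%:R a = hlat m (d * e) A B.
  rewrite aE; apply/seteqP; split=> [_ [_ [i [j ->]] <-]|_ [i [j ->]]].
    by exists i, j; rewrite natrM; ring.
  by exists (e%:R * (i%:~R * A%:R + j%:~R * (B%:R + m%:R * w))); [exists i, j|rewrite natrM mulrA].
by rewrite aE !hlat_index // ?muln_gt0 ?d0 // -mulnn; lia.
Qed.

(** The equation says that x generates [a] at every prime dividing d. With x = al of norm N q, where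
    N is the index and q is a form value prime to d, take y = u conj(al) / N with u q = 1 - v d. *)
Lemma invm_locally_principal m a a' d : (0 < m)%N -> (0 < d)%N -> invm m a a' ->
  exists x y z, [/\ a x, a' y, ord m z & x * y = 1 + d%:R * z].
Proof.
move=> m0 d0 h.
have [M M0 hM] := invm_upper h; have uM := natr_unit k M0.
(* An integral multiple of [a]; scaling [a] and its inverse by reciprocal factors leaves [x * y]
   unchanged. *)
pose b := lat_scale (m * M)%N%:R a.
have uMm : (m * M)%N%:R \is a @GRing.unit k by apply: natr_unit; rewrite muln_gt0 m0.
have hb := invm_scale uMm h.
have bO : b `<=` ord m.
  by move=> _ [x /hM hx <-]; rewrite natrM -mulrA; apply: ord_cond.
suff [x [y [z [[x' ax <-] [y' ay <-] oz e]]]] : exists x y z,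
    [/\ b x, lat_scale (m * M)%N%:R^-1 a' y, ord m z & x * y = 1 + d%:R * z].
  exists x', y', z; split=> //; rewrite -e.
  by rewrite mulrACA mulrV // mul1r.
rewrite -/b in hb; clearbody b.
have [e [A [B [C [e0 A0 hC hg bE]]]]] := invm_hlat m0 hb bO.
have [x [y cop]] := form_represents_coprime d0 hg.
set q := qform _ _ _ _ _ in cop.
have [u [v huv]] := Bezoutz q d%:Z.
rewrite (eqP cop : gcdz q d%:Z = 1) in huv.
have N0 : (0 < e * (e * A))%N by rewrite !muln_gt0 e0 A0.
have uN := natr_unit k N0.
have [hb1 _ _] := hb.
have eN : lat_mul b (conjs b) = lat_scale (e * (e * A))%N%:R (ord m).
  by rewrite bE; apply: (hlat_conj hC hg); rewrite -bE.
rewrite (invm_uniq hb (invm_of_conj N0 bO hb1 eN)).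
pose al : k := e%:R * (x%:~R * A%:R + y%:~R * (B%:R + m%:R * w)).
have bal : b al by rewrite bE; exists x, y.
exists al, ((e * (e * A))%N%:R^-1 * (conj al * u%:~R)), (- v)%:~R; split=> //.
- exists (conj al * u%:~R) => //; rewrite mulrC.
  by apply: (zsubMz (conjs_zsub (sub_ord1 bO) (proj1 hb1))); exists al.
- exact: ord_int.
have cE : conj al = e%:R * (x%:~R * A%:R + y%:~R * (B%:R + m%:R * (t%:~R - w))).
  have -> : al = (e%:Z * (x * A%:Z + y * B%:Z))%:~R + (e%:Z * y)%:~R * (m%:R * w).
    by rewrite /al; ring.
  by rewrite conjE'; ring.
have EC : A%:R * C%:~R = B%:R ^+ 2 + B%:R * m%:R * t%:~R + m%:R ^+ 2 * n%:~R :> k.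
  have -> : A%:R * C%:~R = (A%:Z * C)%:~R :> k by ring.
  by rewrite hC; ring.
have nE : al * conj al = (e * (e * A))%N%:R * q%:~R.
  by rewrite cE /al /q /qform !natrM; ring: (qw2 Q) EC.
transitivity ((u * q)%:~R : k); last first.
  have -> : u * q = 1 - v * d%:Z by rewrite -huv; ring.
  by ring.
have -> : al * ((e * (e * A))%N%:R^-1 * (conj al * u%:~R)) =
  (e * (e * A))%N%:R^-1 * (al * conj al) * u%:~R by ring.
by rewrite nE mulrA mulVr // mul1r; ring.
Qed.

(** For m = 1 the multiplier (B + w) / g is integral over Z, so maximality gives g = 1: the form is
    primitive and the conjugate ideal supplies the inverse. *)
Lemma ord1_invertible a (N : nat) : (0 < N)%N -> a N%:R -> a `<=` ord 1 -> omod 1 a ->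
  exists a', invm 1 a a'.
Proof.
move=> N0 aN aO ha.
have [e [A [B [C [e0 A0 _ hC aE]]]]] := ideal_hnf (ltn0Sn 0) ha aO N0 aN.
have [g [th [u [v [g0 hg gth thth _]]]]] := hlat_multiplier e A0 hC.
have g1 : g = 1%N.
  apply: (@qmax _ Q th g B%:Z u v) => //; rewrite gth; ring.
rewrite g1 in hg.
exists (lat_scale (e * (e * A))%N%:R^-1 (conjs a)).
apply: invm_of_conj => //; first by rewrite !muln_gt0 e0 A0.
by rewrite aE; apply: (hlat_conj hC) => //; rewrite -aE.
Qed.

End IdealNorms.
(** * Extension of ideals from an order to a larger one *)

Section Lifting.
Variables (k : comUnitAlgType rat) (Q : quadratic_basis k).
Implicit Types (a b c : set k) (x y : k) (m d e : nat).
Notation w := (qw Q).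
Notation ord := (ord Q).
Notation omod := (omod Q).
Notation invm := (invm Q).

(* The sublattice Z al + d b of b: modulo d, b is generated by al. *)
Definition lift al d b : set k :=
  [set x | exists (i : int) y, b y /\ x = i%:~R * al + d%:R * y].

Lemma lift_zsub al d b : zsub b -> zsub (lift al d b).
Proof.
move=> zb; split; first by exists 0, 0; split; [case: zb|ring].
move=> _ _ [i [y [hy ->]]] [i' [y' [hy' ->]]]; exists (i - i'), (y - y').
by split; [apply: (zsubB zb)|ring].
Qed.

Lemma lift_mem al d b : zsub b -> lift al d b al.
Proof. by move=> zb; exists 1, 0; split; [case: zb|ring]. Qed.

Lemma lift_scale al d b y : b y -> lift al d b (d%:R * y).
Proof. by move=> hy; exists 0, y; split=> //; ring. Qed.

Lemma ord_scale m d x : ord m x -> ord (m * d) (d%:R * x).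
Proof.
by move=> [i [j ->]]; exists (d%:Z * i), j; rewrite natrM; ring.
Qed.

Lemma ord_scaleP m d x : ord (m * d) x <->
  exists (i : int) y, ord m y /\ x = i%:~R + d%:R * y.
Proof.
split=> [[i [j ->]]|[i [y [hy ->]]]]; last first.
  by apply: (zsubD (ord_zsub Q _)); [apply: ord_int|apply: ord_scale].
exists i, (j%:~R * (m%:R * w)); split; last by rewrite natrM; ring.
by exists 0, j; ring.
Qed.

Lemma omod_lift m d b al : omod m b -> b al -> omod (m * d) (lift al d b).
Proof.
move=> [zb hb] bal; apply: omodI; first exact: lift_zsub.
move=> _ [i [y [hy ->]]].
have -> : (m * d)%N%:R * w * (i%:~R * al + d%:R * y) =
  d%:R * (m%:R * w * (i%:~R * al + d%:R * y)) by rewrite natrM; ring.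
apply: lift_scale; apply: hb; first exact: ord_w.
by apply: (zsubD zb); [apply: (zsubMz zb)|apply: (zsubMnl zb)].
Qed.

(** The product of the two lifts lies in Z + d O_m = O_{md}, because al ga is 1 modulo d O_m.
    Conversely it contains d O_m and, by the same congruence, 1. *)
Lemma invm_lift m d b b' al ga z : invm m b b' -> b al -> b' ga -> ord m z ->
  al * ga = 1 + d%:R * z ->
  invm (m * d) (lift al d b) (lift ga d b') /\ lat_mul (lift al d b) (ord m) = b.
Proof.
move=> [hb hb' E] bal bga oz e; have [zb hbm] := hb; have [zb' hbm'] := hb'.
have zo := ord_zsub Q m.
have bb x y : b x -> b' y -> ord m (x * y) by move=> ? ?; rewrite -E; apply: lat_mulP.
have zl := lift_zsub al d zb; have zP := lat_mul_zsub (lift ga d b') zl.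
have e1 : 1 = al * ga - d%:R * z by rewrite e; ring.
split; first split; [exact: omod_lift|exact: omod_lift| |].
  apply/seteqP; split.
    apply: lat_mul_sub; first exact: ord_zsub.
    move=> _ _ [i [y [hy ->]]] [j [y' [hy' ->]]]; apply/ord_scaleP.
    exists (i * j), ((i * j)%:~R * z + (i%:~R * (al * y') + j%:~R * (y * ga) + d%:R * (y * y'))).
    split; last by ring: e.
    apply: (zsubD zo); first exact: (zsubMz zo).
    apply: (zsubD zo); last by apply: (zsubMnl zo); apply: bb.
    by apply: (zsubD zo); apply: (zsubMz zo); apply: bb.
  (* d x = al (d x ga) - d^2 z x. The first term is a product of elements of the lifts; for the
     second, z x is written as a sum of products from b and b', and each factor absorbs one d. *)
  have dP x : ord m x -> lat_mul (lift al d b) (lift ga d b') (d%:R * x).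
    move=> ox.
    have -> : d%:R * x = al * (d%:R * (x * ga)) - d%:R * d%:R * (z * x).
      by ring: e.
    apply: (zsubB zP).
      by apply: lat_mulP; [apply: lift_mem|apply: lift_scale; apply: hbm'].
    have : ord m (z * x) by apply: ordM.
    rewrite -E => -[s [hs ->]]; rewrite mulr_sumr.
    apply: (zsub_sum zP) => p /hs [? ?].
    have -> : d%:R * d%:R * (p.1 * p.2) = (d%:R * p.1) * (d%:R * p.2) by ring.
    by apply: lat_mulP; apply: lift_scale.
  have P1 : lat_mul (lift al d b) (lift ga d b') 1.
    rewrite e1; apply: (zsubB zP); last exact: dP.
    by apply: lat_mulP; apply: lift_mem.
  move=> _ /ord_scaleP [i [y [hy ->]]]; apply: (zsubD zP); last exact: dP.
  by rewrite -[i%:~R]mulr1; apply: (zsubMz zP).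
apply/seteqP; split.
  apply: lat_mul_sub => // _ x [i [y [hy ->]]] ox; rewrite mulrC; apply: hbm => //.
  by apply: (zsubD zb); [apply: (zsubMz zb)|apply: (zsubMnl zb)].
move=> y hy.
have -> : y = al * (y * ga) - (d%:R * y) * z by ring: e.
apply: (zsubB (lat_mul_zsub _ zl)); apply: lat_mulP => //.
- exact: lift_mem.
- exact: bb.
- exact: lift_scale.
Qed.

Lemma exists_lift m d b b' : (0 < m)%N -> (0 < d)%N -> invm m b b' ->
  exists a a', invm (m * d) a a' /\ lat_mul a (ord m) = b.
Proof.
move=> m0 d0 hb; have [x [y [z [bx by_ oz e]]]] := invm_locally_principal m0 d0 hb.
by exists (lift x d b), (lift y d b'); apply: (invm_lift hb bx by_ oz e).
Qed.

Definition coprime_cond m b := exists x z, [/\ b x, ord 1 z & x + m%:R * z = 1].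

Lemma coprime_condP m b : omod m b -> b `<=` ord m ->
  lat_add b (lat_scale m%:R (ord 1)) = ord m <-> coprime_cond m b.
Proof.
move=> [zb hb] bO; split=> [e|[x [z [bx oz e]]]].
  have : lat_add b (lat_scale m%:R (ord 1)) 1 by rewrite e; apply: ord1.
  by move=> [x bx [_ [z oz <-] h]]; exists x, z.
apply/seteqP; split.
  move=> _ [y hy [_ [u ou <-] <-]].
  by apply: (zsubD (ord_zsub Q m)); [apply: bO|apply: ord_cond].
move=> _ /ordP [i [y [oy ->]]].
exists (i%:~R * x); first exact: (zsubMz zb).
have ex : x = 1 - m%:R * z by apply: (addIr (m%:R * z)); rewrite e; ring.
exists (m%:R * (i%:~R * z + y)); last by rewrite ex; ring.
exists (i%:~R * z + y) => //; apply: (zsubD (ord_zsub Q 1)) => //.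
exact: (zsubMz (ord_zsub Q 1)).
Qed.

(* The extension B of b to the maximal order is invertible, and b = Z x + m B with x = 1
   modulo m, so that the lifting construction applies. *)
Lemma coprime_invm m b : omod m b -> b `<=` ord m -> coprime_cond m b ->
  lattice b -> exists b', invm m b b'.
Proof.
move=> hb bO [x [z [bx oz e]]] lb; have [zb hbm] := hb.
have [_ [N [N0 _ hN]]] := lattice_bounded Q lb.
pose B := lat_mul b (ord 1).
have zo := ord_zsub Q 1.
have hB : omod 1 B by apply: omod_ext.
have bB y : b y -> B y by move=> by_; rewrite -[y]mulr1; apply: lat_mulP => //; apply: ord1.
have bO1 := sub_ord1 bO.
have BO : B `<=` ord 1.
  by apply: lat_mul_sub => // y u /bO1 ? ?; apply: ordM.
have [B' hBB] : exists B', invm 1 B B'.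
  apply: (@ord1_invertible _ Q B N) => //; apply: bB.
  by rewrite -[N%:R]mulr1; apply/hN/ord1.
have [_ [zB' hB'] EB] := hBB.
(* 1 lies in B B', and B <= O_k with B' an O_k-module puts B B' inside B'. Hence ga = 1 may be used
   as the partner of x. *)
have B'1 : B' 1.
  have : lat_mul B B' 1 by rewrite EB; apply: ord1.
  by apply: lat_mul_sub => // y u /BO ? ?; apply: hB'.
have ex : x = 1 - m%:R * z by apply: (addIr (m%:R * z)); rewrite e; ring.
have e' : x * 1 = 1 + m%:R * (- z) by rewrite ex; ring.
have [] := invm_lift hBB (bB _ bx) B'1 (zsubN zo oz) e'.
rewrite mul1n => h _; exists (lift 1 m B').
suff -> : b = lift x m B by [].
apply/seteqP; split.
  move=> y hy; have [i [u [ou yE]]] := (ordP Q m y).1 (bO _ hy).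
  (* Combine y = y x + m y z with y = i + m u. *)
  exists i, (u * x + y * z); split; last first.
    have -> : i%:~R * x + m%:R * (u * x + y * z) = (i%:~R + m%:R * u) * x + m%:R * (y * z) by ring.
    by rewrite -yE ex; ring.
  by apply: (zsubD (proj1 hB)); [rewrite mulrC|]; apply: lat_mulP.
move=> _ [i [y [hy ->]]]; apply: (zsubD zb); first exact: (zsubMz zb).
move: hy => [s [hs ->]]; rewrite mulr_sumr; apply: (zsub_sum zb) => p /hs [? ?].
by rewrite mulrCA mulrC; apply: hbm => //; apply: ord_cond.
Qed.

(* The ideal a + m ord 1 is determined by its integers. *)
Definition content_set m a : set int :=
  [set i | exists2 z, ord 1 z & a (i%:~R + m%:R * z)].

Lemma ideal_decomposition m a a' : (0 < m)%N -> invm m a a' -> a `<=` ord m ->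
  exists m' d b b', [/\ (m = m' * d)%N, invm m' b b', b `<=` ord m', coprime_cond m' b &
    lat_mul a (ord m') = lat_scale d%:R b].
Proof.
move=> m0 h aO; have [ha _ _] := h; have [za hm] := ha.
have zo := ord_zsub Q 1.
have [] := @int_subgroup (content_set m a) _ _ m => //.
- by exists 0; [case: zo|rewrite mulr0 addr0; case: za].
- move=> i j [z oz ai] [u ou aj]; exists (z - u); first exact: (zsubB zo).
  have -> : (i - j)%:~R + m%:R * (z - u) = (i%:~R + m%:R * z) - (j%:~R + m%:R * u) by ring.
  exact: (zsubB za).
- exists (- 1); first by apply: (zsubN zo); apply: ord1.
  have -> : m%:Z%:~R + m%:R * (-1) = 0 :> k by ring.
  by case: za.
move=> d [d0 hd].
have [m' mE] : exists m', m = (m' * d)%N.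
  apply/dvdnP; suff : (d%:Z %| m%:Z)%Z by [].
  apply/hd; exists (- 1); first by apply: (zsubN zo); apply: ord1.
  have -> : m%:Z%:~R + m%:R * (-1) = 0 :> k by ring.
  by case: za.
have ud := natr_unit k d0.
have mm : (m' %| m)%N by rewrite mE dvdn_mulr.
have ud' : d%:R^-1 \is a @GRing.unit k by rewrite unitrV.
have h' := invm_scale ud' (invm_ext mm h).
pose b := lat_scale d%:R^-1 (lat_mul a (ord m')).
(* Each x = i + m y in [a] has i in the content set, hence d divides i; as m = m' d, this gives a <=
   d O_{m'}. *)
have ad x : a x -> exists2 y, ord m' y & x = d%:R * y.
  move=> ax; have [i [y [oy xE]]] := (ordP Q m x).1 (aO _ ax).
  have /hd /dvdzP [j iE] : content_set m a i by exists y; rewrite // -xE.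
  exists (j%:~R + m'%:R * y); last by rewrite xE iE mE natrM; ring.
  by apply/ordP; exists j, y.
have eb : lat_mul a (ord m') = lat_scale d%:R b.
  by rewrite /b lat_scaleA mulrV // lat_scale1.
exists m', d, b, (lat_scale d%:R^-1^-1 (lat_mul a' (ord m'))); split=> //.
  move=> _ [x hx <-].
  have : lat_mul a (ord m') `<=` lat_scale d%:R (ord m').
    apply: lat_mul_sub; first by apply: lat_scale_zsub; apply: ord_zsub.
    move=> y u /ad [v ov ->] ou; exists (v * u); first exact: ordM.
    by rewrite mulrA.
  by move=> /(_ _ hx) [y oy <-]; rewrite mulrA mulVr // mul1r.
have /hd [z oz az] : (d%:Z %| d%:Z)%Z by apply: dvdzz.
exists (d%:R^-1 * (d%:Z%:~R + m%:R * z)), (- z); split; last 1 first.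
- rewrite mulrDr mE natrM mulVr // mulrAC [d%:R^-1 * _]mulrC -!mulrA mulrV //; ring.
- exists (d%:Z%:~R + m%:R * z) => //; rewrite -[X in lat_mul _ _ X]mulr1.
  by apply: lat_mulP => //; apply: ord1.
- exact: (zsubN zo).
Qed.

(** The number d is recovered from [a] as the generator of the integers of a + m O_k; this is the
    source of uniqueness of the decomposition. *)
Lemma decomposition_content m m' d a b : (0 < m)%N -> (m = m' * d)%N -> omod m a ->
  b `<=` ord m' -> coprime_cond m' b -> lat_mul a (ord m') = lat_scale d%:R b ->
  forall i : int, content_set m a i <-> (d%:Z %| i)%Z.
Proof.
move=> m0 mE [za hm] bO [x [u [bx ou e]]] E.
have zo := ord_zsub Q 1.
have ad y : a y -> exists2 v, ord m' v & y = d%:R * v.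
  move=> ay; have : lat_scale d%:R b y.
    by rewrite -E -[y]mulr1; apply: lat_mulP => //; apply: ord1.
  by move=> [v /bO ov <-]; exists v.
have Pd : content_set m a d%:Z.
  have : lat_mul a (ord m') (d%:R * x) by rewrite E; exists x.
  (* This group is a + m O_k. It contains a O_{m'}, because a <= d O_{m'} and d m' = m; so it
     contains d x, which is d modulo m O_k. *)
  have zR : zsub [set y | exists2 z, ord 1 z & a (y + m%:R * z)].
    split; first by exists 0; [case: zo|rewrite mulr0 addr0; case: za].
    move=> y y' [z oz ay] [z' oz' ay']; exists (z - z'); first exact: (zsubB zo).
    have -> : y - y' + m%:R * (z - z') = (y + m%:R * z) - (y' + m%:R * z') by ring.
    exact: (zsubB za).
  move=> /(lat_mul_sub zR) []; last first.
    move=> z oz az; exists (z - u); first exact: (zsubB zo).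
    have -> : d%:Z%:~R + m%:R * (z - u) = d%:R * x + m%:R * z; last by [].
    have ex : x = 1 - m'%:R * u by apply: (addIr (m'%:R * u)); rewrite e; ring.
    by rewrite ex mE natrM; ring.
  move=> y v ay /ordP [j [s [os ->]]]; have [r or yE] := ad _ ay.
  exists (- (r * s)).
    by apply: (zsubN zo); apply: ordM => //; apply: (@sub_ord1 _ Q m' (ord m')).
  have -> : y * (j%:~R + m'%:R * s) + m%:R * - (r * s) = j%:~R * y.
    by rewrite yE mE natrM; ring.
  exact: (zsubMz za).
move=> i; split=> [[z oz /ad [v [j [l ->]] e']]|/dvdzP [j ->]].
  have [p [q zE]] := oz.
  have [|h _] := @ord_coord_inj _ Q 1 (i + m%:Z * p) (m%:Z * q) (d%:Z * j) (d%:Z * l * m'%:Z) isT.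
    transitivity (i%:~R + m%:R * z); first by rewrite zE; ring.
    by rewrite e'; ring.
  have -> : i = d%:Z * (j - m'%:Z * p) by apply: (addIr (m%:Z * p)); rewrite h mE PoszM; ring.
  by rewrite dvdz_mulr.
have [z oz az] := Pd; exists (j%:~R * z); first exact: (zsubMz zo).
have -> : (j * d%:Z)%:~R + m%:R * (j%:~R * z) = j%:~R * (d%:Z%:~R + m%:R * z) by ring.
exact: (zsubMz za).
Qed.

Lemma decomposition_uniq m m1 d1 m2 d2 a b1 b2 : (0 < m)%N -> omod m a ->
  (m = m1 * d1)%N -> b1 `<=` ord m1 -> coprime_cond m1 b1 ->
  lat_mul a (ord m1) = lat_scale d1%:R b1 ->
  (m = m2 * d2)%N -> b2 `<=` ord m2 -> coprime_cond m2 b2 ->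
  lat_mul a (ord m2) = lat_scale d2%:R b2 -> m1 = m2.
Proof.
move=> m0 ha e1 b1O c1 h1 e2 b2O c2 h2.
have P1 := decomposition_content m0 e1 ha b1O c1 h1.
have P2 := decomposition_content m0 e2 ha b2O c2 h2.
have d12 : (d1 %| d2)%N by have /P2 /P1 : (d2%:Z %| d2%:Z)%Z by apply: dvdzz.
have d21 : (d2 %| d1)%N by have /P1 /P2 : (d1%:Z %| d1%:Z)%Z by apply: dvdzz.
have d : d1 = d2 by apply/eqP; rewrite eqn_dvd d12.
move: m0; rewrite e1 muln_gt0 => /andP [_ d0].
by apply/eqP; rewrite -(eqn_pmul2r d0) -e1 d -e2.
Qed.

End Lifting.
(* For each prime p, the p-part of gcd(m1, m2) is that of m1 or that of m2; e is the
   idempotent modulo m that separates the two kinds of primes. *)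
Lemma split_idempotent (m m1 m2 : nat) : (0 < m)%N -> (m1 %| m)%N -> (m2 %| m)%N ->
  exists e : int, [/\ (m%:Z %| e * (1 - e))%Z, (m1%:Z %| e * (gcdn m1 m2)%:Z)%Z &
    (m2%:Z %| (1 - e) * (gcdn m1 m2)%:Z)%Z].
Proof.
move=> m0 d1 d2; have m10 := dvdn_gt0 m0 d1; have m20 := dvdn_gt0 m0 d2.
pose pi : nat_pred := [pred p | (logn p m1 <= logn p m2)%N].
set M1 := (m`_pi)%N; set M2 := (m`_pi^')%N.
have mE : (M1 * M2)%N = m by apply: partnC.
have cop : coprimez M1%:Z M2%:Z by rewrite coprimezE; apply: coprime_partC.
have [u [v huv]] := Bezoutz M1%:Z M2%:Z.
rewrite (eqP cop : gcdz M1%:Z M2%:Z = 1) in huv.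
have part_dvd (rho : nat_pred) (n n' : nat) : (0 < n)%N -> (0 < n')%N ->
    (forall p, p \in rho -> (logn p n <= logn p n')%N) -> (n`_rho %| n')%N.
  move=> n0 n0' hlog; apply/dvdn_partP; first exact: part_gt0.
  move=> p; rewrite pi_of_part // inE /= mem_primes => /andP [/andP [pp _] prho].
  rewrite partn_part; last by move=> q; rewrite inE => /eqP ->.
  by rewrite p_part pfactor_dvdn //; apply: hlog.
have h1 : (m1`_pi %| gcdn m1 m2)%N.
  by rewrite dvdn_gcd dvdn_part part_dvd.
have h2 : (m2`_pi^' %| gcdn m1 m2)%N.
  rewrite dvdn_gcd dvdn_part andbT part_dvd // => p.
  by rewrite !inE -ltnNge => /ltnW.
(* It is 1 modulo M1 and 0 modulo M2. *)
exists (v * M2%:Z).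
have e1 : 1 - v * M2%:Z = u * M1%:Z by rewrite -huv addrK.
rewrite e1; split.
- by apply/dvdzP; exists (v * u); rewrite -mE PoszM; ring.
- rewrite -mulrA dvdz_mull // -PoszM.
  have : ((m1`_pi^')%N * (m1`_pi)%N %| M2 * gcdn m1 m2)%N by rewrite dvdn_mul // partn_dvd.
  by rewrite mulnC partnC.
- rewrite -mulrA dvdz_mull // -PoszM.
  have : ((m2`_pi)%N * (m2`_pi^')%N %| M1 * gcdn m1 m2)%N by rewrite dvdn_mul // partn_dvd.
  by rewrite partnC.
Qed.

(** * Ideals that become trivial in a larger order *)

Section UnitIdeals.
Variables (k : comUnitAlgType rat) (Q : quadratic_basis k).
Implicit Types (a b c : set k) (x y : k) (m d e : nat).
Notation w := (qw Q).
Notation ord := (ord Q).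
Notation omod := (omod Q).
Notation invm := (invm Q).

(** Z al + m O_k, the O_m-ideal attached to the residue of al in O_k / m O_k. *)
Definition ulat m al : set k := lift al m (ord 1).

(** al and ga are inverse units of O_{m'} / m O_k. *)
Definition upair m' m al ga := [/\ ord m' al, ord m' ga &
  exists2 z, ord 1 z & al * ga = 1 + m%:R * z].

Lemma ord_sub1 m x : ord m x -> ord 1 x.
Proof. exact/ord_sub/dvd1n. Qed.

Lemma ulat_sub m' m al : (m' %| m)%N -> ord m' al -> ulat m al `<=` ord m'.
Proof.
move=> mm oal _ [i [y [oy ->]]]; have zo := ord_zsub Q m'.
by apply: (zsubD zo); [apply: (zsubMz zo)|apply/(ord_sub mm)/ord_cond].
Qed.

Lemma upair_invm m' m al ga : (m' %| m)%N -> upair m' m al ga ->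
  invm m (ulat m al) (ulat m ga) /\ lat_mul (ulat m al) (ord m') = ord m'.
Proof.
move=> mm [oal oga [z oz e]].
have [] := invm_lift (invm_ord Q 1) (ord_sub1 oal) (ord_sub1 oga) oz e.
rewrite mul1n => h _; split=> //; have zo := ord_zsub Q m'.
apply/seteqP; split.
  by apply: lat_mul_sub => // x y /(ulat_sub mm oal) ? ?; apply: ordM.
move=> y oy; have -> : y = al * (ga * y) - m%:R * z * y by ring: e.
have zl : zsub (ulat m al) by apply: lift_zsub; apply: ord_zsub.
apply: (zsubB (lat_mul_zsub _ zl)); apply: lat_mulP => //.
- by apply: lift_mem; apply: ord_zsub.
- exact: ordM.
- exact: lift_scale.
Qed.

(** Local principality with d = m gives a generator x of [a] modulo m, and m O_k <= a; the two
    together give a = Z x + m O_k. *)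
Lemma unit_ideal_ulat m' m a a' : (0 < m)%N -> (m' %| m)%N -> invm m a a' ->
  lat_mul a (ord m') = ord m' -> exists al ga, upair m' m al ga /\ a = ulat m al.
Proof.
move=> m0 mm h E; have [[za hm] [za' hm'] Eo] := h.
have m0' := dvdn_gt0 m0 mm.
have zo := ord_zsub Q m'; have zo1 := ord_zsub Q 1.
have E' : lat_mul a' (ord m') = ord m'.
  have := invm_ext mm h; rewrite E => -[_ ha' e].
  by rewrite -[LHS](lat_mul_ord ha').
have sub b : lat_mul b (ord m') = ord m' -> b `<=` ord m'.
  by move=> <- x bx; rewrite -[x]mulr1; apply: lat_mulP => //; apply: ord1.
have aO := sub _ E; have aO' := sub _ E'.
(* The inverse a' lies in O_k, so m y a' <= m O_k <= O_m; expand m y = m y * 1 with 1 in a a'. *)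
have ca y : ord 1 y -> a (m%:R * y).
  move=> oy; have : lat_mul a a' 1 by rewrite Eo; apply: ord1.
  move=> [s [hs e1]].
  have -> : m%:R * y = \sum_(p <- s) m%:R * y * (p.1 * p.2) by rewrite -mulr_sumr -e1 mulr1.
  apply: (zsub_sum za) => p /hs [? h2].
  have -> : m%:R * y * (p.1 * p.2) = m%:R * (y * p.2) * p.1 by ring.
  apply: hm => //; apply: ord_cond; apply: ordM => //.
  by apply: (@ord_sub1 m'); apply: aO'.
have [x [y [z [ax ay oz e]]]] := invm_locally_principal m0 m0 h.
exists x, y; split.
  by split; [apply: aO|apply: aO'|exists z => //; apply: (ord_sub1 oz)].
apply/seteqP; split=> [v av|_ [i [v [ov ->]]]]; last first.
  by apply: (zsubD za); [apply: (zsubMz za)|apply: ca].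
have : ord m (v * y) by rewrite -Eo; apply: lat_mulP.
move=> /ordP [i [u [ou vy]]]; exists i, (u * x - v * z); split.
  apply: (zsubB zo1); apply: ordM => //; try exact: (ord_sub1 oz).
    exact: (ord_sub1 (aO _ ax)).
  exact: (ord_sub1 (aO _ av)).
have -> : i%:~R * x + m%:R * (u * x - v * z) = (i%:~R + m%:R * u) * x - m%:R * (v * z) by ring.
by rewrite -vy; ring: e.
Qed.

Lemma ulat_congr m al al' z : ord 1 z -> al = al' + m%:R * z -> ulat m al = ulat m al'.
Proof.
have H x x' u : ord 1 u -> x = x' + m%:R * u -> ulat m x `<=` ulat m x'.
  move=> ou -> _ [i [y [oy ->]]]; exists i, (i%:~R * u + y); split; last by ring.
  by apply: (zsubD (ord_zsub Q 1)) => //; apply: (zsubMz (ord_zsub Q 1)).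
move=> oz e; apply/seteqP; split; first exact: H e.
apply: (H _ _ (- z)); first exact: (zsubN (ord_zsub Q 1)).
by rewrite e; ring.
Qed.

Lemma ulat_mul m al ga al' ga' : upair 1 m al ga -> upair 1 m al' ga' ->
  lat_mul (ulat m al) (ulat m al') = ulat m (al * al').
Proof.
move=> [oal oga [z oz e]] [oal' oga' [z' oz' e']].
have zo := ord_zsub Q 1.
have zu x : zsub (ulat m x) by apply: lift_zsub.
apply/seteqP; split.
  apply: lat_mul_sub => // _ _ [i [y [oy ->]]] [j [y' [oy' ->]]].
  exists (i * j), (i%:~R * (al * y') + j%:~R * (y * al') + m%:R * (y * y')).
  split; last by ring.
  apply: (zsubD zo); last by apply: (zsubMnl zo); apply: ordM.
  by apply: (zsubD zo); apply: (zsubMz zo); apply: ordM.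
have zP := lat_mul_zsub (ulat m al') (zu al).
move=> _ [i [y [oy ->]]]; apply: (zsubD zP).
  by apply/(zsubMz zP)/lat_mulP; apply: lift_mem.
have -> : m%:R * y = al * (m%:R * (ga * y)) - (m%:R * z) * (m%:R * y) by ring: e.
apply: (zsubB zP); apply: lat_mulP.
- exact: lift_mem.
- by apply: lift_scale; apply: ordM.
- exact: lift_scale.
- exact: lift_scale.
Qed.

(** The ideal depends only on al modulo m O_k, which leaves at most m^2 choices. *)
Lemma finite_Ugroup m' m : (0 < m)%N -> (m' %| m)%N ->
  finite_set (Ugroup (ord m') (ord m)).
Proof.
move=> m0 mm.
pose el (r : nat) : k := (r %/ m)%N%:R + (r %% m)%N%:R * w.
apply: (@sub_finite_set _ _ ((fun r => ulat m (el r)) @` `I_(m * m))); last first.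
  by apply: finite_image; apply: finite_II.
move=> a [/invertible_invm [a' h] E].
have [al [ga [[oal _ _] ->]]] := unit_ideal_ulat m0 mm h E.
have [i [j alE]] := ord_sub1 oal.
have mN : m%:Z != 0 by lia.
have h1 := divz_eq i m; have h2 := modz_ge0 i mN; have h3 := ltz_mod i mN.
have h4 := divz_eq j m; have h5 := modz_ge0 j mN; have h6 := ltz_mod j mN.
set q := (i %/ m)%Z in h1; set s := (i %% m)%Z in h1 h2 h3.
set q' := (j %/ m)%Z in h4; set s' := (j %% m)%Z in h4 h5 h6.
exists (`|s| * m + `|s'|)%N; first by rewrite /=; nia.
have hs : (`|s'| < m)%N by lia.
rewrite /el divnMDl // divn_small // addn0 modnMDl modn_small //.
symmetry; apply: (@ulat_congr _ _ _ (q%:~R + q'%:~R * w)); first by exists q, q'; ring.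
have -> : (`|s|%N)%:R = s%:~R :> k by rewrite -{2}[s]gez0_abs.
have -> : (`|s'|%N)%:R = s'%:~R :> k by rewrite -{2}[s']gez0_abs.
by rewrite alE h1 h4; ring.
Qed.

(** With r the idempotent of [split_idempotent] and g the gcd, al is congruent modulo m to the
    product of (1 - r) + r al and r + (1 - r) al. For al in Z + g O_k the first factor lies in
    O_{m1}, because m1 divides r g; the second lies in O_{m2} for the same reason. *)
Lemma Ugroup_gcd m m1 m2 a a' : (0 < m)%N -> (m1 %| m)%N -> (m2 %| m)%N ->
  invm m a a' -> lat_mul a (ord (gcdn m1 m2)) = ord (gcdn m1 m2) ->
  exists a1 b1 a2 b2, [/\ invm m a1 b1, lat_mul a1 (ord m1) = ord m1, invm m a2 b2,
    lat_mul a2 (ord m2) = ord m2 & a = lat_mul a1 a2].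
Proof.
move=> m0 d1 d2 h E; set g := gcdn m1 m2 in E.
have gm : (g %| m)%N by apply: dvdn_trans d1; apply: dvdn_gcdl.
have [al [ga [[oal oga [z oz e]] ->]]] := unit_ideal_ulat m0 gm h E.
have [r [/dvdzP [q1 h1] /dvdzP [q2 h2] /dvdzP [q3 h3]]] := split_idempotent m0 d1 d2.
rewrite -/g in h2 h3.
have zo := ord_zsub Q 1.
have H (r' q q' : int) m' x y : r' * (1 - r') = q * m%:Z -> r' * g%:Z = q' * m'%:Z ->
    ord g x -> ord g y -> (exists2 u, ord 1 u & x * y = 1 + m%:R * u) ->
    upair m' m ((1 - r')%:~R + r'%:~R * x) ((1 - r')%:~R + r'%:~R * y).
  move=> hr hq.
  have o v : ord g v -> ord m' ((1 - r')%:~R + r'%:~R * v).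
    move=> /ordP [i [p [op ->]]]; apply/ordP; exists (1 - r' + r' * i), (q'%:~R * p).
    split; first exact: (zsubMz zo).
    have -> : m'%:R * (q'%:~R * p) = (q' * m'%:Z)%:~R * p by ring.
    by rewrite -hq; ring.
  move=> ox oy [u ou hu]; split; [exact: o|exact: o|].
  have ox1 := ord_sub1 ox; have oy1 := ord_sub1 oy.
  (* With x y = 1 + m u the product expands to 1 + r'(1 - r')(x + y - 2) + r'^2 m u, and r'(1 - r')
     = q m. *)
  exists ((r' * r')%:~R * u + q%:~R * (x + y - 2)).
    apply: (zsubD zo); apply: (zsubMz zo) => //; apply: (zsubB zo); last exact: (ord_int Q 1 2).
    exact: (zsubD zo).
  have -> : m%:R * ((r' * r')%:~R * u + q%:~R * (x + y - 2)) =
     (r' * r')%:~R * (m%:R * u) + (q * m%:Z)%:~R * (x + y - 2) by ring.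
  by rewrite -hr; ring: hu.
have hz : exists2 u, ord 1 u & al * ga = 1 + m%:R * u by exists z.
have u1 := H r q1 q2 m1 al ga h1 h2 oal oga hz.
have h1' : (1 - r) * (1 - (1 - r)) = q1 * m%:Z by rewrite -h1; ring.
have u2 := H (1 - r) q1 q3 m2 al ga h1' h3 oal oga hz.
have [i1 e1] := upair_invm d1 u1; have [i2 e2] := upair_invm d2 u2.
do 4 eexists; split; [exact: i1|exact: e1|exact: i2|exact: e2|].
have up m' x y : upair m' m x y -> upair 1 m x y.
  by move=> [? ? ?]; split=> //; apply: (@ord_sub1 m').
rewrite (ulat_mul (up _ _ _ u1) (up _ _ _ u2)).
have oal1 := ord_sub1 oal.
(* The product of the two factors equals al + r (1 - r) (al - 1)^2. *)
apply: (@ulat_congr _ _ _ (- (q1%:~R * (al - 1) * (al - 1)))).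
  apply: (zsubN zo); apply: ordM; last by apply: (zsubB zo) => //; apply: ord1.
  by apply: (zsubMz zo); apply: (zsubB zo) => //; apply: ord1.
have -> : m%:R * - (q1%:~R * (al - 1) * (al - 1)) = - ((q1 * m%:Z)%:~R * (al - 1) * (al - 1)).
  by ring.
by rewrite -h1; ring.
Qed.

End UnitIdeals.
(** * Class groups and their characters *)

Section ClassFiniteness.
Variables (k : comUnitAlgType rat) (Q : quadratic_basis k).
Implicit Types (a b c : set k) (x y : k) (m d e A B : nat).
Notation w := (qw Q).
Notation t := (qt Q).
Notation n := (qn Q).
Notation ord := (ord Q).
Notation invm := (invm Q).

(** Such a subgroup is determined by which of the M^2 residues modulo M O_m it contains. *)
Lemma finite_between m (M : nat) : (0 < M)%N ->
  finite_set [set L | [/\ zsub L, L `<=` ord m & forall x, ord m x -> L (M%:R * x)]].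
Proof.
move=> M0; pose el (r : nat) : k := (r %/ M)%N%:R + (r %% M)%N%:R * (m%:R * w).
pose F (S : {set 'I_(M * M)}) : set k :=
  [set x | exists r, r \in S /\ exists z, ord m z /\ x = el r + M%:R * z].
apply: (@sub_finite_set _ _ (F @` setT)); last by apply: finite_image.
move=> L [zL LO hL].
exists (finset (fun r : 'I_(M * M) => `[< L (el r) >])) => //.
apply/seteqP; split.
  move=> _ [r [+ [z [oz ->]]]]; rewrite inE => /asboolP Lr.
  by apply: (zsubD zL) => //; apply: hL.
move=> x Lx; have [i [j xE]] := LO _ Lx.
have MN : M%:Z != 0 by lia.
have h1 := divz_eq i M; have h2 := modz_ge0 i MN; have h3 := ltz_mod i MN.
have h4 := divz_eq j M; have h5 := modz_ge0 j MN; have h6 := ltz_mod j MN.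
set q := (i %/ M)%Z in h1; set s := (i %% M)%Z in h1 h2 h3.
set q' := (j %/ M)%Z in h4; set s' := (j %% M)%Z in h4 h5 h6.
have rM : (`|s| * M + `|s'| < M * M)%N by nia.
have hs : (`|s'| < M)%N by lia.
have oz : ord m (q%:~R + q'%:~R * (m%:R * w)) by exists q, q'.
have eE : x = el (Ordinal rM) + M%:R * (q%:~R + q'%:~R * (m%:R * w)).
  rewrite /el /= divnMDl // divn_small // addn0 modnMDl modn_small //.
  have -> : (`|s|%N)%:R = s%:~R :> k by rewrite -{2}[s]gez0_abs.
  have -> : (`|s'|%N)%:R = s'%:~R :> k by rewrite -{2}[s']gez0_abs.
  by rewrite xE h1 h4; ring.
exists (Ordinal rM); split; last by exists (q%:~R + q'%:~R * (m%:R * w)).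
rewrite inE; apply/asboolP; have -> : el (Ordinal rM) = x - M%:R * (q%:~R + q'%:~R * (m%:R * w)).
  by rewrite eE addrK.
by apply: (zsubB zL) => //; apply: hL.
Qed.

(** Every class contains a lattice between M O_m and O_m, for one M. Let b be the ideal divided by
    its content, and al in b of norm A q with 0 < |q| <= |D|. Then (M / al) b contains M O_m because
    al is in b, and it lies in O_m because b conj(al) lies in A O_m and q divides M. *)
Lemma finite_classes m : (0 < m)%N ->
  finite_set [set ideal_class (ord m) a | a in [set a | exists a', invm m a a']].
Proof.
move=> m0; pose D := m%:Z ^+ 2 * (t ^+ 2 - 4 * n).
have D0 : D != 0 by rewrite mulf_neq0 ?qdisc // expf_neq0 //; lia.
(* A factorial, so that every nonzero q with |q| <= |D| divides M. *)
pose M := (`|D|)`!; have M0 : (0 < M)%N by apply: fact_gt0.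
apply: (sub_finite_set _ (finite_image (ideal_class (ord m)) (@finite_between m M M0))).
move=> _ [a [a' h] <-].
have [N N0 hN] := invm_upper h.
have umN : ((m * N)%N%:R : k) \is a GRing.unit by apply: natr_unit; rewrite muln_gt0 m0.
have h1 := invm_scale umN h.
have bO : lat_scale (m * N)%N%:R a `<=` ord m.
  by move=> _ [x /hN hx <-]; rewrite natrM -mulrA; apply: ord_cond.
have [e [A [B [C [e0 A0 hC hg bE]]]]] := invm_hlat m0 h1 bO.
pose b := hlat Q m 1 A B.
have ue := natr_unit k e0.
have bE' : lat_scale (m * N)%N%:R a = lat_scale e%:R b.
  rewrite bE; apply/seteqP; split=> [_ [i [j ->]]|_ [_ [i [j ->]] <-]].
    exists (1%:R * (i%:~R * A%:R + j%:~R * (B%:R + m%:R * w))); first by exists i, j.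
    by rewrite mul1r.
  by exists i, j; rewrite mul1r.
have bE2 : b = lat_scale (e%:R^-1 * (m * N)%N%:R) a.
  by rewrite -lat_scaleA bE' lat_scaleA mulVr // lat_scale1.
have ub : e%:R^-1 * (m * N)%N%:R \is a @GRing.unit k by rewrite unitrM unitrV ue.
have hb := invm_scale ub h; rewrite -bE2 in hb.
have [omb _ _] := hb; have [zb hbm] := omb.
have [oma _ _] := h.
have clE : ideal_class (ord m) b = ideal_class (ord m) a.
  by rewrite bE2 ideal_class_scale.
have bO' : b `<=` ord m by apply: hlat_sub.
have A0' : A%:Z != 0 by lia.
have dE : (2 * B%:Z + m%:Z * t) ^+ 2 - 4 * (A%:Z * C) = D by rewrite hC /D; ring.
have [|x [y]] := @form_represents_small A (2 * B%:Z + m%:Z * t) C A0'; first by rewrite dE.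
rewrite dE; set q := qform _ _ _ _ _; move=> hq.
have q0 : q != 0 by move: hq => /andP [+ _]; rewrite normr_gt0.
have [r Mr] : exists r : int, M%:Z = q * r.
  have : (`|q| %| M)%N by apply: dvdn_fact; lia.
  move=> qM; have /dvdzP [r rE] : (q %| M%:Z)%Z by rewrite dvdzE.
  by exists r; rewrite rE mulrC.
pose al : k := 1%:R * (x%:~R * A%:R + y%:~R * (B%:R + m%:R * w)).
have bal : b al by exists x, y.
have cE : conj Q al = x%:~R * A%:R + y%:~R * (B%:R + m%:R * (t%:~R - w)).
  have -> : al = (x * A%:Z + y * B%:Z)%:~R + y%:~R * (m%:R * w) by rewrite /al; ring.
  by rewrite conjE'; ring.
have EC : A%:R * C%:~R = B%:R ^+ 2 + B%:R * m%:R * t%:~R + m%:R ^+ 2 * n%:~R :> k.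
  have -> : A%:R * C%:~R = (A%:Z * C)%:~R :> k by ring.
  by rewrite hC; ring.
have nE : al * conj Q al = A%:R * q%:~R.
  by rewrite cE /al /q /qform; ring: (qw2 Q) EC.
have uA := natr_unit k A0; have uq := intr_unit k q0.
(* In the split algebra a nonzero element need not be invertible; here it is, because its norm A q
   is nonzero. *)
have ual : al \is a GRing.unit.
  have : al * conj Q al \is a GRing.unit by rewrite nE unitrM uA.
  by rewrite unitrM => /andP [].
have uM := natr_unit k M0.
have uL : M%:R / al \is a @GRing.unit k by rewrite unitrM uM unitrV.
exists (lat_scale (M%:R / al) b); last by rewrite ideal_class_scale.
split; first exact: lat_scale_zsub.
  move=> _ [v bv <-].
  have : lat_mul b (conjs Q b) (v * conj Q al) by apply: lat_mulP => //; exists al.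
  rewrite (hlat_conj hC hg omb) => -[u ou hu].
  have -> : M%:R / al * v = r%:~R * u.
    apply: (mulrI uA); apply: (mulrI uq).
    have -> : q%:~R * (A%:R * (r%:~R * u)) = (q * r)%:~R * ((1 * (1 * A))%N%:R * u).
      by rewrite !mul1n; ring.
    rewrite hu -Mr.
    transitivity (al^-1 * (al * conj Q al) * (M%:R * v)); first by rewrite nE; ring.
    have -> : al^-1 * (al * conj Q al) * (M%:R * v) =
      (al^-1 * al) * (M%:R * (v * conj Q al)) by ring.
    by rewrite mulVr // mul1r.
  by apply: (zsubMz (ord_zsub Q m)).
move=> u ou; exists (u * al); first exact: hbm.
by rewrite [u * al]mulrC mulrA mulrVK.
Qed.

End ClassFiniteness.

(** * Characters, their conductors, and orthogonality on U *)

Section CharacterTheory.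
Variables (R : realType) (k : comUnitAlgType rat) (Q : quadratic_basis k).
Implicit Types (a b c u : set k) (x y : k) (m d : nat).
Notation ord := (ord Q).
Notation invm := (invm Q).
Variables (m : nat) (chi : set (set k) -> R[i]).
Hypotheses (m0 : (0 < m)%N) (hchi : is_character (ord m) chi).

Notation chic a := (chi (ideal_class (ord m) a)).

Lemma chi_mul a a' b b' : invm m a a' -> invm m b b' ->
  chic (lat_mul a b) = chic a * chic b.
Proof.
move=> ha hb; case: hchi => _ h; apply: h.
  exact: (invm_invertible m0 ha).
exact: (invm_invertible m0 hb).
Qed.

Lemma chi_neq0 a a' : invm m a a' -> chic a != 0.
Proof.
move=> h; have := chi_mul h (invmC h); case: (h) => _ _ ->; case: hchi => -> _ e.
by apply/eqP => e0; move: e; rewrite e0 mul0r => /eqP; rewrite oner_eq0.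
Qed.

(** Two different powers of [a] lie in one class, so the value at [a] is a root of unity. *)
Lemma normr_chi a a' : invm m a a' -> `|chic a| = 1.
Proof.
move=> h; pose pw i := iter i (lat_mul a) (ord m).
have hpw i : exists b', invm m (pw i) b'.
  elim: i => [|i [b' IH]]; first by exists (ord m); apply: invm_ord.
  by exists (lat_mul a' b'); apply: invm_mul.
have chipw i : chic (pw i) = chic a ^+ i.
  elim: i => [|i IH]; first by rewrite expr0; case: hchi.
  by have [b' hb] := hpw i; rewrite exprS -IH /pw iterS; apply: chi_mul h hb.
have [i [j [ij e]]] : exists i j, (i < j)%N /\
    ideal_class (ord m) (pw i) = ideal_class (ord m) (pw j).
  apply: contrapT => hn.
  have inj : injective (fun i => ideal_class (ord m) (pw i)).
    move=> i j e; apply/eqP; case: (ltngtP i j) => // ij; exfalso; apply: hn.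
      by exists i, j.
    by exists j, i.
  apply: infinite_nat; have := finite_classes Q m0.
  move=> /(@sub_finite_set _ ((fun i => ideal_class (ord m) (pw i)) @` setT)) H.
  have /eq_finite_set <- : card_eq ((fun i => ideal_class (ord m) (pw i)) @` setT) [set: nat].
    by apply: inj_card_eq => x y _ _; apply: inj.
  by apply: H => _ [i _ <-]; exists (pw i) => //; apply: hpw.
have : chic a ^+ (j - i) = 1.
  apply: (mulIf (expf_neq0 i (chi_neq0 h))).
  by rewrite -exprD subnK ?(ltnW ij) // mul1r -!chipw e.
move=> /(congr1 Num.norm); rewrite normr1 normrX => /eqP.
by rewrite pexpr_eq1 ?subn_gt0 // => /eqP.
Qed.

(** For m' | m this is equivalent to chi being defined at m' ([defined_atP]). It speaks of chi
    alone, without a choice of chi', which makes gcds and multiples of m' easy to treat. *)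
Definition trivial_on_U m' := forall u u', invm m u u' -> lat_mul u (ord m') = ord m' -> chic u = 1.

Lemma induced_triv m' chi' : induced_from (ord m) (ord m') chi chi' -> trivial_on_U m'.
Proof.
by move=> [[c1 _] h] u u' hu e; rewrite (h _ (invm_invertible m0 hu)) e.
Qed.

(** If b O_{m'} = x a O_{m'}, then b (x a)^-1 lies in U(O_{m'}, O_m), where chi is 1. *)
Lemma triv_ext m' a a' b b' : (m' %| m)%N -> trivial_on_U m' -> invm m a a' -> invm m b b' ->
  ideal_class (ord m') (lat_mul a (ord m')) = ideal_class (ord m') (lat_mul b (ord m')) ->
  chic a = chic b.
Proof.
move=> mm tr ha hb e; have m0' := dvdn_gt0 m0 mm.
have [x ux E] := ideal_class_eq m0' (invm_ext mm ha) (invm_ext mm hb) e.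
have [[za hma] [za' _] Eo] := ha; have [[zb _] _ _] := hb.
have hx := invm_scale ux ha; have [_ [zx _] _] := hx.
have : chic (lat_mul b (lat_scale x^-1 a')) = 1.
  apply: (tr _ _ (invm_mul hb (invmC hx))).
  rewrite lat_mul_ext // E.
  have := invm_ext mm hx.
  by rewrite (lat_mul_scale _ za (ord_zsub Q m')) => -[_ _ ->].
rewrite (chi_mul hb (invmC hx)).
have := chi_mul hx (invmC hx); case: (hx) => _ _ ->; case: hchi => -> _.
rewrite ideal_class_scale //.
move=> e1 e2; apply: (mulIf (chi_neq0 (invmC hx))).
by rewrite -e1 e2.
Qed.

Lemma triv_induced m' : (m' %| m)%N -> trivial_on_U m' ->
  exists chi', induced_from (ord m) (ord m') chi chi'.
Proof.
move=> mm tr; have m0' := dvdn_gt0 m0 mm.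
pose good C a := (exists a', invm m a a') /\ ideal_class (ord m') (lat_mul a (ord m')) = C.
(* The value is read at some O_m-ideal whose extension has class C; [triv_ext] removes the
   dependence on the choice. The default [set0] is reached only if C is not such a class. *)
pose chi' C := chic (xget set0 [set a | good C a]).
have key a a' : invm m a a' -> chi' (ideal_class (ord m') (lat_mul a (ord m'))) = chic a.
  move=> ha; rewrite /chi'; case: xgetP => [b -> [[b' hb] e]|/(_ a) []]; last first.
    by split=> //; exists a'.
  exact: (triv_ext mm tr hb ha e).
exists chi'; split; last by move=> a /invertible_invm [a' /key ->].
split.
  have := key _ _ (invm_ord Q m); rewrite ord_mul // => ->; by case: hchi.
move=> b1 b2 /invertible_invm [b1' h1] /invertible_invm [b2' h2].
(* Arbitrary invertible O_{m'}-ideals are replaced by extensions of O_m-ideals, where chi' is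
   already known. *)
have [d mE] := dvdnP mm; have d0 : (0 < d)%N by move: m0; rewrite mE muln_gt0 => /andP [].
rewrite mulnC in mE.
have [a1 [a1' []]] := exists_lift m0' d0 h1; rewrite -mE => i1 <-.
have [a2 [a2' []]] := exists_lift m0' d0 h2; rewrite -mE => i2 <-.
have [[z1 _] _ _] := i1; have [[z2 _] _ _] := i2.
rewrite -lat_mul_ext // (key _ _ (invm_mul i1 i2)) (key _ _ i1) (key _ _ i2).
exact: chi_mul i1 i2.
Qed.

Lemma triv_gcd m1 m2 : (m1 %| m)%N -> (m2 %| m)%N -> trivial_on_U m1 -> trivial_on_U m2 ->
  trivial_on_U (gcdn m1 m2).
Proof.
move=> d1 d2 t1 t2 u u' hu e.
have [a1 [b1 [a2 [b2 [i1 e1 i2 e2 ->]]]]] := Ugroup_gcd m0 d1 d2 hu e.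
by rewrite (chi_mul i1 i2) (t1 _ _ i1 e1) (t2 _ _ i2 e2) mulr1.
Qed.

Lemma triv_mono m1 m2 : (m1 %| m2)%N -> trivial_on_U m1 -> trivial_on_U m2.
Proof.
move=> d t1 u u' hu e; apply: (t1 _ _ hu); have [[zu _] _ _] := hu.
by rewrite -(lat_mul_ext2 Q d zu) e ord_mul.
Qed.

Lemma defined_atP m' : (m' %| m)%N -> defined_at (ord 1) m chi m' <-> trivial_on_U m'.
Proof.
move=> mm; rewrite /defined_at !suborder_ord; split=> [[chi' h]|]; last exact: triv_induced.
exact: induced_triv h.
Qed.

Lemma conductorP m' : (m' %| m)%N -> (conductor (ord 1) m chi %| m')%N <-> trivial_on_U m'.
Proof.
move=> mm; rewrite /conductor; set f := (X in (X %| _)%N).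
have fdvd m'' : (m'' %| m)%N -> trivial_on_U m'' -> (f %| m'')%N.
  move=> mm' tr; rewrite /f big_mkcond (big_rem m'') /=; last by rewrite -dvdn_divisors.
  rewrite asboolT /=; first exact: dvdn_gcdl.
  exact: (defined_atP mm').2 tr.
split=> [fm|tr]; last exact: fdvd.
have trm : trivial_on_U m.
  by move=> u u' [hu _ _]; rewrite (lat_mul_ordr hu) => ->; case: hchi.
(* The alternative 0 is the value of the empty gcd; it is excluded at the end, because the gcd
   divides m > 0. *)
pose K (x : nat) := x = 0%N \/ (x %| m)%N /\ trivial_on_U x.
have : K f.
  rewrite /f big_seq_cond; apply: (big_ind K); rewrite /K.
  - by left.
  - move=> x y [->|[dx tx]] [->|[dy ty]]; rewrite ?gcd0n ?gcdn0; try by [left|right].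
    by right; split; [apply: dvdn_trans dx; apply: dvdn_gcdl|apply: triv_gcd].
  - move=> x /andP []; rewrite -dvdn_divisors // => xm /asboolP dx.
    by right; split=> //; apply: (defined_atP xm).1.
case=> [f0|[_ tf]]; last exact: triv_mono tf.
by move: (fdvd _ (dvdnn m) trm); rewrite f0 dvd0n => /eqP m00; move: m0; rewrite m00.
Qed.

Lemma inducingP m' : (m' %| m)%N -> trivial_on_U m' ->
  induced_from (ord m) (ord m') chi (inducing (ord m) (ord m') chi).
Proof.
move=> mm /(triv_induced mm) [chi' h]; rewrite /inducing.
by case: xgetP => [? -> //|/(_ chi')].
Qed.

(** Orthogonality: if chi(u0) differs from 1 for some u0 in U, multiplication by u0 permutes U, so
    the sum S satisfies S = chi(u0) S. *)
Lemma sum_Ugroup m' : (m' %| m)%N ->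
  \sum_(u <- fset_set (Ugroup (ord m') (ord m))) chic u =
  if `[< trivial_on_U m' >] then (set_card (Ugroup (ord m') (ord m)))%:R else 0.
Proof.
move=> mm; have fU := finite_Ugroup Q m0 mm.
have UP u : u \in fset_set (Ugroup (ord m') (ord m)) <->
    (exists u', invm m u u') /\ lat_mul u (ord m') = ord m'.
  rewrite in_fset_set //; split=> [/set_mem [/invertible_invm ? ?] //|[[u' hu] e]].
  by apply/mem_set; split=> //; apply: (invm_invertible m0 hu).
case: asboolP => [tr|ntr].
  rewrite big_seq (eq_bigr (fun=> 1)) => [|u /UP [[u' hu] e]]; last exact: tr hu e.
  by rewrite -big_seq big_const_seq count_predT iter_addr_0 /set_card.
have [u0 [u0' [h0 [e0 n1]]]] : exists u u',
    invm m u u' /\ lat_mul u (ord m') = ord m' /\ chic u <> 1.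
  apply: contrapT => hn; apply: ntr => u u' hu e; apply: contrapT => ne.
  by apply: hn; exists u, u'.
have [[z0 _] [z0' _] E0] := h0.
set S := \sum_(u <- _) _.
have : S = chic u0 * S.
  rewrite /S mulr_sumr.
  rewrite (perm_big [seq lat_mul u0 u | u <- fset_set (Ugroup (ord m') (ord m))]) /=; last first.
    apply: uniq_perm.
    - exact: fset_uniq.
    - rewrite map_inj_in_uniq ?fset_uniq // => u v /UP [[u' [hu _ _]] _] /UP [[v' [hv _ _]] _].
      exact: (invm_cancel h0 hu hv).
    - move=> u; apply/idP/mapP => [/UP [[u' hu] e]|[v /UP [[v' hv] e] ->]].
        have [[zu hmu] _ _] := hu.
        exists (lat_mul u0' u); last by rewrite lat_mulA // E0 lat_mul_ord.
        apply/UP; split; first by exists (lat_mul u0 u'); apply: invm_mul => //; apply: invmC.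
        rewrite lat_mul_ext // e lat_mulC lat_mul_ord; last by apply: omod_ext.
        have [_ _] := invm_ext mm h0; rewrite e0 lat_mul_ord //; exact: omod_ext.
      have [[zv _] _ _] := hv.
      apply/UP; split; first by exists (lat_mul u0' v'); apply: invm_mul.
      by rewrite lat_mul_ext // e e0 ord_mul.
  rewrite big_map big_seq [RHS]big_seq; apply: eq_bigr => u /UP [[u' hu] _].
  exact: chi_mul h0 hu.
move=> /eqP; rewrite -subr_eq0 -{1}[S]mul1r -mulrBl mulf_eq0 => /orP [|/eqP //].
by rewrite subr_eq0 => /eqP e; case: n1.
Qed.

End CharacterTheory.
(** * Unordered sums *)

Section UnorderedSums.
Variable R : realType.
Local Open Scope ereal_scope.

Lemma max_decomposition (x : R) : (Num.max x 0 - Num.max (- x) 0 = x)%R.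
Proof.
have [x0|x0] := leP 0%R x; rewrite ?(max_l x0) ?(max_r (ltW x0)).
  by rewrite max_r ?subr0 // oppr_le0.
by rewrite max_l ?sub0r ?opprK // oppr_ge0 ltW.
Qed.

Lemma esum_fin (T : choiceType) (D : set T) (u g : T -> R) :
  (forall i, D i -> 0 <= u i)%R -> (forall i, D i -> u i <= g i)%R ->
  \esum_(i in D) (g i)%:E < +oo -> \esum_(i in D) (u i)%:E \is a fin_num.
Proof.
move=> u0 ug gfin; rewrite ge0_fin_numE; last by apply: esum_ge0 => i Di; rewrite lee_fin u0.
by apply: le_lt_trans gfin; apply: le_esum => i Di; rewrite lee_fin ug.
Qed.

(** Any decomposition into nonnegative summable parts computes the sum: f = u - v gives f^+ + v =
    f^- + u, and sums of nonnegative families are additive. *)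
Lemma rsum_sub (T : choiceType) (D : set T) (f u v : T -> R) :
  (forall i, D i -> 0 <= u i)%R -> (forall i, D i -> 0 <= v i)%R ->
  \esum_(i in D) (u i)%:E < +oo -> \esum_(i in D) (v i)%:E < +oo ->
  (forall i, D i -> f i = u i - v i)%R ->
  (rsum D f = fine (\esum_(i in D) (u i)%:E) - fine (\esum_(i in D) (v i)%:E))%R.
Proof.
move=> u0 v0 uf vf fE.
have fu : \esum_(i in D) (u i)%:E \is a fin_num by apply: (esum_fin _ _ uf).
have fv : \esum_(i in D) (v i)%:E \is a fin_num by apply: (esum_fin _ _ vf).
have p0 (g : T -> R) i : (0 <= Num.max (g i) 0)%R by rewrite le_max lexx orbT.
have fp : \esum_(i in D) (Num.max (f i) 0)%:E \is a fin_num.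
  apply: (esum_fin _ _ uf) => i Di //; rewrite ge_max u0 // andbT fE //.
  by have := v0 i Di; lra.
have fn : \esum_(i in D) (Num.max (- f i) 0)%:E \is a fin_num.
  apply: (esum_fin _ _ vf) => i Di //; first exact: (p0 (fun i => - f i)%R).
  by rewrite ge_max v0 // andbT fE //; have := u0 i Di; lra.
rewrite /rsum; apply/eqP; rewrite subr_eq addrAC -subr_eq opprK; apply/eqP.
rewrite -!fineD //; congr fine.
rewrite -!esumD; try by move=> i Di; rewrite lee_fin ?p0 ?u0 ?v0 //; apply: (p0 (fun i => - f i)%R).
apply: eq_esum => i Di; rewrite -!EFinD; congr EFin.
by have := max_decomposition (f i); have := fE i Di; lra.
Qed.

Definition rsummable (T : choiceType) (D : set T) (f : T -> R) :=
  \esum_(i in D) (`|f i|%R)%:E < +oo.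

Lemma rsummable_le (T : choiceType) (D : set T) (f g : T -> R) :
  (forall i, D i -> `|f i| <= g i)%R -> \esum_(i in D) (g i)%:E < +oo -> rsummable D f.
Proof. by move=> h; apply: le_lt_trans; apply: le_esum => i Di; rewrite lee_fin h. Qed.

Lemma rsummable_pos (T : choiceType) (D : set T) (f : T -> R) : rsummable D f ->
  \esum_(i in D) (Num.max (f i) 0)%:E < +oo /\ \esum_(i in D) (Num.max (- f i) 0)%:E < +oo.
Proof.
move=> h; split; apply: le_lt_trans h; apply: le_esum => i Di;
  rewrite lee_fin ge_max normr_ge0 andbT.
  exact: ler_norm.
by rewrite lerNl lerNnormlW.
Qed.

Lemma eq_rsum (T : choiceType) (D : set T) (f g : T -> R) :
  (forall i, D i -> f i = g i) -> rsum D f = rsum D g.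
Proof.
by move=> h; rewrite /rsum; congr (fine _ - fine _)%R; apply: eq_esum => i Di; rewrite h.
Qed.

Lemma rsumD (T : choiceType) (D : set T) (f g : T -> R) :
  rsummable D f -> rsummable D g ->
  (rsum D (fun i => f i + g i) = rsum D f + rsum D g)%R.
Proof.
move=> /rsummable_pos [fp fn] /rsummable_pos [gp gn].
have p0 (h : T -> R) i : (0 <= Num.max (h i) 0)%R by rewrite le_max lexx orbT.
have n0 (h : T -> R) i : (0 <= Num.max (- h i) 0)%R by rewrite le_max lexx orbT.
have ED (h1 h2 : T -> R) : (forall i, 0 <= h1 i)%R -> (forall i, 0 <= h2 i)%R ->
    \esum_(i in D) (h1 i + h2 i)%:E = \esum_(i in D) (h1 i)%:E + \esum_(i in D) (h2 i)%:E.
  move=> h10 h20; rewrite -esumD; try by move=> i _; rewrite lee_fin.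
  by apply: eq_esum => i _; rewrite EFinD.
rewrite (@rsum_sub _ _ _ (fun i => Num.max (f i) 0 + Num.max (g i) 0)%R
  (fun i => Num.max (- f i) 0 + Num.max (- g i) 0)%R).
- rewrite !ED //; try by move=> i; [exact: p0|exact: n0].
  rewrite !fineD ?ge0_fin_numE //; try by apply: esum_ge0 => i _; rewrite lee_fin ?p0 ?n0.
  by rewrite /rsum; lra.
- by move=> i _; rewrite addr_ge0 ?p0.
- by move=> i _; rewrite addr_ge0 ?n0.
- by rewrite ED //; apply: lte_add_pinfty.
- by rewrite ED //; apply: lte_add_pinfty.
- by move=> i _; have := max_decomposition (f i); have := max_decomposition (g i); lra.
Qed.

Lemma rsumN (T : choiceType) (D : set T) (f : T -> R) :
  (rsum D (fun i => - f i) = - rsum D f)%R.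
Proof.
rewrite /rsum opprB; congr (_ - fine _)%R.
by apply: eq_esum => i _; rewrite opprK.
Qed.

(** For c > 0 one inequality comes from finite partial sums; the other is the same inequality for
    c^-1 and the family c f. *)
Lemma esumZ (T : choiceType) (D : set T) (c : R) (f : T -> R) : (0 <= c)%R ->
  (forall i, 0 <= f i)%R -> \esum_(i in D) (c * f i)%:E = c%:E * \esum_(i in D) (f i)%:E.
Proof.
move=> c0 f0; have [->|cN0] := eqVneq c 0%R.
  by rewrite mul0e esum1 // => i _; rewrite mul0r.
have le (d : R) (g : T -> R) : (0 < d)%R -> (forall i, 0 <= g i)%R ->
    \esum_(i in D) (d * g i)%:E <= d%:E * \esum_(i in D) (g i)%:E.
  move=> d0 g0; apply: ge_ereal_sup => _ [F [Ff FD] <-].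
  under eq_fsbigr do rewrite EFinM.
  rewrite -ge0_mule_fsumr; last by move=> i; rewrite lee_fin.
  rewrite lee_pmul2l ?lte_fin //; apply: ereal_sup_ubound; exists F => //.
have c0' : (0 < c)%R by rewrite lt_def cN0.
apply/eqP; rewrite eq_le le //=.
have := le (c^-1)%R (fun i => c * f i)%R.
rewrite invr_gt0 => /(_ c0' (fun i => mulr_ge0 c0 (f0 i))).
under eq_esum do rewrite mulKf //.
have H x y : x <= (c^-1)%:E * y -> c%:E * x <= y.
  move=> h; rewrite -[y]mul1e -(mulfV cN0) EFinM -muleA lee_pmul2l ?lte_fin //.
by move=> h; apply: H.
Qed.

Lemma rsummableZ (T : choiceType) (D : set T) (c : R) (f : T -> R) :
  rsummable D f -> rsummable D (fun i => c * f i)%R.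
Proof.
rewrite /rsummable => h; under eq_esum do rewrite normrM.
by rewrite esumZ // lte_mul_pinfty.
Qed.

Lemma rsumZ (T : choiceType) (D : set T) (c : R) (f : T -> R) :
  rsummable D f -> (rsum D (fun i => c * f i) = c * rsum D f)%R.
Proof.
move=> hf.
have H (d : R) : (0 <= d -> rsum D (fun i => d * f i) = d * rsum D f)%R.
  move=> d0; rewrite /rsum mulrBr.
  have E (g : T -> R) : (fine (\esum_(i in D) (Num.max (d * g i) 0)%:E) =
      d * fine (\esum_(i in D) (Num.max (g i) 0)%:E))%R.
    have -> : \esum_(i in D) (Num.max (d * g i) 0)%:E = d%:E * \esum_(i in D) (Num.max (g i) 0)%:E.
      rewrite -esumZ //; last by move=> i; rewrite le_max lexx orbT.
      by apply: eq_esum => i _; rewrite maxr_pMr // mulr0.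
    have : 0 <= \esum_(i in D) (Num.max (g i) 0)%:E.
      by apply: esum_ge0 => i _; rewrite lee_fin le_max lexx orbT.
    (* An infinite sum gives 0 on both sides, since [fine] sends +oo to 0. *)
    case: (\esum_(i in D) _) => [r _ //|_|//].
    have [->|dN0] := eqVneq d 0%R; first by rewrite mul0e mul0r.
    by rewrite gt0_muley ?lte_fin ?lt_def ?dN0 //= mulr0.
  rewrite (E f) -(E (fun i => - f i)%R); congr (_ - fine _)%R.
  by apply: eq_esum => i _; rewrite mulrN.
have [c0|c0] := leP 0%R c; first exact: H.
rewrite -[LHS]opprK -rsumN (eq_rsum (g := fun i => - c * f i)%R); last first.
  by move=> i _; rewrite mulNr.
by rewrite H ?oppr_ge0 ?ltW //; ring.
Qed.

Lemma esum_partition (T I : choiceType) (D : set T) (r : seq I) (D_ : I -> set T)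
    (a : T -> \bar R) : uniq r -> (forall x, 0 <= a x) ->
  (forall x, D x <-> exists2 i, i \in r & D_ i x) ->
  (forall i j x, i \in r -> j \in r -> D_ i x -> D_ j x -> i = j) ->
  \esum_(x in D) a x = \sum_(i <- r) \esum_(x in D_ i) a x.
Proof.
move=> ur a0 cov dis; rewrite esum_mkcond.
under [RHS]eq_bigr do rewrite esum_mkcond.
rewrite -esum_sum; last by move=> *; case: ifP.
apply: eq_esum => x _; case: ifPn => [/set_mem /cov [i ir Dix]|nD].
  rewrite (bigD1_seq i) //= ifT ?inE // big_seq_cond big1 ?adde0 // => j /andP [jr ji].
  case: ifPn => // /set_mem Djx; move: ji; by rewrite (dis j i x jr ir Djx Dix) eqxx.
rewrite big_seq big1 // => i ir; case: ifPn => // /set_mem Dix.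
by move: nD; rewrite notin_setE; case; apply/cov; exists i.
Qed.

Lemma rsum_partition (T I : choiceType) (D : set T) (r : seq I) (D_ : I -> set T)
    (f : T -> R) : uniq r -> rsummable D f ->
  (forall x, D x <-> exists2 i, i \in r & D_ i x) ->
  (forall i j x, i \in r -> j \in r -> D_ i x -> D_ j x -> i = j) ->
  (rsum D f = \sum_(i <- r) rsum (D_ i) f)%R.
Proof.
move=> ur hf cov dis; have [fp fn] := rsummable_pos hf.
have H (g : T -> R) : (forall i, 0 <= g i)%R -> \esum_(i in D) (g i)%:E < +oo ->
    (fine (\esum_(i in D) (g i)%:E) = \sum_(i <- r) fine (\esum_(x in D_ i) (g x)%:E))%R.
  move=> g0 gf; rewrite (esum_partition (r := r) (D_ := D_)) //.
  rewrite big_seq [RHS]big_seq -sum_fine // => i ir.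
  rewrite ge0_fin_numE; last by apply: esum_ge0 => *; rewrite lee_fin.
  apply: le_lt_trans gf; rewrite [leLHS]esum_mkcond [leRHS]esum_mkcond.
  apply: le_esum => x _; case: ifPn => [/set_mem Dix|_]; last by case: ifP => //; rewrite lee_fin.
  by rewrite ifT ?lexx // inE; apply/cov; exists i.
rewrite /rsum sumrB; congr (_ - _)%R; apply: H => // i; by rewrite le_max lexx orbT.
Qed.

Lemma rsum_reindex (T T' : choiceType) (P : set T) (D : set T') (e : T -> T') (f : T' -> R) :
  set_bij P D e -> rsum D f = rsum P (f \o e).
Proof. by move=> h; rewrite /rsum !(reindex_esum P D e _ h). Qed.

End UnorderedSums.

(** * Complex unordered sums and powers of integers *)

Section ComplexSums.
Variable R : realType.
Local Notation Re := complex.Re.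
Local Notation Im := complex.Im.

Definition csummable (T : choiceType) (D : set T) (F : T -> R[i]) :=
  rsummable D (fun i => Re (F i)) /\ rsummable D (fun i => Im (F i)).

Lemma eq_csum (T : choiceType) (D : set T) (F G : T -> R[i]) :
  (forall i, D i -> F i = G i) -> csum D F = csum D G.
Proof. by move=> h; rewrite /csum; congr (_ +i* _)%C; apply: eq_rsum => i /h ->. Qed.

Lemma csumZ (T : choiceType) (D : set T) (c : R[i]) (F : T -> R[i]) :
  csummable D F -> csum D (fun i => c * F i) = c * csum D F.
Proof.
move=> [hr hi]; rewrite /csum; case: c => c d.
have -> : rsum D (fun i => Re ((c +i* d)%C * F i)) =
    c * rsum D (fun i => Re (F i)) + (- d) * rsum D (fun i => Im (F i)).
  rewrite -!rsumZ // -rsumD; [|exact: rsummableZ|exact: rsummableZ].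
  by apply: eq_rsum => i _; case: (F i) => x y /=; ring.
have -> : rsum D (fun i => Im ((c +i* d)%C * F i)) =
    c * rsum D (fun i => Im (F i)) + d * rsum D (fun i => Re (F i)).
  rewrite -!rsumZ // -rsumD; [|exact: rsummableZ|exact: rsummableZ].
  by apply: eq_rsum => i _; case: (F i) => x y /=; ring.
by apply/eqP; rewrite eq_complex /=; apply/andP; split; apply/eqP; ring.
Qed.

Lemma csum_partition (T I : choiceType) (D : set T) (r : seq I) (D_ : I -> set T)
    (F : T -> R[i]) : uniq r -> csummable D F ->
  (forall x, D x <-> exists2 i, i \in r & D_ i x) ->
  (forall i j x, i \in r -> j \in r -> D_ i x -> D_ j x -> i = j) ->
  csum D F = \sum_(i <- r) csum (D_ i) F.
Proof.
move=> ur [hr hi] cov dis; rewrite /csum.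
rewrite (rsum_partition ur hr cov dis) (rsum_partition ur hi cov dis).
elim: (r) => [|i s IH]; first by rewrite !big_nil.
by rewrite !big_cons -IH; apply/eqP; rewrite eq_complex /= !eqxx.
Qed.

Lemma csum_reindex (T T' : choiceType) (P : set T) (D : set T') (e : T -> T')
    (F : T' -> R[i]) : set_bij P D e -> csum D F = csum P (F \o e).
Proof. by move=> h; rewrite /csum !(rsum_reindex _ h). Qed.

Lemma csummable_le (T : choiceType) (D : set T) (F : T -> R[i]) (g : T -> R) :
  (forall i, D i -> `|F i| <= (g i)%:C%C) -> (\esum_(i in D) (g i)%:E < +oo)%E ->
  csummable D F.
Proof.
move=> h hg; split; apply: (rsummable_le _ hg) => i Di; have := h i Di;
  rewrite normc_def lecE /= eqxx /= => hh; apply: le_trans hh;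
  rewrite -sqrtr_sqr ler_sqrt ?addr_ge0 ?sqr_ge0 //.
  by rewrite lerDl sqr_ge0.
by rewrite lerDr sqr_ge0.
Qed.

Lemma natpowC_expD (x y x' y' : R) :
  ((expR x * cos y) +i* (expR x * sin y))%C * ((expR x' * cos y') +i* (expR x' * sin y'))%C =
  ((expR (x + x') * cos (y + y')) +i* (expR (x + x') * sin (y + y')))%C.
Proof.
apply/eqP; rewrite eq_complex /= expRD cosD sinD.
by apply/andP; split; apply/eqP; ring.
Qed.

Lemma natpowCM (n n' : nat) (s : R[i]) : (0 < n)%N -> (0 < n')%N ->
  natpowC (n * n') s = natpowC n s * natpowC n' s.
Proof.
move=> n0 n0'; rewrite /natpowC natpowC_expD natrM lnM ?posrE ?ltr0n //.
by rewrite !mulrDr.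
Qed.

Lemma natpowC_sqr (n : nat) (s : R[i]) : (0 < n)%N ->
  natpowC (n ^ 2) s = natpowC n (2%:R * s).
Proof.
move=> n0; rewrite -mulnn natpowCM // /natpowC natpowC_expD.
have -> : Re (2%:R * s) = 2 * Re s by case: s => x y /=; ring.
have -> : Im (2%:R * s) = 2 * Im s by case: s => x y /=; ring.
by rewrite -!mulrA !mulr_natl !mulr2n.
Qed.

Lemma normr_natpowC (n : nat) (s : R[i]) :
  `|natpowC n s| = (expR (Re s * ln n%:R))%:C%C.
Proof.
rewrite normc_def /=; congr (_%:C)%C.
rewrite !exprMn -mulrDr cos2Dsin2 mulr1 sqrtr_sqr ger0_norm // expR_ge0.
Qed.

Lemma natpowC1 (s : R[i]) : natpowC 1 s = 1.
Proof.
by rewrite /natpowC ln1 !mulr0 expR0 cos0 sin0 mul1r mulr0.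
Qed.

End ComplexSums.
(** * Convergence of the Dirichlet series of norms *)

Section DirichletBound.
Variables (R : realType) (sigma : R).
Hypothesis sigma1 : 1 < sigma.

Definition powN (n : nat) : R := expR (- (sigma * ln n%:R)).

Lemma powN_ge0 n : 0 <= powN n. Proof. exact: expR_ge0. Qed.

Lemma powNM n n' : (0 < n)%N -> (0 < n')%N -> powN (n * n') = powN n * powN n'.
Proof.
move=> n0 n0'; rewrite /powN natrM lnM ?posrE ?ltr0n // -expRD.
by congr expR; ring.
Qed.

Lemma powN1 : powN 1 = 1. Proof. by rewrite /powN ln1 mulr0 oppr0 expR0. Qed.

Lemma powN_le n n' : (0 < n)%N -> (n <= n')%N -> powN n' <= powN n.
Proof.
move=> n0 nn; rewrite ler_expR lerN2 ler_pM2l; last exact: lt_trans ltr01 sigma1.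
by rewrite ler_ln ?posrE ?ltr0n ?ler_nat // (leq_trans n0).
Qed.

Lemma powN2 : 2 * powN 2 < 1.
Proof.
have l0 : 0 < ln (2 : R) by rewrite ln_gt0 // ltr1n.
have -> : 2 * powN 2 = expR ((1 - sigma) * ln (2 : R)).
  rewrite /powN -{1}[2 : R]lnK ?posrE ?ltr0n // -expRD; congr expR; ring.
by rewrite expR_lt1 pmulr_llt0 // subr_lt0.
Qed.

(* The sum f satisfies f(N) <= f(2 N + 1) <= 1 + 2 ^ (1 - sigma) f(N). *)
Lemma zeta_bound N : \sum_(i < N) powN i.+1 <= (1 - 2 * powN 2)^-1.
Proof.
pose f N := \sum_(i < N) powN i.+1.
have fS M : f M.+1 = f M + powN M.+1 by rewrite /f big_ord_recr.
have f0 M : 0 <= f M by apply: sumr_ge0 => i _; apply: powN_ge0.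
have key M : f (M.*2).+1 <= 1 + 2 * powN 2 * f M.
  elim: M => [|M IH]; first by rewrite fS /f !big_ord0 powN1 mulr0 add0r addr0.
  rewrite doubleS !fS.
  have h1 : powN M.*2.+2 = powN 2 * powN M.+1 by rewrite -powNM // mul2n doubleS.
  have h2 : powN M.*2.+3 <= powN M.*2.+2 by apply: powN_le.
  move: IH; rewrite fS; nra.
have mono : f N <= f (N.*2).+1.
  have : (N <= N.*2.+1)%N by lia.
  elim: (N.*2.+1) {key} => [|M IH]; first by rewrite leqn0 => /eqP ->.
  rewrite leq_eqVlt => /orP [/eqP ->//|]; rewrite ltnS => /IH h.
  by rewrite fS; apply: le_trans h _; rewrite lerDl powN_ge0.
have q1 := powN2; rewrite -/(f N) -[leRHS]mul1r ler_pdivlMr; last by lra.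
by have := key N; nra.
Qed.

Lemma zeta_summable : (\esum_(n in [set: nat]) (powN n.+1)%:E < +oo)%E.
Proof.
rewrite -nneseries_esumT; last by move=> n; rewrite lee_fin powN_ge0.
apply: (@le_lt_trans _ _ ((1 - 2 * powN 2)^-1)%:E); last exact: ltry.
apply: lime_le; first by apply: is_cvg_nneseries => n _ _; rewrite lee_fin powN_ge0.
by apply: nearW => N; rewrite big_mkord sumEFin lee_fin zeta_bound.
Qed.

Lemma prod_summable (T1 T2 : choiceType) (D1 : set T1) (D2 : set T2) (u : T1 -> R) (v : T2 -> R) :
  (forall i, 0 <= u i) -> (forall i, 0 <= v i) ->
  (\esum_(i in D1) (u i)%:E < +oo)%E -> (\esum_(i in D2) (v i)%:E < +oo)%E ->
  (\esum_(x in D1 `*` D2) (u x.1 * v x.2)%:E < +oo)%E.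
Proof.
move=> u0 v0 hu hv.
have -> : (D1 `*` D2) = D1 `*`` (fun=> D2) by apply/seteqP; split=> -[x y].
rewrite -(@esum_esum _ _ _ D1 (fun=> D2) (fun i j => (u i * v j)%:E)); last first.
  by move=> i j _ _; rewrite lee_fin mulr_ge0.
under eq_esum do rewrite esumZ //.
have v0' : (0 <= \esum_(i in D2) (v i)%:E)%E by apply: esum_ge0 => i _; rewrite lee_fin.
move: (\esum_(i in D2) _)%E hv v0' => [r| |]// _; rewrite lee_fin => r0.
under eq_esum do rewrite -EFinM mulrC.
by rewrite esumZ // lte_mul_pinfty.
Qed.

End DirichletBound.

Lemma residue_inj (q x y : nat) : (x < q)%N -> (y < q)%N ->
  (q %| absz (x%:Z - y%:Z)%R)%N -> x = y.
Proof.
move=> xq yq h; have [//|ne] := eqVneq x y.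
have h0 : (0 < absz (x%:Z - y%:Z)%R)%N by lia.
have := dvdn_leq h0 h; lia.
Qed.

(* For a fixed root B0 modulo A, a root B is determined by g = gcd(B - B0, A) up to
   d = gcd(g, A / g) choices modulo A, and d ^ 2 divides the discriminant D. *)
Lemma quadratic_roots_param (A : nat) (T P D : int) (B0 B : nat) :
  D = T ^+ 2 - 4 * P -> D != 0 -> (0 < A)%N ->
  (A%:Z %| B0%:Z ^+ 2 + B0%:Z * T + P)%Z -> (A%:Z %| B%:Z ^+ 2 + B%:Z * T + P)%Z ->
  let g := gcdn (absz (B%:Z - B0%:Z)) A in let d := gcdn g (A %/ g) in
  [/\ (0 < d <= `|D|)%N, (d %| A)%N, (A %/ d %| lcmn g (A %/ g))%N,
   (g%:Z %| B%:Z - B0%:Z)%Z & ((A %/ g)%N%:Z %| B%:Z + B0%:Z + T)%Z].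
Proof.
move=> DE D0 A0 h0 h1 g d.
have gA : (g %| A)%N by apply: dvdn_gcdr.
have g0 : (0 < g)%N by apply: dvdn_gt0 gA.
have AE : A = (g * (A %/ g))%N by rewrite mulnC divnK.
set h := (A %/ g)%N in d AE *.
have h0' : (0 < h)%N by move: A0; rewrite AE muln_gt0 => /andP [].
have gB : (g%:Z %| B%:Z - B0%:Z)%Z by rewrite dvdzE /= dvdn_gcdl.
have hB : (h%:Z %| B%:Z + B0%:Z + T)%Z.
  (* Divisibility by A / g is tested after multiplication by g, which is a Bezout combination of B -
     B0 and A. The product of B - B0 with B + B0 + T is a difference of two values of the
     polynomial. *)
  have [u [v huv]] := Bezoutz (B%:Z - B0%:Z) A%:Z.
  have gN : g%:Z != 0 by lia.
  rewrite -(dvdz_mul2l gN) -PoszM -AE.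
  have -> : g%:Z = gcdz (B%:Z - B0%:Z) A%:Z by [].
  rewrite -huv.
  have -> : (u * (B%:Z - B0%:Z) + v * A%:Z) * (B%:Z + B0%:Z + T) =
    u * ((B%:Z ^+ 2 + B%:Z * T + P) - (B0%:Z ^+ 2 + B0%:Z * T + P)) +
    A%:Z * (v * (B%:Z + B0%:Z + T)) by ring.
  rewrite rpredD //; last by rewrite dvdz_mulr.
  by rewrite dvdz_mull // rpredB.
have dg : (d %| g)%N by apply: dvdn_gcdl.
have dh : (d %| h)%N by apply: dvdn_gcdr.
have d0 : (0 < d)%N by rewrite gcdn_gt0 g0.
have ddA : (d * d %| A)%N by rewrite AE dvdn_mul.
split=> //.
- rewrite d0 /=.
  (* d divides 2 B0 + T as a difference of multiples of g and A / g, and d^2 divides A, hence P(B0)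
     for the polynomial P; so d^2 divides D = (2 B0 + T)^2 - 4 P(B0). *)
  have /dvdzP [q qE] : (d%:Z %| 2 * B0%:Z + T)%Z.
    have -> : 2 * B0%:Z + T = (B%:Z + B0%:Z + T) - (B%:Z - B0%:Z) by ring.
    by rewrite rpredB // ?(dvdz_trans _ gB) ?(dvdz_trans _ hB).
  have : ((d * d)%N%:Z %| D)%Z.
    have -> : D = (2 * B0%:Z + T) ^+ 2 - 4 * (B0%:Z ^+ 2 + B0%:Z * T + P) by rewrite DE; ring.
    rewrite rpredB //; last by rewrite dvdz_mull // (dvdz_trans _ h0).
    by rewrite qE expr2 PoszM dvdz_mul // dvdz_mull.
  rewrite dvdzE /= => /dvdn_leq; rewrite absz_gt0 => /(_ D0) hd.
  by apply: leq_trans hd; rewrite leq_pmulr.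
- by apply: dvdn_trans dg gA.
- rewrite -/h; have e : (lcmn g h * d = A)%N by rewrite muln_lcm_gcd -AE.
  by rewrite -{1}e mulnK.
Qed.

(** * Counting integral ideals by their index *)

Section IdealCount.
Variables (k : comUnitAlgType rat) (Q : quadratic_basis k).
Implicit Types (a b : set k) (m d e A B : nat).
Notation t := (qt Q).
Notation n := (qn Q).
Notation ord := (ord Q).
Notation invm := (invm Q).
Variables (R : realType) (m : nat) (sigma : R).
Hypotheses (m0 : (0 < m)%N) (sigma1 : 1 < sigma).

Let N (B : nat) : int := B%:Z ^+ 2 + B%:Z * m%:Z * t + m%:Z ^+ 2 * n.
(** One fixed root modulo A. The default 0 is taken only if there is no root, and then no ideal has
    this A in its normal form. *)
Let B0 (A : nat) : nat := xget 0%N [set B | (A%:Z %| N B)%Z].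
Let D : int := (m%:Z * t) ^+ 2 - 4 * (m%:Z ^+ 2 * n).

(* A code (e, h, h', r) of an ideal of index e^2 h h'; the components e, h, h' are
   shifted by one to range over nat. *)
Definition ideal_code a (c : (nat * nat) * (nat * nat)) : Prop :=
  let e := c.1.1.+1 in let h := c.1.2.+1 in let h' := c.2.1.+1 in
  exists B : nat, [/\ a = hlat Q m e (h * h') B, (B < h * h')%N,
    ((h * h')%N%:Z %| N B)%Z, gcdn (absz (B%:Z - (B0 (h * h'))%:Z)) (h * h') = h &
    c.2.2 = (B %/ (h * h' %/ gcdn h h'))%N].

Let D_neq0 : D != 0.
Proof.
have -> : D = m%:Z ^+ 2 * (t ^+ 2 - 4 * n) by rewrite /D; ring.
by rewrite mulf_neq0 ?qdisc // expf_neq0 //; lia.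
Qed.

Let params A B : (0 < A)%N -> (A%:Z %| N B)%Z ->
  let g := gcdn (absz (B%:Z - (B0 A)%:Z)) A in let d := gcdn g (A %/ g) in
  [/\ (0 < d <= `|D|)%N, (d %| A)%N, (A %/ d %| lcmn g (A %/ g))%N,
   (g%:Z %| B%:Z - (B0 A)%:Z)%Z & ((A %/ g)%N%:Z %| B%:Z + (B0 A)%:Z + m%:Z * t)%Z].
Proof.
move=> A0 h; have h0 : (A%:Z %| N (B0 A))%Z by rewrite /B0; case: xgetP => [? -> //|/(_ B)].
have NE B1 : N B1 = B1%:Z ^+ 2 + B1%:Z * (m%:Z * t) + m%:Z ^+ 2 * n by rewrite /N; ring.
rewrite NE in h; rewrite NE in h0.
exact: (@quadratic_roots_param A (m%:Z * t) (m%:Z ^+ 2 * n) D (B0 A) B).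
Qed.

(** B is B0 modulo h and -B0 - m t modulo h', so it is known modulo lcm(h, h'), a multiple of A / d.
    The last component r is the quotient of B by A / d and fixes B itself. *)
Lemma ideal_code_inj a a' c : ideal_code a c -> ideal_code a' c -> a = a'.
Proof.
case: c => -[e h] [h' r]; rewrite /ideal_code /=.
set H := h.+1; set H' := h'.+1; set A := (H * H')%N.
move=> [B [-> BA NB gB rB]] [B' [-> BA' NB' gB' rB']].
have A0 : (0 < A)%N by rewrite muln_gt0.
have AH : (A %/ H)%N = H' by rewrite /A mulKn.
have := params A0 NB; cbv zeta; rewrite gB AH => -[d0 dA dl p1 p2].
have := params A0 NB'; cbv zeta; rewrite gB' AH => -[_ _ _ p1' p2'].
set d := gcdn H H' in d0 dA dl rB rB'.
suff -> : B = B' by [].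
have l : (A %/ d %| absz (B%:Z - B'%:Z)%R)%N.
  apply: dvdn_trans dl _; rewrite dvdn_lcm; apply/andP; split.
    have : (H%:Z %| B%:Z - B'%:Z)%Z; last by rewrite dvdzE.
    have -> : B%:Z - B'%:Z = (B%:Z - (B0 A)%:Z) - (B'%:Z - (B0 A)%:Z) by ring.
    by rewrite rpredB.
  have : (H'%:Z %| B%:Z - B'%:Z)%Z; last by rewrite dvdzE.
  have -> : B%:Z - B'%:Z = (B%:Z + (B0 A)%:Z + m%:Z * t) - (B'%:Z + (B0 A)%:Z + m%:Z * t) by ring.
  by rewrite rpredB.
have e0 : (0 < A %/ d)%N by rewrite divn_gt0 ?(dvdn_leq A0 dA) //; case/andP: d0.
set q := (A %/ d)%N in l e0 rB rB'.
have hB := divn_eq B q; have hB' := divn_eq B' q.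
have lB := ltn_pmod B e0; have lB' := ltn_pmod B' e0.
rewrite -rB in hB; rewrite -rB' in hB'.
have l' : (q %| absz ((B %% q)%N%:Z - (B' %% q)%N%:Z)%R)%N.
  by move: l; rewrite {1}hB {1}hB'; congr (_ %| absz _)%N; rewrite !PoszD; ring.
suff e1 : (B %% q = B' %% q)%N by rewrite hB hB' e1.
exact: residue_inj lB lB' l'.
Qed.

Lemma ideal_code_ex a a' : invm m a a' -> a `<=` ord m -> exists c,
  [/\ ideal_code a c, (c.2.2 < `|D|.+1)%N &
   lat_index (ord m) a = (c.1.1.+1 * (c.1.1.+1 * (c.1.2.+1 * c.2.1.+1)))%N].
Proof.
move=> h aO; have [M M0 hM] := invm_lower m0 h; have [ha _ _] := h.
have aM : a M%:R by rewrite -[M%:R]mulr1; apply/hM/ord1.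
have [e [A [B [C [e0 A0 BA hC aE]]]]] := ideal_hnf m0 ha aO M0 aM.
have NB : (A%:Z %| N B)%Z by rewrite /N -hC dvdz_mulr.
have := params A0 NB; cbv zeta; set g := gcdn _ A; move=> [d0 dA dl p1 p2].
have gA : (g %| A)%N by apply: dvdn_gcdr.
have g0 : (0 < g)%N by apply: dvdn_gt0 gA.
have AE : A = (g * (A %/ g))%N by rewrite mulnC divnK.
have h0' : (0 < A %/ g)%N by move: A0; rewrite {1}AE muln_gt0 => /andP [].
exists ((e.-1, g.-1), ((A %/ g).-1, (B %/ (A %/ gcdn g (A %/ g)))%N)).
rewrite /ideal_code /= !prednK // -AE; split.
- by exists B; split.
(* B < A makes the quotient of B by A / d smaller than d, and d <= |D|. *)
- rewrite ltnS; apply: leq_trans (proj2 (andP d0)); apply: ltnW.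
  have d00 := proj1 (andP d0).
  by rewrite ltn_divLR ?divn_gt0 ?(dvdn_leq A0 dA) // mulnC divnK.
- by rewrite aE hlat_index.
Qed.

(** Codes inject the ideals into a box: three free positive integers e, h, h' and |D| + 1 values of
    r. On the box the bounding family is a product, whose sum is |D| + 1 times the cube of the zeta
    sum. *)
Lemma ideals_summable :
  (\esum_(a in [set a | (exists a', invm m a a') /\ a `<=` ord m])
     (powN sigma (lat_index (ord m) a))%:E < +oo)%E.
Proof.
set S := [set a | _].
have ex a : exists c, S a -> [/\ ideal_code a c, (c.2.2 < `|D|.+1)%N &
    lat_index (ord m) a = (c.1.1.+1 * (c.1.1.+1 * (c.1.2.+1 * c.2.1.+1)))%N].
  have [[[a' ha] aO]|nS] := pselect (S a); last by exists ((0, 0), (0, 0))%N.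
  by have [c hc] := ideal_code_ex ha aO; exists c.
have [phi hphi] := boolp.choice ex.
(* [u] takes care of e and h, [v] of h' and r, with weight 1 for r. *)
pose u (x : nat * nat) := powN sigma x.1.+1 * powN sigma x.2.+1.
pose v (x : nat * nat) := powN sigma x.1.+1 * 1 : R.
have zs := zeta_summable sigma1.
have pge x : 0 <= powN sigma x := powN_ge0 sigma x.
have hu : (\esum_(x in [set: nat] `*` [set: nat]) (u x)%:E < +oo)%E 
  by apply: (@prod_summable _ _ _ _ _ (fun i => powN sigma i.+1) (fun i => powN sigma i.+1)).
have hv : (\esum_(x in [set: nat] `*` `I_(`|D|.+1)) (v x)%:E < +oo)%E.
  apply: (@prod_summable _ _ _ _ _ (fun i => powN sigma i.+1) (fun=> 1)) => //.
  rewrite esum_fset ?finite_II //.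
  rewrite fsbig_finite ?finite_II //= sumEFin; exact: ltry.
have := prod_summable (u := u) (v := v) _ _ hu hv.
move=> /(_ (fun i => mulr_ge0 (pge _) (pge _)) (fun i => mulr_ge0 (pge _) ler01)).
apply: le_lt_trans.
set box := (X in \esum_(x in X) _).
have inj : set_bij S (phi @` S) phi.
  split => [a Sa|a b /set_mem Sa /set_mem Sb e|_ [a Sa <-]]; [by exists a| |by exists a].
  have [ca _ _] := hphi _ Sa; have [cb _ _] := hphi _ Sb.
  by rewrite e in ca; apply: ideal_code_inj ca cb.
pose G (x : (nat * nat) * (nat * nat)) := u x.1 * v x.2.
have G0 x : 0 <= G x by rewrite /G /u /v !mulr_ge0.
apply: (@le_trans _ _ (\esum_(x in phi @` S) (G x)%:E)%E).
  rewrite (reindex_esum S (phi @` S) phi _ inj); apply: le_esum => a Sa; rewrite lee_fin.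
  have [_ _ ->] := hphi _ Sa; rewrite /G /u /v mulr1 !powNM ?muln_gt0 //.
  (* The index contains e twice; [u] carries one factor e^(-sigma), and the other is bounded by
     1. *)
  have p1 : powN sigma (phi a).1.1.+1 <= 1 by rewrite -(powN1 sigma); apply: powN_le.
  by rewrite -[leRHS]mulrA; apply: ler_piMl => //; apply: mulr_ge0 => //; apply: mulr_ge0.
rewrite [leLHS]esum_mkcond [leRHS]esum_mkcond; apply: le_esum => x _.
case: ifPn => [/set_mem [a Sa <-]|_]; last by case: ifP => _; [rewrite lee_fin; apply: G0|].
rewrite ifT ?lexx // inE; have [_ h _] := hphi _ Sa.
by split; split.
Qed.

End IdealCount.
(** * The decomposition of the L-series *)

Section Formula.
Variables (R : realType) (k : comUnitAlgType rat) (Q : quadratic_basis k).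
Implicit Types (a b u : set k) (m d : nat).
Notation ord := (ord Q).
Notation invm := (invm Q).
Variables (m : nat) (chi : set (set k) -> R[i]) (s : R[i]).
Hypotheses (m0 : (0 < m)%N) (hchi : is_character (ord m) chi) (s1 : 1 < complex.Re s).

Notation chic a := (chi (ideal_class (ord m) a)).

Definition integral_ideals m' : set (set k) :=
  [set a | (exists a', invm m' a a') /\ a `<=` ord m'].

Definition coprime_ideals m' : set (set k) :=
  [set b | [/\ exists b', invm m' b b', b `<=` ord m' & coprime_cond Q m' b]].

Lemma integral_idealsE m' : (0 < m')%N ->
  [set a | invertible_ideal (ord m') a /\ a `<=` ord m'] = integral_ideals m'.
Proof.
move=> m0'; apply/seteqP; split=> a [h aO]; split=> //; first exact: invertible_invm.
by case: h => a' h; apply: (invm_invertible m0' h).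
Qed.

Lemma coprime_idealsE m' : (0 < m')%N ->
  [set a | [/\ fractional_ideal (ord m') a, a `<=` ord m' &
     lat_add a [set y *+ m' | y in ord 1] = ord m']] = coprime_ideals m'.
Proof.
move=> m0'; rewrite conductor_scale; apply/seteqP; split=> a.
  move=> [hf aO hc]; have ha := fractional_omod hf; have [la _] := hf.
  have cc := (coprime_condP ha aO).1 hc.
  by split=> //; apply: (coprime_invm ha aO cc la).
move=> [[a' h] aO cc]; have [hf _] := invm_invertible m0' h.
by split=> //; apply: (coprime_condP (fractional_omod hf) aO).2.
Qed.

Lemma normr_term (N : nat) (z : R[i]) : `|z| = 1 ->
  `|z / natpowC N s| = (powN (complex.Re s) N)%:C%C.
Proof. by move=> z1; rewrite normrM normfV z1 mul1r normr_natpowC -fmorphV -expRN. Qed.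

Lemma csummable_terms m' (G : set (set k)) (z : set k -> R[i]) : (0 < m')%N ->
  G `<=` integral_ideals m' -> (forall a, G a -> `|z a| = 1) ->
  csummable G (fun a => z a / natpowC (lat_index (ord m') a) s).
Proof.
move=> m0' GI z1.
apply: (csummable_le (g := fun a => powN (complex.Re s) (lat_index (ord m') a))).
  by move=> a Ga; rewrite normr_term // z1.
apply: le_lt_trans (ideals_summable Q m0' s1).
rewrite [leLHS]esum_mkcond [leRHS]esum_mkcond; apply: le_esum => a _.
case: ifPn => [/set_mem /GI h|_]; first by rewrite ifT ?lexx // inE.
by case: ifP => _; rewrite ?lee_fin ?powN_ge0.
Qed.

Section Divisor.
Variables (m' d : nat).
Hypothesis mE : (m = m' * d)%N.

Let mm : (m' %| m)%N. Proof. by rewrite mE dvdn_mulr. Qed.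
Let m0' : (0 < m')%N. Proof. exact: dvdn_gt0 mm. Qed.
Let d0 : (0 < d)%N. Proof. by move: m0; rewrite mE muln_gt0 => /andP []. Qed.

(** A base point in the coset of ideals of O_m lying over d b. *)
Definition chosen_lift b : set k :=
  xget set0 [set a | (exists a', invm m a a') /\ lat_mul a (ord m') = lat_scale d%:R b].

Lemma chosen_liftP b b' : invm m' b b' ->
  (exists a', invm m (chosen_lift b) a') /\
  lat_mul (chosen_lift b) (ord m') = lat_scale d%:R b.
Proof.
move=> hb; have hd := invm_scale (natr_unit k d0) hb.
have [a [a' []]] := exists_lift m0' d0 hd; rewrite -mE => ha e.
rewrite /chosen_lift; case: xgetP => [? -> //|/(_ a) []].
by split=> //; exists a'.
Qed.

(** Here u is fixed and b varies, transversally to the cosets over single ideals b. As U is finite,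
    the integral ideals fall into finitely many such sets. *)
Definition fibre u : set (set k) := [set lat_mul (chosen_lift b) u | b in coprime_ideals m'].

Lemma fibre_mem a a' b b' : invm m a a' -> invm m' b b' ->
  lat_mul a (ord m') = lat_scale d%:R b ->
  exists u u', [/\ invm m u u', lat_mul u (ord m') = ord m' & a = lat_mul (chosen_lift b) u].
Proof.
move=> ha hb e; have [[c hc] ec] := chosen_liftP hb.
have [[za hma] _ _] := ha; have [[zl _] [zc _] Ec] := hc.
exists (lat_mul c a), (lat_mul (chosen_lift b) a'); split.
- by apply: invm_mul => //; apply: invmC.
- rewrite lat_mul_ext // e -ec lat_mulC.
  by have [_ _] := invm_ext mm hc.
- by rewrite lat_mulA // Ec lat_mul_ord.
Qed.

Lemma lift_unit_ext b b' u : invm m' b b' -> zsub u -> lat_mul u (ord m') = ord m' ->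
  lat_mul (lat_mul (chosen_lift b) u) (ord m') = lat_scale d%:R b.
Proof.
move=> hb zu e; have [[c hc] ec] := chosen_liftP hb; have [[zl _] _ _] := hc.
rewrite lat_mul_ext // e ec lat_mulC lat_mul_ord //.
by apply: omod_scale; case: hb.
Qed.

Lemma lift_unit_integral b b' u u' : invm m' b b' -> b `<=` ord m' -> invm m u u' ->
  lat_mul u (ord m') = ord m' -> integral_ideals m (lat_mul (chosen_lift b) u).
Proof.
move=> hb bO hu e; have [[c hc] ec] := chosen_liftP hb; have [[zu _] _ _] := hu.
split; first by exists (lat_mul c u'); apply: invm_mul.
move=> x hx; have : lat_mul (lat_mul (chosen_lift b) u) (ord m') x.
  by rewrite -[x]mulr1; apply: lat_mulP => //; apply: ord1.
by rewrite (lift_unit_ext hb zu e) => -[y /bO oy <-]; rewrite mE; apply: ord_scale.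
Qed.

(** chi is multiplicative on (lift of b) u, whose index equals that of its extension d b, namely d^2
    N b. The remaining sum does not involve u, so summing over U leaves only a character sum to
    evaluate. *)
Lemma csum_fibre u u' : invm m u u' -> lat_mul u (ord m') = ord m' ->
  csum (fibre u) (fun a => chic a / natpowC (lat_index (ord m) a) s) =
  chic u / natpowC d (2%:R * s) *
  csum (coprime_ideals m')
    (fun b => chic (chosen_lift b) / natpowC (lat_index (ord m') b) s).
Proof.
move=> hu e; have [[zu _] _ _] := hu.
rewrite (@csum_reindex _ _ _ (coprime_ideals m') _
  (fun b => lat_mul (chosen_lift b) u)); last first.
  split=> [b hb|b1 b2 /set_mem [[b1' h1] _ _] /set_mem [[b2' h2] _ _] E|_ [b hb <-]].
  - by exists b.
  - apply: (lat_scale_inj (natr_unit k d0)).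
    by rewrite -(lift_unit_ext h1 zu e) -(lift_unit_ext h2 zu e) E.
  - by exists b.
rewrite -csumZ; last first.
  apply: csummable_terms => // [b [hb bO _]|b [[b' hb] _ _]]; first by split.
  by have [[c hc] _] := chosen_liftP hb; apply: (normr_chi m0 hchi hc).
apply: eq_csum => b [[b' hb] bO _] /=.
have [[c hc] ec] := chosen_liftP hb.
have hI := lift_unit_integral hb bO hu e.
rewrite (chi_mul m0 hchi hc hu) -(index_ext m0 mm (invm_mul hc hu) hI.2).
rewrite (lift_unit_ext hb zu e) (index_scale m0' d0 hb bO).
have [i0 _] := invm_index m0' hb bO.
rewrite natpowCM ?expn_gt0 ?d0 // natpowC_sqr // invfM; ring.
Qed.

(** The lift of b extends to d b, which has the class of b; so chi at the lift is the inducing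
    character at b. *)
Lemma csum_lift_triv : trivial_on_U Q m chi m' ->
  csum (coprime_ideals m')
    (fun b => chic (chosen_lift b) / natpowC (lat_index (ord m') b) s) =
  Lseries_star (ord 1) m' (inducing (ord m) (ord m') chi) s.
Proof.
move=> tr; rewrite /Lseries_star suborder_ord coprime_idealsE //.
have [_ hi] := inducingP m0 hchi mm tr.
apply: eq_csum => b [[b' hb] _ _]; have [[c hc] ec] := chosen_liftP hb.
rewrite (hi _ (invm_invertible m0 hc)) ec ideal_class_scale //; first by case: hb.
exact: natr_unit.
Qed.

End Divisor.

Lemma Lseries_formula :
  Lseries (ord m) chi s =
  \sum_(m' <- divisors m | (conductor (ord 1) m chi %| m')%N)
    (set_card (Ugroup (ord m') (ord m)))%:R / natpowC (m %/ m') (2%:R * s) *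
    Lseries_star (ord 1) m' (inducing (ord m) (ord m') chi) s.
Proof.
pose U m' := fset_set (Ugroup (ord m') (ord m)).
pose r := [seq (m', u) | m' <- divisors m, u <- enum_fset (U m')].
pose D_ (x : nat * set k) := fibre x.1 (m %/ x.1) x.2.
have UP m' u : (m' %| m)%N -> u \in U m' ->
    (exists u', invm m u u') /\ lat_mul u (ord m') = ord m'.
  move=> mm; rewrite in_fset_set; last exact: finite_Ugroup.
  by move=> /set_mem [/invertible_invm ? ?].
have rP x : x \in r -> [/\ (x.1 %| m)%N, (m = x.1 * (m %/ x.1))%N,
    exists u', invm m x.2 u' & lat_mul x.2 (ord x.1) = ord x.1].
  move=> /allpairsPdep [m' [u [mm hu ->]]] /=; rewrite -dvdn_divisors // in mm.
  by have [? ?] := UP _ _ mm hu; split=> //; rewrite mulnC divnK.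
rewrite /Lseries integral_idealsE //.
rewrite (@csum_partition _ _ _ _ r D_); first last.
(* Disjointness: [a] determines m' through its content, then b through a O_{m'} = d b, and then u by
   cancelling the chosen lift. *)
- move=> x y a xr yr [b1 [[b1' h1] b1O c1] e1] [b2 [[b2' h2] b2O c2] e2].
  have [mx ex [u1 hu1] eu1] := rP _ xr; have [my ey [u2 hu2] eu2] := rP _ yr.
  have [[zu1 _] _ _] := hu1; have [[zu2 _] _ _] := hu2.
  have E1 := lift_unit_ext ex h1 zu1 eu1; rewrite e1 in E1.
  have E2 := lift_unit_ext ey h2 zu2 eu2; rewrite e2 in E2.
  have [[l1 hl1] _] := chosen_liftP ex h1.
  have ha : omod Q m a by have [ha _ _] := invm_mul hl1 hu1; rewrite e1 in ha.
  have xy : x.1 = y.1 := decomposition_uniq m0 ha ex b1O c1 E1 ey b2O c2 E2.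
  case: x y xy {xr yr mx my} ex ey e1 e2 E1 E2 hu1 hu2 hl1 h1 h2 {b1O b2O c1 c2 zu1 zu2 eu1 eu2}.
  move=> x1 x2 [y1 y2] /= -> ex _ e1 e2 E1 E2 hu1 hu2 hl1 h1 h2; congr (_, _).
  have d0 : (0 < m %/ y1)%N by move: m0; rewrite {1}ex muln_gt0 => /andP [].
  have bE : b1 = b2 by apply: (lat_scale_inj (natr_unit k d0)); rewrite -E1.
  rewrite -{}bE in e2.
  apply: (invm_cancel hl1); [by case: hu1|by case: hu2|by rewrite e1 e2].
- move=> a; split.
    move=> [[a' ha] aO].
    have [m' [d [b [b' [mE hb bO cc e]]]]] := ideal_decomposition m0 ha aO.
    have mm : (m' %| m)%N by rewrite mE dvdn_mulr.
    have m0' := dvdn_gt0 m0 mm.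
    have dE : d = (m %/ m')%N by rewrite mE mulKn.
    have [u [u' [hu eu aE]]] := fibre_mem mE ha hb e.
    exists (m', u); last by exists b; [split=> //; exists b'|rewrite -dE].
    apply/allpairsPdep; exists m', u; split=> //; first by rewrite -dvdn_divisors.
    rewrite /U in_fset_set; last exact: finite_Ugroup.
    by apply/mem_set; split=> //; apply: (invm_invertible m0 hu).
  move=> [x /rP [mx ex [u' hu] eu] [b [[b' hb] bO _] <-]].
  exact: (lift_unit_integral ex hb bO hu eu).
- by apply: csummable_terms => // a [[a' ha] _]; apply: (normr_chi m0 hchi ha).
- apply: allpairs_uniq_dep; [exact: divisors_uniq|by move=> *; apply: fset_uniq|].
  by move=> [x1 x2] [y1 y2] _ _ [-> ->].
rewrite big_allpairs_dep [RHS]big_mkcond big_seq [RHS]big_seq; apply: eq_bigr => m' /=.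
rewrite -dvdn_divisors // => mm.
have mE : (m = m' * (m %/ m'))%N by rewrite mulnC divnK.
under eq_big_seq => u hu.
  have [[u' hu'] eu] := UP _ _ mm hu.
  rewrite (csum_fibre mE hu' eu) -mulrA.
  over.
rewrite -mulr_suml sum_Ugroup //.
have [tr|ntr] := asboolP.
  rewrite (conductorP m0 hchi mm).2 // mulrA csum_lift_triv //.
rewrite ifF ?mul0r //; apply/negP => h; apply: ntr; exact: (conductorP m0 hchi mm).1.
Qed.

End Formula.
(** * Integral bases of maximal orders *)

(** The properties of the etale algebra from which the basis is built: two additive maps to the
    rationals that separate points, and no nonzero element of square zero. Additivity is enough,
    because they are applied to integer relations only. *)
Lemma etale_coordinates (k : comUnitAlgType rat) : quadratic_etale k ->
  (exists f g : {additive k -> rat}, forall x, f x = 0 -> g x = 0 -> x = 0) /\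
  (forall x : k, x * x = 0 -> x = 0).
Proof.
case=> [[[v [v' vK _]] hu]|[u [u' uK _]]].
  split.
    pose f (i : 'I_2) (x : k) := v x ord0 i.
    have fB i : zmod_morphism (f i) by move=> x y; rewrite /f raddfB !mxE.
    pose F i : {additive k -> rat} := HB.pack (f i) (GRing.isZmodMorphism.Build _ _ _ (fB i)).
    exists (F ord0), (F ord_max) => x h0 h1.
    apply: (can_inj vK); rewrite raddf0; apply/rowP => i; rewrite !mxE.
    have [->|->] : i = ord0 \/ i = ord_max.
      by case: i => -[|[|//]] p; [left|right]; apply/val_inj.
      exact: h0.
    exact: h1.
  move=> x xx; apply/eqP; case: eqVneq => // /hu ux.
  by have := unitr0 k; rewrite -xx unitrM ux.
split.
  pose f (x : k) := (u x).1; pose g (x : k) := (u x).2.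
  have fB : zmod_morphism f by move=> x y; rewrite /f rmorphB.
  have gB : zmod_morphism g by move=> x y; rewrite /g rmorphB.
  pose F : {additive k -> rat} := HB.pack f (GRing.isZmodMorphism.Build _ _ _ fB).
  pose G : {additive k -> rat} := HB.pack g (GRing.isZmodMorphism.Build _ _ _ gB).
  exists F, G => x h1 h2; apply: (can_inj uK); rewrite rmorph0.
  have : u x = ((u x).1, (u x).2) by case: (u x).
  by rewrite [(u x).1]h1 [(u x).2]h2.
move=> x xx; apply: (can_inj uK); rewrite rmorph0.
have : u x * u x = 0 by rewrite -rmorphM xx rmorph0.
case: (u x) => p q [/eqP hp /eqP hq]; move: hp hq.
by rewrite !mulf_eq0 !orbb => /eqP -> /eqP ->.
Qed.

(** Three elements have dependent coordinates under f and g; clearing denominators gives an integer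
    relation, in which the coefficient of x is nonzero by freeness of b1, b2. *)
Lemma etale_span (k : comUnitAlgType rat) (b1 b2 : k) : quadratic_etale k ->
  (forall p q : rat, p *: b1 + q *: b2 = 0 -> p = 0 /\ q = 0) ->
  forall x : k, exists N : nat, (0 < N)%N /\
    exists i j : int, N%:R * x = i%:~R * b1 + j%:~R * b2.
Proof.
move=> /etale_coordinates [[f [g fg]] _] free x.
have fz (h : {additive k -> rat}) (i : int) y : h (i%:~R * y) = i%:~R * h y.
  by rewrite mulrzl raddfMz mulrzl.
have free' (i j : int) : i%:~R * b1 + j%:~R * b2 = 0 -> i = 0 /\ j = 0.
  move=> h; have [] := free i%:~R j%:~R.
    by rewrite !scaler_int -(mulrzl b1) -(mulrzl b2).
  by move=> /eqP; rewrite intr_eq0 => /eqP -> /eqP; rewrite intr_eq0 => /eqP ->.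
have clear (p q r : rat) : exists (D : int) (p' q' r' : int), [/\ D != 0,
    D%:~R * p = p'%:~R, D%:~R * q = q'%:~R & D%:~R * r = r'%:~R].
  exists (denq p * denq q * denq r), (numq p * denq q * denq r),
    (numq q * denq p * denq r), (numq r * denq p * denq q).
  split; first by rewrite !mulf_neq0 ?denq_neq0.
  - by rewrite !intrM numqE; ring.
  - by rewrite !intrM numqE; ring.
  - by rewrite !intrM numqE; ring.
have dep (a b c : rat) (y1 y2 y3 : k) :
    a * f y1 + b * f y2 + c * f y3 = 0 -> a * g y1 + b * g y2 + c * g y3 = 0 ->
    exists D a' b' c' : int, [/\ D != 0, D%:~R * a = a'%:~R, D%:~R * b = b'%:~R,
      D%:~R * c = c'%:~R & a'%:~R * y1 + b'%:~R * y2 + c'%:~R * y3 = 0].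
  move=> h1 h2; have [D [a' [b' [c' [D0 ea eb ec]]]]] := clear a b c.
  exists D, a', b', c'; split=> //; apply: fg; rewrite !raddfD /= !fz -ea -eb -ec.
    by rewrite -!mulrA -!mulrDr h1 mulr0.
  by rewrite -!mulrA -!mulrDr h2 mulr0.
pose c1 := f b1 * g b2 - f b2 * g b1.
have c10 : c1 != 0.
  apply/eqP => c10.
  (* If the determinant vanishes, (h b2, - h b1) is a relation between b1 and b2, hence zero; then f
     and g vanish at b1, and b1 = 0. *)
  have nz (h : {additive k -> rat}) : (h = f \/ h = g) -> h b1 = 0 /\ h b2 = 0.
    move=> hh.
    have [|| D [a' [b' [c' [D0 ea eb ec e]]]]] := @dep (h b2) (- h b1) 0 b1 b2 0.
    - by case: hh => ->; [|move: c10; rewrite /c1]; lra.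
    - by case: hh => ->; [move: c10; rewrite /c1|]; lra.
    have [a0 b0] : a' = 0 /\ b' = 0 by apply: free'; rewrite -[RHS]e mulr0 addr0.
    rewrite a0 in ea; rewrite b0 in eb.
    split; apply/eqP.
      by move: eb => /eqP; rewrite mulf_eq0 intr_eq0 (negPf D0) oppr_eq0.
    by move: ea => /eqP; rewrite mulf_eq0 intr_eq0 (negPf D0).
  have [f1 _] := nz f (or_introl erefl); have [g1 _] := nz g (or_intror erefl).
  have b10 : b1 = 0 by apply: fg.
  have [] := free' 1 0; last by [].
  by rewrite b10 mulr0 mul0r addr0.
(* The coefficients are the 2 x 2 minors of the coordinates of x, b1, b2. *)
have [|| D [a' [b' [c' [D0 ea eb ec e]]]]] :=
  @dep c1 (f b2 * g x - f x * g b2) (f x * g b1 - f b1 * g x) x b1 b2.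
- by rewrite /c1; ring.
- by rewrite /c1; ring.
have a0 : a' != 0.
  by apply/eqP => a0; move: ea => /eqP; rewrite a0 mulf_eq0 intr_eq0 (negPf D0) (negPf c10).
exists `|a'|%N; rewrite absz_gt0; split=> //.
exists (- (sgz a' * b')), (- (sgz a' * c')).
have -> : (`|a'|%N)%:R = (sgz a')%:~R * a'%:~R :> k by rewrite -intrM -abszEsg.
have ex : a'%:~R * x = - (b'%:~R * b1 + c'%:~R * b2).
  by apply: (addIr (b'%:~R * b1 + c'%:~R * b2)); rewrite addrA e addNr.
by rewrite -mulrA ex; ring.
Qed.

Lemma maximal_order_basis (k : comUnitAlgType rat) (Ok : set k) :
  quadratic_etale k -> is_maximal_order Ok -> exists Q : quadratic_basis k, Ok = ord Q 1.
Proof.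
move=> hk [[[b1 [b2 [free OkE]]] Ok1 OkM] Okmax].
have [_ red] := etale_coordinates hk.
have span := etale_span hk free.
have free' (i j i' j' : int) : i%:~R * b1 + j%:~R * b2 = i'%:~R * b1 + j'%:~R * b2 ->
    i = i' /\ j = j'.
  move=> h; have [] := free (i - i')%:~R (j - j')%:~R.
    rewrite !scaler_int -(mulrzl b1) -(mulrzl b2).
    have -> : (i - i')%:~R * b1 + (j - j')%:~R * b2 =
      (i%:~R * b1 + j%:~R * b2) - (i'%:~R * b1 + j'%:~R * b2) by ring.
    by rewrite h subrr.
  by move=> /eqP; rewrite intr_eq0 subr_eq0 => /eqP -> /eqP; rewrite intr_eq0 subr_eq0 => /eqP ->.
have OkP x : Ok x <-> exists i j : int, x = i%:~R * b1 + j%:~R * b2.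
  by rewrite OkE; split=> -[i [j ->]]; exists i, j; ring.
have [i [j e1]] := (OkP 1).1 Ok1.
have [u [v]] := Bezoutz i j; set g := gcdz i j => huv.
(* 1 is primitive in O_k: if 1 = g e with g = gcd(i, j), then e = g e^2 with e^2 in O_k, so g
   divides the coordinates of e, which are coprime. *)
have cop : u * i + v * j = 1.
  have /dvdzP [i' iE] : (g %| i)%Z by apply: dvdz_gcdl.
  have /dvdzP [j' jE] : (g %| j)%Z by apply: dvdz_gcdr.
  have g0 : g != 0.
    apply/eqP => g0; move: e1; rewrite iE jE g0 !mulr0 !mul0r addr0 => /eqP.
    by rewrite oner_eq0.
  have hij : u * i' + v * j' = 1 by apply: (mulIf g0); rewrite mul1r -{2}huv iE jE; ring.
  pose e : k := i'%:~R * b1 + j'%:~R * b2.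
  have ge : g%:~R * e = 1 by rewrite [RHS]e1 iE jE /e; ring.
  have Oe : Ok e by apply/OkP; exists i', j'.
  have [p [q epq]] := (OkP _).1 (OkM _ _ Oe Oe).
  have [pi qj] : g * p = i' /\ g * q = j'.
    apply: free'; rewrite -/e.
    transitivity (g%:~R * (p%:~R * b1 + q%:~R * b2)); first by ring.
    by rewrite -epq mulrA ge mul1r.
  have : (g %| u * i' + v * j')%Z by rewrite -pi -qj rpredD // mulrCA dvdz_mulr.
  rewrite hij dvdz1 => /eqP g1; rewrite huv; move: g1; rewrite /g /gcdz /= => ->.
  by [].
have eu (r : int) : r%:~R = r%:~R * (i%:~R * b1 + j%:~R * b2) by rewrite -e1 mulr1.
(* Completes 1 to a basis: the matrix with rows (i, j) and (-v, u) has determinant 1. *)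
pose w : k := (- v)%:~R * b1 + u%:~R * b2.
have b1E : b1 = u%:~R - j%:~R * w.
  transitivity ((u * i + v * j)%:~R * b1); first by rewrite cop mul1r.
  by rewrite [u%:~R]eu /w; ring.
have b2E : b2 = v%:~R + i%:~R * w.
  transitivity ((u * i + v * j)%:~R * b2); first by rewrite cop mul1r.
  by rewrite [v%:~R]eu /w; ring.
have OkP' x : Ok x <-> exists p q : int, x = p%:~R + q%:~R * w.
  split=> [/OkP [p [q ->]]|[p [q ->]]].
    exists (p * u + q * v), (q * i - p * j).
    transitivity (p%:~R * (u%:~R - j%:~R * w) + q%:~R * (v%:~R + i%:~R * w)); last by ring.
    by rewrite -b1E -b2E.
  apply/OkP; exists (p * i - q * v), (p * j + q * u).
  by rewrite [p%:~R]eu /w; ring.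
have wfree (p q p' q' : int) : p%:~R + q%:~R * w = p'%:~R + q'%:~R * w -> p = p' /\ q = q'.
  move=> h; have [h1 h2] : p * i - q * v = p' * i - q' * v /\ p * j + q * u = p' * j + q' * u.
    apply: free'.
    have E (r s : int) : (r * i - s * v)%:~R * b1 + (r * j + s * u)%:~R * b2 = r%:~R + s%:~R * w.
      by rewrite [r%:~R]eu /w; ring.
    by rewrite !E.
  have hp : p = u * (p * i - q * v) + v * (p * j + q * u) by rewrite -[LHS]mulr1 -cop; ring.
  have hp' : p' = u * (p' * i - q' * v) + v * (p' * j + q' * u) by rewrite -[LHS]mulr1 -cop; ring.
  have hq : q = i * (p * j + q * u) - j * (p * i - q * v) by rewrite -[LHS]mulr1 -cop; ring.
  have hq' : q' = i * (p' * j + q' * u) - j * (p' * i - q' * v) by rewrite -[LHS]mulr1 -cop; ring.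
  by split; [rewrite hp hp' h1 h2|rewrite hq hq' h1 h2].
have wfree0 (p q : int) : p%:~R + q%:~R * w = 0 -> p = 0 /\ q = 0.
  by move=> h; apply: wfree; rewrite h; ring.
have Ow : Ok w by apply/OkP'; exists 0, 1; ring.
have [n' [t ww']] := (OkP' _).1 (OkM _ _ Ow Ow).
pose n := - n'.
have ww : w * w = t%:~R * w - n%:~R by rewrite ww' /n; ring.
have disc : t ^+ 2 - 4 * n != 0.
  (* If the discriminant vanishes, 2 w - t has square zero, hence is zero, against freeness of 1 and
     w. *)
  apply/eqP => d0; have : 2 * w - t%:~R = 0.
    apply: red; transitivity ((t ^+ 2 - 4 * n)%:~R : k); first by ring: ww.
    by rewrite d0.
  move=> h; have [] := wfree0 (- t) 2; last by [].
  by rewrite -[RHS]h; ring.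
have wspan x : exists N : nat, (0 < N)%N /\ exists p q : int, N%:R * x = p%:~R + q%:~R * w.
  have [N [N0 [p [q E]]]] := span x; exists N; split=> //.
  by apply/OkP'; apply/OkP; exists p, q.
have max (th : k) (g' : nat) (b p q : int) : (0 < g')%N -> g'%:R * th = b%:~R + w ->
    th * th = p%:~R * th - q%:~R -> g' = 1%N.
  move=> g0 gth thth.
  (* Z[th] is an order containing O_k, so it equals O_k; then th has integer coordinates and g'
     divides 1. *)
  pose O' : set k := [set x | exists r s : int, x = 1 *~ r + th *~ s].
  have wE : w = g'%:R * th - b%:~R by rewrite gth addrC addKr.
  have lat : lattice O'.
    exists 1, th; split=> // r s h.
    have [r' [s' [D [D0 er es]]]] : exists r' s' D : int,
        [/\ D != 0, D%:~R * r = r'%:~R & D%:~R * s = s'%:~R].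
      exists (numq r * denq s), (numq s * denq r), (denq r * denq s).
      split; first by rewrite mulf_neq0 ?denq_neq0.
        by rewrite !intrM numqE; ring.
      by rewrite !intrM numqE; ring.
    have h' : r'%:~R + s'%:~R * th = 0.
      move: (congr1 (fun z => D%:~R *: z) h).
      by rewrite scaler0 scalerDr !scalerA er es !scaler_int -(mulrzl th).
    have [] := wfree0 (r' * g'%:Z + s' * b) s'.
      transitivity (g'%:R * (r'%:~R + s'%:~R * th)); last by rewrite h' mulr0.
      transitivity (r'%:~R * g'%:R + s'%:~R * (b%:~R + w)); first by ring.
      by rewrite -gth; ring.
    move=> h1 s0; have r0 : r' = 0 by move: h1 g0; rewrite s0; nia.
    rewrite r0 in er; rewrite s0 in es; split; apply/eqP.
      by move: er => /eqP; rewrite mulf_eq0 intr_eq0 (negPf D0).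
    by move: es => /eqP; rewrite mulf_eq0 intr_eq0 (negPf D0).
  have ord' : is_order O'.
    split=> //; first by exists 1, 0; ring.
    move=> _ _ [r [s ->]] [r' [s' ->]].
    by exists (r * r' - s * s' * q), (r * s' + s * r' + s * s' * p); ring: thth.
  have sub : Ok `<=` O'.
    move=> _ /OkP' [r [s ->]]; rewrite wE.
    by exists (r - s * b), (s * g'%:Z); ring.
  have Oth : Ok th by rewrite -(Okmax _ ord' sub); exists 0, 1; ring.
  have [r [s E]] := (OkP' _).1 Oth.
  have [_ h] : g'%:Z * r = b /\ g'%:Z * s = 1.
    apply: wfree; transitivity (g'%:R * th); first by rewrite E; ring.
    by rewrite gth; ring.
  exact: natz_mul_eq1 h.
exists (QuadraticBasis ww wfree0 wspan disc max).
apply/seteqP; split=> x.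
  by move=> /OkP' [p [q ->]]; exists p, q; rewrite mul1r.
by move=> [p [q ->]]; apply/OkP'; exists p, q; rewrite mul1r.
Qed.

Theorem theorem5p4 (R : realType) (k : comUnitAlgType rat)
    (hk : quadratic_etale k)
    (Ok : set k) (hOk : is_maximal_order Ok)
    (m : nat) (hm : (1 <= m)%N)
    (chi : set (set k) -> R[i]) (hchi : is_character (suborder Ok m) chi)
    (f : nat) (hf : conductor Ok m chi = f) :
  (forall s : R[i], 1 < complex.Re s ->
     Lseries (suborder Ok m) chi s =
     \sum_(m' <- divisors m | (f %| m')%N)
        (set_card (Ugroup (suborder Ok m') (suborder Ok m)))%:R
        / natpowC (m %/ m') (2%:R * s)
        * Lseries_star Ok m' (inducing (suborder Ok m) (suborder Ok m') chi) s) /\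
  (f = m ->
   forall s : R[i], 1 < complex.Re s ->
     Lseries (suborder Ok m) chi s = Lseries_star Ok m chi s).
Proof.
have [Q OkE] := maximal_order_basis hk hOk.
rewrite {Ok hOk}OkE in hchi hf *; rewrite suborder_ord in hchi *; rewrite -{f}hf.
have formula s (s1 : 1 < complex.Re s) := Lseries_formula hm hchi s1.
split=> [s s1|fm s s1].
  by rewrite formula //; apply: eq_bigr => m' _; rewrite suborder_ord.
rewrite formula // fm.
have mm : m \in divisors m by rewrite -dvdn_divisors.
have tr : trivial_on_U Q m chi m by apply: (conductorP hm hchi (dvdnn m)).1; rewrite fm.
rewrite big_mkcond (bigD1_seq m) ?divisors_uniq //= dvdnn.
rewrite [X in _ + X]big_seq_cond [X in _ + X]big1 ?addr0; last first.
  move=> m' /andP []; rewrite -dvdn_divisors // => m'm ne.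
  by rewrite ifF //; apply/negP => mm'; rewrite eqn_dvd m'm mm' in ne.
(* Only m' = m is left in the sum; its coefficient is 1, because an O_m-ideal is its own extension
   to O_m. *)
have UE : Ugroup (ord Q m) (ord Q m) = [set ord Q m].
  apply/seteqP; split=> [a [/invertible_invm [a' [ha _ _]]]|_ ->].
    by rewrite lat_mul_ordr.
  by split; [apply: (invm_invertible hm (invm_ord Q m))|apply: ord_mul].
rewrite UE /set_card fset_set1 cardfs1 divnn hm natpowC1 divr1 mul1r.
rewrite /Lseries_star suborder_ord coprime_idealsE //.
(* [inducing] may differ from chi as a function on sets, but the two agree on the classes of
   invertible ideals. *)
have [_ hi] := inducingP hm hchi (dvdnn m) tr.
apply: eq_csum => b [[b' hb] _ _].
rewrite (hi _ (invm_invertible hm hb)) lat_mul_ordr //.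
by case: hb.
Qed.
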